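(* Let $m_1,m_2,\epsilon\in\mathbb{R}$ satisfy $0<m_2\leq m_1\leq 9m_2$, $m_1\geq\frac{\epsilon}{2}>0$ and $m_2\geq\frac{3\epsilon}{8}$. Then for every energy $c<c_0$, where $c_0$ is the minimum of the first, second and third critical values of the Lagrange problem with parameters $(m_1,m_2,\epsilon)$, each bounded connected component of the regularized energy hypersurface $\overline{\Sigma}_{c,\epsilon}$ arises as the boundary of a strictly monotone toric domain.
   Context: **Lagrange problem.** The Hamiltonian is $H_\epsilon(q,p)=\frac12|p|^2-U_\epsilon(q)$ on $T^*(\mathbb{R}^2\setminus\{e,m\})$, with $e=(-\frac12,0)$, $m=(\frac12,0)$ and $$U_\epsilon(q)=\frac{m_1}{\sqrt{(q_1+\frac12)^2+q_2^2}}+\frac{m_2}{\sqrt{(q_1-\frac12)^2+q_2^2}}+\frac{\epsilon}{2}|q|^2 .$$ Critical points of $H_\epsilon$ are the points $L=(q,p)=(l,0)$ with $l$ a critical point of $U_\epsilon$, and $H_\epsilon(L)=-U_\epsilon(l)$. For $m_1,m_2,\epsilon>0$ there are exactly three critical points of $U_\epsilon$ on the $q_1$-axis, $l_i=(\iota_i,0)$, $i=1,2,3$, with $-\frac12<\iota_1<\frac12$, $\iota_2>\frac12$, $\iota_3<-\frac12$; let $L_i$ be the corresponding critical points of $H_\epsilon$. The first, second and third critical values are $H_\epsilon(L_1),H_\epsilon(L_2),H_\epsilon(L_3)$, and $c_0=\min\{H_\epsilon(L_1),H_\epsilon(L_2),H_\epsilon(L_3)\}$. **Regularization.** Use elliptic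 coordinates $(\mu,\nu)\in\mathbb{R}\times S^1$, $S^1=\mathbb{R}/2\pi\mathbb{Z}$, with $q_1=\frac12\cosh\mu\cos\nu$, $q_2=\frac12\sinh\mu\sin\nu$ (so $e$ corresponds to $(\mu,\nu)=(0,\pi)$ and $m$ to $(0,0)$), together with the conjugate momenta $(p_\mu,p_\nu)$. Put $M_1=m_1+m_2$, $M_2=m_1-m_2$. The function $\frac14(\cosh^2\mu-\cos^2\nu)(H_\epsilon-c)$ extends smoothly to $K_{c,\epsilon}=K^1_{c,\epsilon}+K^2_{c,\epsilon}:T^*(\mathbb{R}\times S^1)\to\mathbb{R}$, where $$K^1_{c,\epsilon}=\tfrac12p_\mu^2-\tfrac{\epsilon}{32}\cosh^4\mu+\tfrac{\epsilon}{32}\cosh^2\mu-\tfrac c4(\cosh^2\mu-1)-\tfrac{M_1}{2}\cosh\mu,$$ $$K^2_{c,\epsilon}=\tfrac12p_\nu^2+\tfrac{\epsilon}{32}\cos^4\nu-\tfrac{\epsilon}{32}\cos^2\nu+\tfrac c4(\cos^2\nu-1)+\tfrac{M_2}{2}\cos\nu .$$ The regularized energy hypersurface is $\overline{\Sigma}_{c,\epsilon}=K_{c,\epsilon}^{-1}(0)\subset T^*(\mathbb{R}\times S^1)$. For $c<c_0$ it has exactly two bounded connected components, $\overline{\Sigma}^e_{c,\epsilon}$ (meeting the fibre over $(0,\pi)$) and $\overline{\Sigma}^m_{c,\epsilon}$ (meeting the fibre over $(0,0)$), plus an unbounded part. **Toric domains.** For a domain $\Omega\subset\mathbb{R}^n_{\geq0}$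 let $X_\Omega=\{z\in\mathbb{C}^n:(\pi|z_1|^2,\dots,\pi|z_n|^2)\in\Omega\}$ (here $n=2$), with the standard symplectic form. Let $\partial_+\Omega$ be the set of $\mu\in\partial\Omega$ with $\mu_j>0$ for all $j$. A strictly monotone toric domain is a compact toric domain $X_\Omega$ with smooth boundary such that, if $\mu\in\partial_+\Omega$ and $v$ is an outward normal vector at $\mu$, then $v_j>0$ for all $j$. **Convention.** A bounded component of $\overline{\Sigma}_{c,\epsilon}$ ''arises as the boundary of $X_\Omega$'' if the compact connected component of $\{K_{c,\epsilon}\le0\}$ it bounds, with the canonical symplectic form of $T^*(\mathbb{R}\times S^1)$, is symplectomorphic to $X_\Omega$ (so that the component corresponds to $\partial X_\Omega$). *)

(* Defs.v *)
From HB Require Import structures.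
From mathcomp Require Import all_boot all_order all_algebra.
From mathcomp Require Import all_classical all_reals all_analysis.

Set Implicit Arguments.
Unset Strict Implicit.
Unset Printing Implicit Defensive.

Import Order.TTheory GRing.Theory Num.Theory.
Import numFieldNormedType.Exports.

Local Open Scope classical_set_scope.
Local Open Scope ring_scope.

Section Smoothness.
Context {R : realType} {V W : normedModType R}.

(* Used only for V and W of finite dimension and U open, where requiring all
   iterated directional derivatives to exist and be continuous on U is the
   usual C^k condition. *)
Fixpoint Ck (k : nat) (U : set V) (f : V -> W) : Prop :=
  (forall x, U x -> {for x, continuous f}) /\
  (if k is k'.+1 then
     forall v, (forall x, U x -> derivable f x v) /\
               Ck k' U (fun x => 'D_v f x)
   else True).

(* For A not open: f is smooth on some open neighbourhood of A, i.e. the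
   values of f outside A are those of a smooth extension. *)
Definition smooth_on (A : set V) (f : V -> W) : Prop :=
  exists U : set V, [/\ open U, A `<=` U & forall k, Ck k U f].

End Smoothness.

Section Boundary.
Context {R : realType} {V : normedModType R}.

Definition boundary (A : set V) : set V := closure A `\` interior A.

Definition local_defining (A : set V) (z : V) (g : V -> R) : Prop :=
  [/\ smooth_on [set z] g,
      \forall w \near z, A w <-> g w <= 0 &
      exists v, 'D_v g z != 0].

(* A is a codimension-0 submanifold with boundary near each boundary point. *)
Definition has_smooth_boundary (A : set V) : Prop :=
  forall z, boundary A z -> exists g, local_defining A z g.

Definition is_component (S A : set V) : Prop :=
  exists2 x, A x & S = connected_component A x.

End Boundary.

Section Symplectomorphism.
Context {R : realType}.

(* A two-form gives at each base point a bilinear form on tangent vectors.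
   A has codimension 0 in V and is the closure of its interior wherever this
   is used, so the derivatives of phi at points of A do not depend on the
   chosen extension. *)
Definition symplectomorphic (V W : normedModType R)
    (A : set V) (omA : V -> V -> V -> R)
    (B : set W) (omB : W -> W -> W -> R) : Prop :=
  exists (phi : V -> W) (psi : W -> V),
    [/\ smooth_on A phi, smooth_on B psi, phi @` A = B,
        forall x, A x -> psi (phi x) = x &
        forall x u v, A x ->
          omB (phi x) ('D_u phi x) ('D_v phi x) = omA x u v].

End Symplectomorphism.

Section ToricDomains.
Context {R : realType} {n : nat}.

(* C^n, with z.1 the real parts and z.2 the imaginary parts. *)
Definition Cn : normedModType R := ('rV[R]_n * 'rV[R]_n)%type.

Definition std_form (_ u v : Cn) : R :=
  \sum_(j < n) (u.1 ord0 j * v.2 ord0 j - u.2 ord0 j * v.1 ord0 j).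

Definition moment (z : Cn) : 'rV[R]_n :=
  \row_(j < n) (pi * (z.1 ord0 j ^+ 2 + z.2 ord0 j ^+ 2)).

Definition toric (Omega : set 'rV[R]_n) : set Cn := moment @^-1` Omega.

(* Domains may contain boundary points: a nonempty connected subset of the
   orthant lying in the closure of its interior. *)
Definition orthant_domain (Omega : set 'rV[R]_n) : Prop :=
  [/\ Omega `<=` [set x | forall j, 0 <= x ord0 j],
      Omega !=set0, connected Omega &
      Omega `<=` closure (interior Omega)].

Definition boundary_plus (Omega : set 'rV[R]_n) : set 'rV[R]_n :=
  boundary Omega `&` [set x | forall j, 0 < x ord0 j].

(* v is the gradient at x of a local defining function; any positive multiple
   of such a function is again one, so this is closed under positive scaling. *)
Definition outward_normal (Omega : set 'rV[R]_n) (x v : 'rV[R]_n) : Prop :=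
  exists2 g : 'rV[R]_n -> R, local_defining Omega x g &
    forall w, 'D_w g x = \sum_(j < n) v ord0 j * w ord0 j.

Definition strictly_monotone (Omega : set 'rV[R]_n) : Prop :=
  [/\ orthant_domain Omega, compact (toric Omega),
      has_smooth_boundary (toric Omega) &
      forall x v, boundary_plus Omega x -> outward_normal Omega x v ->
        forall j, 0 < v ord0 j].

End ToricDomains.
Arguments Cn : clear implicits.

Section Lagrange.
Context {R : realType}.
Variables (m1 m2 eps : R).

Definition U (q : R * R) : R :=
  m1 / Num.sqrt ((q.1 + 2^-1) ^+ 2 + q.2 ^+ 2)
  + m2 / Num.sqrt ((q.1 - 2^-1) ^+ 2 + q.2 ^+ 2)
  + eps / 2 * (q.1 ^+ 2 + q.2 ^+ 2).

Definition H (q p : R * R) : R := 2^-1 * (p.1 ^+ 2 + p.2 ^+ 2) - U q.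

Definition critical_point (f : R * R -> R) (x : R * R) : Prop :=
  differentiable f x /\ forall v, 'd f x v = 0.

(* For positive parameters there is exactly one such triple. *)
Definition lagrange_points (i1 i2 i3 : R) : Prop :=
  [/\ - 2^-1 < i1 < 2^-1, 2^-1 < i2, i3 < - 2^-1 &
      [/\ critical_point U (i1, 0), critical_point U (i2, 0) &
          critical_point U (i3, 0)]].

Definition critical_value (i : R) : R := H (i, 0) (0, 0).

End Lagrange.

Section Regularization.
Context {R : realType}.

(* T^*(R x S^1) sits inside R^5: R/2piZ is identified with the unit circle by
   nu |-> (cos nu, sin nu), and a point is ((mu, (cos nu, sin nu)), (pmu, pnu)). *)
Definition ambient : normedModType R := ((R * (R * R)) * (R * R))%type.

Definition cot (mu nu pmu pnu : R) : ambient :=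
  ((mu, (cos nu, sin nu)), (pmu, pnu)).

Definition phase_space : set ambient :=
  [set z | exists mu nu pmu pnu, z = cot mu nu pmu pnu].

(* d nu = x dy - y dx on the unit circle. *)
Definition dnu (z u : ambient) : R :=
  z.1.2.1 * u.1.2.2 - z.1.2.2 * u.1.2.1.

(* d mu /\ d pmu + d nu /\ d pnu.  With the opposite sign convention one gets
   the same class of toric domains, since complex conjugation preserves every
   toric domain and negates the standard form. *)
Definition canonical_form (z u v : ambient) : R :=
  (u.1.1 * v.2.1 - u.2.1 * v.1.1) + (dnu z u * v.2.2 - u.2.2 * dnu z v).

Definition cosh (x : R) : R := (expR x + expR (- x)) / 2.

Variables (m1 m2 eps c : R).

Definition K1 (mu pmu : R) : R :=
  2^-1 * pmu ^+ 2 - eps / 32 * cosh mu ^+ 4 + eps / 32 * cosh mu ^+ 2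
  - c / 4 * (cosh mu ^+ 2 - 1) - (m1 + m2) / 2 * cosh mu.

Definition K2 (nu pnu : R) : R :=
  2^-1 * pnu ^+ 2 + eps / 32 * cos nu ^+ 4 - eps / 32 * cos nu ^+ 2
  + c / 4 * (cos nu ^+ 2 - 1) + (m1 - m2) / 2 * cos nu.

Definition K (mu nu pmu pnu : R) : R := K1 mu pmu + K2 nu pnu.

Definition regularized_hypersurface : set ambient :=
  [set z | exists mu nu pmu pnu,
     z = cot mu nu pmu pnu /\ K mu nu pmu pnu = 0].

Definition regularized_sublevel : set ambient :=
  [set z | exists mu nu pmu pnu,
     z = cot mu nu pmu pnu /\ K mu nu pmu pnu <= 0].

(* The topological boundary in T^*(R x S^1), which is closed in R^5. *)
Definition boundary_in_phase_space (B : set ambient) : set ambient :=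
  closure B `&` closure (phase_space `\` B).

Definition arises_as_boundary (S : set ambient) (X : set (Cn R 2)) : Prop :=
  exists B : set ambient,
    [/\ is_component B regularized_sublevel, compact B,
        boundary_in_phase_space B = S &
        symplectomorphic X std_form B canonical_form].

End Regularization.

(* Main.v *)
Require Import Defs.
From HB Require Import structures.
From mathcomp Require Import all_boot all_order all_algebra ring lra.
From mathcomp Require Import all_classical all_reals all_analysis.
Set Implicit Arguments.
Unset Strict Implicit.
Unset Printing Implicit Defensive.
Import Order.TTheory GRing.Theory Num.Theory.
Import numFieldNormedType.Exports.
Local Open Scope classical_set_scope.
Local Open Scope ring_scope.

(** The regularized Hamiltonian is a sum of two Hamiltonians of one degree of
    freedom.  In terms of sinh (mu / 2), and of the sine of half the angle from a
    singularity, twice the potential of either one, counted from its minimum, is a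
    function 4 t Q(t) of the square t of the variable, with Q positive: a well with
    a nondegenerate minimum at the singularity.  With energies counted from the bottoms of the wells, the energy
    hypersurface is the level set, at some level b, of a sum of two well energies.
    Below the critical values both wells are deeper than b.  Indeed the rim of the
    outer well is at the maximum beyond 1 of a quartic in cosh mu, so the potential
    there is at least that at the third critical point ([barrier3]); and the rim of
    the inner well is at the maximum over ]-1, 1[ of the negative of a quartic in
    cos nu, so the potential there is at least that at the first critical point
    ([barrier1]).

    One well has symplectic coordinates in a disc in which its energy is an
    increasing function of the squared radius ([well_action_angle]).  These are
    action-angle coordinates, built so as to be visibly smooth at the equilibrium.  A
    substitution turns the energy into a function of the squared distance to the
    origin and the area form into a density that is even in the first coordinate;
    turning each point by a suitable angle makes the density constant along circles
    ([circle_turning]), and a radial dilation then makes it constant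
    ([circle_straightening]).  The product of the coordinates of the two wells
    identifies the sublevel set with a toric domain, given by the condition that
    the energies g1 and g2 of the wells, as functions of the actions, have sum at
    most b.  As g1 and g2 are increasing, so is their sum in each action, and
    the domain is strictly monotone ([toric_sublevel_strictly_monotone]).

    It remains to see that a bounded component of the hypersurface lies above the
    rim of neither well.  Beyond the outer rim the potential decreases, so from
    such a point one can run to infinity along the hypersurface, the momentum taking
    up the loss of potential ([escape]); on the inner rim the energy is too high.
    So the component meets the open window of one of the two singularities.  There
    the level set is connected, and it is open and closed in the hypersurface,
    hence it is the component; the same argument applies to the sublevel set
    ([well_component]).

    A function is called smooth when its iterated directional derivatives are all
    Frechet differentiable.  This class is stable under composition and contains
    integrals depending on parameters ([pintp_smooth]) and solutions of monotone
    scalar equations ([smooth_implicit]); all inverse functions needed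
    are of the latter kind. *)

(** * Differentiability of every order *)
Section Differentiability.
Context {R : realType}.

Lemma is_diff_eps {V W : normedModType R} (f df : V -> W) (x : V) :
  linear df -> continuous df ->
  (forall e, 0 < e -> \forall h \near (0 : V),
     `|f (h + x) - f x - df h| <= e * `|h|) -> is_diff x f df.
Proof.
move=> lin cdf fe.
pose dfM := GRing.isLinear.Build _ _ _ _ _ lin.
pose dfL : {linear V -> W} := HB.pack df dfM.
have fo : f \o shift x = cst (f x) + dfL +o_ (0 : V) id.
  apply/eqaddoP => e e0; move: (fe e e0); apply: filterS => h.
  by rewrite /= !fctE /= opprD addrA.
have dE : 'd f x = dfL :> (V -> W) by exact: diff_unique.
by apply: DiffDef; [apply/diff_locallyP; rewrite dE|exact: dE].
Qed.

Lemma is_diff_lin {V W : normedModType R} (f : V -> W) x :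
  linear f -> continuous f -> is_diff x f f.
Proof.
move=> lf cf; apply: is_diff_eps => // e e0; near=> h.
have -> : f (h + x) = f h + f x by rewrite -[h]scale1r lf !scale1r.
by rewrite addrK subrr normr0 mulr_ge0 // ltW.
Unshelve. all: by end_near. Qed.

Lemma diff_eps {V W : normedModType R} (f : V -> W) (x : V) :
  differentiable f x -> forall e, 0 < e -> \forall h \near (0 : V),
     `|f (h + x) - f x - 'd f x h| <= e * `|h|.
Proof.
move=> /diff_locally /eqaddoP fo e e0; move: (fo e e0); apply: filterS => h.
by rewrite /= !fctE /= opprD addrA.
Qed.

Lemma near_is_diff {V W : normedModType R} (f g df : V -> W) (x : V) :
  (\forall y \near x, f y = g y) -> is_diff x f df -> is_diff x g df.
Proof.
move=> fg [dfx dfE].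
have lin : linear df by rewrite -dfE => a u v; rewrite linearP.
have cont : continuous df by rewrite -dfE; exact: diff_continuous.
apply: is_diff_eps => // e e0.
have := fg; rewrite (near_shift (0 : V)) /= subr0 => fg'.
near=> h.
rewrite -(nbhs_singleton fg).
have <- : f (h + x) = g (h + x) by near: h; exact: fg'.
by near: h; rewrite -dfE; exact: diff_eps.
Unshelve. all: by end_near. Qed.

Lemma deriveE_diff {V W : normedModType R} (f df : V -> W) (x : V) v :
  is_diff x f df -> 'D_v f x = df v.
Proof. by move=> [d <-]; rewrite deriveE. Qed.

Lemma open_near {V : topologicalType} (U : set V) (x : V) : open U -> U x ->
  \forall y \near x, U y.
Proof. by move=> oU Ux; apply: open_nbhs_nbhs. Qed.

(** Iterated directional derivatives, each of them Frechet differentiable: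
    unlike plain continuity of the iterated derivatives, this makes the chain
    rule available at every order. *)
Fixpoint Dk {V W : normedModType R} (k : nat) (U : set V) (f : V -> W) : Prop :=
  (forall x, U x -> differentiable f x) /\
  (if k is k'.+1 then forall v, Dk k' U ('D_v f) else True).

Lemma Dk_diff {V W : normedModType R} k (U : set V) (f : V -> W) x :
  Dk k U f -> U x -> differentiable f x.
Proof. by case: k => [|k] [+ _]; apply. Qed.

Lemma Dk_ext {V W : normedModType R} k (U : set V) (f g : V -> W) :
  open U -> (forall x, U x -> f x = g x) -> Dk k U f -> Dk k U g.
Proof.
move=> oU; elim: k f g => [|k IH] f g fg [df Df].
  split=> // x Ux.
  have [] // : is_diff x g ('d f x).
  apply: (@near_is_diff _ _ f); last by apply: DiffDef => //; exact: df.
  by apply: filterS (open_near oU Ux) => y /fg.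
split=> [x Ux|v].
  have [] // : is_diff x g ('d f x).
  apply: (@near_is_diff _ _ f); last by apply: DiffDef => //; exact: df.
  by apply: filterS (open_near oU Ux) => y /fg.
apply: IH (Df v) => x Ux; apply: near_eq_derive.
by apply: filterS (open_near oU Ux) => y /fg.
Qed.

Lemma DkS {V W : normedModType R} k (U : set V) (f : V -> W) :
  Dk k.+1 U f -> Dk k U f.
Proof.
elim: k f => [|k IH] f [df Df]; first by split.
by split=> // v; apply: IH.
Qed.

Lemma Dk_sub {V W : normedModType R} k (A B : set V) (f : V -> W) :
  A `<=` B -> Dk k B f -> Dk k A f.
Proof.
move=> AB; elim: k f => [|k IH] f [df Df]; split=> //; try by move=> x /AB/df.
by move=> v; exact: IH (Df v).
Qed.

(** The inductive step in all closure properties: the derivative has to be known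
    through its values on [U] only. *)
Lemma DkSE {V W : normedModType R} k (U : set V) (f : V -> W) (g : V -> V -> W) :
  open U -> (forall x, U x -> is_diff x f (g ^~ x)) ->
  (forall v, Dk k U (g v)) -> Dk k.+1 U f.
Proof.
move=> oU fg Dg; split=> [x /fg[]//|v].
by apply: Dk_ext (Dg v) => // x Ux; rewrite (deriveE_diff _ (fg x Ux)).
Qed.

Lemma Dk_is_diff {V W : normedModType R} k (U : set V) (f : V -> W) x :
  Dk k U f -> U x -> is_diff x f (fun v => 'D_v f x).
Proof.
move=> Df Ux; have d := Dk_diff Df Ux; apply: DiffDef => //.
by apply/funext => v; rewrite deriveE.
Qed.

Lemma Dk_cst {V W : normedModType R} k (U : set V) (a : W) :
  open U -> Dk k U (cst a : V -> W).
Proof.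
move=> oU; elim: k a => [|k IH] a; first by split.
apply: (@DkSE _ _ _ _ _ (fun _ => cst 0)) => //.
Qed.

Lemma Dk_lin {V W : normedModType R} k (U : set V) (f : V -> W) :
  open U -> linear f -> continuous f -> Dk k U f.
Proof.
move=> oU lf cf; have df x := is_diff_lin x lf cf.
case: k => [|k]; first by split=> // x _; have [] := df x.
by apply: (@DkSE _ _ _ _ _ (fun v => cst (f v))) => // v; exact: Dk_cst.
Qed.

Lemma Dk_add {V W : normedModType R} k (U : set V) (f g : V -> W) :
  open U -> Dk k U f -> Dk k U g -> Dk k U (fun x => f x + g x).
Proof.
move=> oU; elim: k f g => [|k IH] f g Df Dg.
  split=> // x Ux.
  by apply: differentiableD; [exact: Dk_diff Df Ux|exact: Dk_diff Dg Ux].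
apply: (@DkSE _ _ _ _ _ (fun v x => 'D_v f x + 'D_v g x)) => // [x Ux|v].
  by have ? := Dk_is_diff Df Ux; have ? := Dk_is_diff Dg Ux; exact: is_diffD.
by case: Df Dg => [_ Df] [_ Dg]; exact: IH (Df v) (Dg v).
Qed.

Lemma Dk_opp {V W : normedModType R} k (U : set V) (f : V -> W) :
  open U -> Dk k U f -> Dk k U (fun x => - f x).
Proof.
move=> oU; elim: k f => [|k IH] f Df.
  split=> // x Ux.
  by apply: differentiableN; exact: Dk_diff Df Ux.
apply: (@DkSE _ _ _ _ _ (fun v x => - 'D_v f x)) => // [x Ux|v].
  by have ? := Dk_is_diff Df Ux; exact: is_diffN.
by case: Df => [_ Df]; exact: IH (Df v).
Qed.

Lemma Dk_mul {V : normedModType R} k (U : set V) (f g : V -> R) :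
  open U -> Dk k U f -> Dk k U g -> Dk k U (fun x => f x * g x).
Proof.
move=> oU; elim: k f g => [|k IH] f g Df Dg.
  split=> // x Ux.
  by apply: differentiableM; [exact: Dk_diff Df Ux|exact: Dk_diff Dg Ux].
apply: (@DkSE _ _ _ _ _ (fun v x => f x * 'D_v g x + g x * 'D_v f x)) => // [x Ux|v].
  by have ? := Dk_is_diff Df Ux; have ? := Dk_is_diff Dg Ux; exact: is_diffM.
by apply: Dk_add => //; apply: IH; (try exact: DkS); [case: Dg => [_ Dg]; exact: Dg|case: Df => [_ Df]; exact: Df].
Qed.

Lemma Dk_scalel {V W : normedModType R} k (U : set V) (f : V -> R) (a : W) :
  open U -> Dk k U f -> Dk k U (fun x => f x *: a).
Proof.
move=> oU; elim: k f => [|k IH] f Df.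
  by split=> // x Ux; apply: differentiableZl; exact: Dk_diff Df Ux.
apply: (@DkSE _ _ _ _ _ (fun v x => 'D_v f x *: a)) => // [x Ux|v].
  have d := Dk_diff Df Ux; apply: DiffDef; first exact: differentiableZl.
  by rewrite diffZl//; apply/funext => v /=; rewrite deriveE.
by case: Df => [_ Df]; exact: IH (Df v).
Qed.

Lemma Dk_pair {V W Z : normedModType R} k (U : set V) (f : V -> W) (g : V -> Z) :
  open U -> Dk k U f -> Dk k U g -> Dk k U (fun x => (f x, g x)).
Proof.
move=> oU; elim: k f g => [|k IH] f g Df Dg.
  split=> // x Ux.
  by apply: differentiable_pair; [exact: Dk_diff Df Ux|exact: Dk_diff Dg Ux].
apply: (@DkSE _ _ _ _ _ (fun v x => ('D_v f x, 'D_v g x))) => // [x Ux|v].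
  by have ? := Dk_is_diff Df Ux; have ? := Dk_is_diff Dg Ux; exact: is_diff_pair.
by case: Df Dg => [_ Df] [_ Dg]; exact: IH (Df v) (Dg v).
Qed.

(** Finitely many vectors and continuous coordinate functionals: the only trace
    of finite dimension that the chain rule needs. *)
Definition frame {W : normedModType R} (s : seq (W * (W -> R))) : Prop :=
  (forall e, List.In e s -> linear e.2 /\ continuous e.2) /\
  forall w, w = \sum_(e <- s) e.2 w *: e.1.

Lemma Dk_sum {V W : normedModType R} k (U : set V) (I : Type) (s : seq I)
    (f : I -> V -> W) :
  open U -> (forall i, List.In i s -> Dk k U (f i)) ->
  Dk k U (fun x => \sum_(i <- s) f i x).
Proof.
move=> oU; elim: s => [|i s IH] Df.
  apply: (Dk_ext oU _ (Dk_cst k (0 : W) oU)) => x _; by rewrite big_nil.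
apply: (Dk_ext oU (f := fun x => f i x + \sum_(i <- s) f i x)).
  by move=> x _; rewrite big_cons.
by apply: Dk_add => //; [apply: Df; left|apply: IH => j js; apply: Df; right].
Qed.

Lemma Dk_lin_comp {V W Z : normedModType R} k (U : set V) (f : V -> W) (l : W -> Z) :
  open U -> linear l -> continuous l -> Dk k U f -> Dk k U (fun x => l (f x)).
Proof.
move=> oU ll cl; elim: k f => [|k IH] f Df.
  split=> // x Ux; apply: (differentiable_comp (f := f) (g := l)).
    exact: Dk_diff Df Ux.
  by case: (is_diff_lin (f x) ll cl).
have dl y := is_diff_lin y ll cl.
apply: (@DkSE _ _ _ _ _ (fun v x => l ('D_v f x))) => // [x Ux|v].
  by have ? := Dk_is_diff Df Ux; exact: is_diff_comp.
by case: Df => [_ Df]; exact: IH (Df v).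
Qed.

(** The chain rule at order [k]: by the frame, a directional derivative of the
    composite is a finite sum of products of functions of order [k]. *)
Lemma Dk_comp {V W : normedModType R} k (s : seq (W * (W -> R))) (U : set V) (A : set W)
    (f : V -> W) (g : W -> R) :
  frame s -> open U -> open A -> (forall x, U x -> A (f x)) ->
  Dk k U f -> Dk k A g -> Dk k U (fun x => g (f x)).
Proof.
move=> [sl sE] oU oA fUA; elim: k f g fUA => [|k IH] f g fUA Df Dg.
  split=> // x Ux; apply: (differentiable_comp (f := f) (g := g)).
    exact: Dk_diff Df Ux.
  by apply: Dk_diff Dg _; exact: fUA.
apply: (@DkSE _ _ _ _ _ (fun v x =>
    \sum_(e <- s) e.2 ('D_v f x) * 'D_(e.1) g (f x))) => // [x Ux|v].
  have df := Dk_diff Df Ux; have dg := Dk_diff Dg (fUA _ Ux).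
  apply: DiffDef; first exact: (differentiable_comp (f := f) (g := g)).
  rewrite (diff_comp (f := f) (g := g))//; apply/funext => v /=.
  rewrite -(deriveE v df) [in LHS](sE ('D_v f x)) linear_sum/=.
  by apply: eq_bigr => e _; rewrite linearZ/= -deriveE.
apply: Dk_sum => // e /sl[le ce]; apply: Dk_mul => //.
  by apply: (Dk_lin_comp (l := e.2)) => //; case: Df => _; apply.
by apply: (IH f ('D_(e.1) g)) => //; [exact: DkS|case: Dg => _; apply].
Qed.

Lemma Dk_smoothCk {V W : normedModType R} k (U : set V) (f : V -> W) :
  Dk k U f -> Ck k U f.
Proof.
elim: k f => [|k IH] f [df Df].
  by split=> // x /df; exact: differentiable_continuous.
split=> [x /df|v]; first exact: differentiable_continuous.
by split; [move=> x /df; exact: diff_derivable|exact: IH (Df v)].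
Qed.

End Differentiability.

(** * Smooth functions on open sets *)

Section Smooth.
Context {R : realType}.

Definition smooth {V W : normedModType R} (U : set V) (f : V -> W) : Prop :=
  open U /\ forall k, Dk k U f.

Section Generic.
Context {V W : normedModType R}.
Implicit Types (U : set V) (f g : V -> W).

Lemma smooth_open U f : smooth U f -> open U. Proof. by case. Qed.

Lemma smooth_diff U f x : smooth U f -> U x -> differentiable f x.
Proof. by move=> [_ /(_ 0%N) D]; exact: Dk_diff D. Qed.

Lemma smooth_is_diff U f x : smooth U f -> U x ->
  is_diff x f (fun v => 'D_v f x).
Proof. by move=> [_ /(_ 0%N) D]; exact: Dk_is_diff D. Qed.

Lemma smooth_cont U f x : smooth U f -> U x -> {for x, continuous f}.
Proof. by move=> fU /(smooth_diff fU); exact: differentiable_continuous. Qed.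

Lemma smooth_derive U f v : smooth U f -> smooth U ('D_v f).
Proof. by move=> [oU D]; split=> // k; case: (D k.+1) => _; apply. Qed.

Lemma smooth_ext U f g : (forall x, U x -> f x = g x) -> smooth U f -> smooth U g.
Proof. by move=> fg [oU D]; split=> // k; exact: Dk_ext (D k). Qed.

Lemma smooth_subset U U' f : open U -> U `<=` U' -> smooth U' f -> smooth U f.
Proof. by move=> oU UU [_ D]; split=> // k; exact: Dk_sub UU (D k). Qed.

Lemma smooth_cst U (a : W) : open U -> smooth U (cst a : V -> W).
Proof. by move=> oU; split=> // k; exact: Dk_cst. Qed.

Lemma smooth_add U f g : smooth U f -> smooth U g -> smooth U (fun x => f x + g x).
Proof. by move=> [oU D] [_ E]; split=> // k; exact: Dk_add. Qed.

Lemma smooth_opp U f : smooth U f -> smooth U (fun x => - f x).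
Proof. by move=> [oU D]; split=> // k; exact: Dk_opp. Qed.

Lemma smooth_lin U f : open U -> linear f -> continuous f -> smooth U f.
Proof. by move=> oU l c; split=> // k; exact: Dk_lin. Qed.

Lemma smooth_scalel U (f : V -> R) (a : W) : smooth U f -> smooth U (fun x => f x *: a).
Proof. by move=> [oU D]; split=> // k; exact: Dk_scalel. Qed.

Lemma smooth_Ck U f : smooth U f -> forall k, Ck k U f.
Proof. by move=> [_ D] k; exact: Dk_smoothCk. Qed.

Lemma smooth_pair {Z : normedModType R} U f (g : V -> Z) :
  smooth U f -> smooth U g -> smooth U (fun x => (f x, g x)).
Proof. by move=> [oU D] [_ E]; split=> // k; exact: Dk_pair. Qed.

Lemma smooth_lin_comp {Z : normedModType R} U f (l : W -> Z) :
  linear l -> continuous l -> smooth U f -> smooth U (fun x => l (f x)).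
Proof. by move=> ll cl [oU D]; split=> // k; exact: Dk_lin_comp. Qed.

Lemma smooth_comp (s : seq (W * (W -> R))) U (A : set W) f (g : W -> R) :
  frame s -> (forall x, U x -> A (f x)) -> smooth U f -> smooth A g ->
  smooth U (fun x => g (f x)).
Proof. by move=> fs UA [oU D] [oA E]; split=> // k; exact: Dk_comp fs oU oA UA (D k) (E k). Qed.

(** For a function defined by an equation, whose differential is an expression in
    the function itself: each order of smoothness then yields the next one. *)
Lemma smooth_bootstrap U f (g : V -> V -> W) : open U ->
  (forall x, U x -> is_diff x f (g ^~ x)) ->
  (forall k, Dk k U f -> forall v, Dk k U (g v)) -> smooth U f.
Proof.
move=> oU fg gk; split=> //; elim=> [|k IH].
  by split=> // x /fg[].
by apply: DkSE oU fg _ => v; exact: gk IH v.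
Qed.
End Generic.

Lemma smooth_mul {V : normedModType R} (U : set V) (f g : V -> R) :
  smooth U f -> smooth U g -> smooth U (fun x => f x * g x).
Proof. by move=> [oU D] [_ E]; split=> // k; exact: Dk_mul. Qed.

Lemma smooth_minus {V : normedModType R} (U : set V) (f g : V -> R) :
  smooth U f -> smooth U g -> smooth U (fun x => f x - g x).
Proof. by move=> sf sg; apply: smooth_add => //; exact: smooth_opp. Qed.

Lemma smooth_exp {V : normedModType R} (U : set V) (f : V -> R) n :
  smooth U f -> smooth U (fun x => f x ^+ n).
Proof.
move=> sf; elim: n => [|n IH].
  apply: (smooth_ext (f := cst (1 : R) : V -> R)); first by move=> x _; rewrite expr0.
  by apply: smooth_cst; case: sf.
apply: (smooth_ext (f := fun x => f x * f x ^+ n)); first by move=> x _; rewrite exprS.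
exact: smooth_mul.
Qed.

End Smooth.

(** * Frames and elementary functions *)
Section Elementary.
Context {R : realType}.

Definition frame_R : seq (R * (R -> R)) := [:: (1, id)].

Lemma frame_RP : frame frame_R.
Proof.
split=> [e [<-|//]|w] /=; first by split=> // x; exact: cvg_id.
by rewrite big_cons big_nil addr0 /= /GRing.scale /= mulr1.
Qed.

Definition frame_prod {V W : normedModType R} (s : seq (V * (V -> R)))
    (t : seq (W * (W -> R))) : seq ((V * W) * (V * W -> R)) :=
  map (fun e => ((e.1, 0), e.2 \o fst)) s ++ map (fun e => ((0, e.1), e.2 \o snd)) t.

Lemma frame_prodP {V W : normedModType R} (s : seq (V * (V -> R)))
    (t : seq (W * (W -> R))) : frame s -> frame t -> frame (frame_prod s t).
Proof.
move=> [sl sE] [tl tE]; split=> [e|[v w]].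
  rewrite /frame_prod; move=> /(@List.in_app_or _ _ _ _)[] /(proj1 (List.in_map_iff _ _ _)).
    move=> [d [<- /sl[l c]]] /=; split.
      by move=> a u u'; rewrite /= l.
    by move=> x; apply: continuous_comp; [exact: cvg_fst|exact: c].
  move=> [d [<- /tl[l c]]] /=; split.
    by move=> a u u'; rewrite /= l.
  by move=> x; apply: continuous_comp; [exact: cvg_snd|exact: c].
rewrite big_cat !big_map/=.
have -> : \sum_(i <- s) i.2 v *: (i.1, 0 : W) = (v, 0).
  rewrite [in RHS](sE v); elim: (s) => [|e l IH]; first by rewrite !big_nil.
  by rewrite !big_cons IH; congr pair; rewrite /= ?scaler0 ?addr0.
have -> : \sum_(i <- t) i.2 w *: (0 : V, i.1) = (0, w).
  rewrite [in RHS](tE w); elim: (t) => [|e l IH]; first by rewrite !big_nil.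
  by rewrite !big_cons IH; congr pair; rewrite /= ?scaler0 ?addr0.
by congr pair; rewrite /= ?addr0 ?add0r.
Qed.

Definition frame_RR : seq ((R * R) * (R * R -> R)) := frame_prod frame_R frame_R.
Lemma frame_RRP : frame frame_RR.
Proof. by apply: frame_prodP; exact: frame_RP. Qed.

Section Comp.
Context {V : normedModType R}.
Implicit Types (U : set V) (f : V -> R).

Lemma smooth_comp1 U (A : set R) f (g : R -> R) :
  (forall x, U x -> A (f x)) -> smooth U f -> smooth A g -> smooth U (fun x => g (f x)).
Proof. exact: smooth_comp frame_RP. Qed.

Lemma smooth_comp2 U (A : set (R * R)) f1 f2 (g : R * R -> R) :
  (forall x, U x -> A (f1 x, f2 x)) -> smooth U f1 -> smooth U f2 -> smooth A g ->
  smooth U (fun x => g (f1 x, f2 x)).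
Proof.
by move=> UA s1 s2; apply: (smooth_comp frame_RRP UA); exact: smooth_pair.
Qed.
End Comp.

Lemma is_derive_diff (f : R -> R) (x d : R) : is_derive x 1 f d ->
  is_diff x f (fun v => v * d).
Proof.
move=> fd; have dv : derivable f x 1 by [].
apply: DiffDef; first exact/derivable1_diffP.
by rewrite deriv1E// derive1E (derive_val).
Qed.

Lemma is_diff_derive (f : R -> R) (x : R) (df : R -> R) : is_diff x f df ->
  is_derive x 1 f (df 1).
Proof.
by move=> dfx; apply: DeriveDef; [apply/derivable1_diffP|exact: deriveE_diff].
Qed.

Lemma smooth_is_derive (U : set R) (f : R -> R) x : smooth U f -> U x ->
  is_derive x 1 f ('D_1 f x).
Proof. by move=> sf Ux; exact: is_diff_derive (smooth_is_diff sf Ux). Qed.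

Lemma smooth_1d (U : set R) (f f' : R -> R) : open U ->
  (forall x, U x -> is_derive x 1 f (f' x)) ->
  (forall k, Dk k U f -> Dk k U f') -> smooth U f.
Proof.
move=> oU fd ff'; apply: (@smooth_bootstrap R R R U f (fun v x => v * f' x)) => //.
  by move=> x /fd; exact: is_derive_diff.
move=> k Df v; apply: Dk_mul => //; last exact: ff'.
exact: (Dk_cst k (v : R) oU).
Qed.

Lemma open_neq0 : open [set x : R | x != 0].
Proof.
have -> : [set x : R | x != 0] = ~` [set 0].
  by apply/seteqP; split=> x /=; [move/eqP|move=> h; apply/eqP].
by apply: closed_openC; exact: closed_eq.
Qed.

Lemma smooth_invr : smooth [set x : R | x != 0] GRing.inv.
Proof.
apply: (smooth_1d (f' := fun x => - (x^-1 * x^-1)) open_neq0).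
  move=> x /= x0; have h := @is_deriveV R id x 1 1 x0 _.
  apply: (is_derive_eq (h _)); rewrite /= /GRing.scale /= mulr1.
  by rewrite expr2 invfM.
move=> k D; apply: Dk_opp; first exact: open_neq0.
by apply: Dk_mul => //; exact: open_neq0.
Qed.

Lemma smooth_inv {V : normedModType R} (U : set V) (f : V -> R) :
  smooth U f -> (forall x, U x -> f x != 0) -> smooth U (fun x => (f x)^-1).
Proof. by move=> sf f0; exact: smooth_comp1 f0 sf smooth_invr. Qed.

Lemma smooth_div {V : normedModType R} (U : set V) (f g : V -> R) :
  smooth U f -> smooth U g -> (forall x, U x -> g x != 0) -> smooth U (fun x => f x / g x).
Proof. by move=> sf sg g0; apply: smooth_mul => //; exact: smooth_inv. Qed.

Lemma Dk_inv {V : normedModType R} k (U : set V) (f : V -> R) : open U ->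
  Dk k U f -> (forall x, U x -> f x != 0) -> Dk k U (fun x => (f x)^-1).
Proof. by move=> oU Df f0; apply: Dk_comp frame_RP oU open_neq0 f0 Df _; case: smooth_invr. Qed.

Lemma open_gt0 : open [set x : R | 0 < x]. Proof. exact: open_gt. Qed.

Lemma smooth_sqrtr : smooth [set x : R | 0 < x] (@Num.sqrt R).
Proof.
apply: (smooth_1d (f' := fun x => (2 * Num.sqrt x)^-1) open_gt0).
move=> k D; apply: Dk_inv; first exact: open_gt0.
  apply: Dk_mul => //.
  exact: (Dk_cst k (2 : R) open_gt0).
by move=> x /= x0; rewrite mulf_neq0// gt_eqF// sqrtr_gt0.
Qed.

Lemma smooth_sqrt {V : normedModType R} (U : set V) (f : V -> R) :
  smooth U f -> (forall x, U x -> 0 < f x) -> smooth U (fun x => Num.sqrt (f x)).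
Proof. by move=> sf f0; exact: smooth_comp1 f0 sf smooth_sqrtr. Qed.

Lemma smooth_expR : smooth setT (@expR R).
Proof.
by apply: (smooth_1d (f' := expR) openT) => // x _; exact: is_derive_expR.
Qed.

Lemma smooth_ln : smooth [set x : R | 0 < x] (@ln R).
Proof.
apply: (smooth_1d (f' := GRing.inv) open_gt0) => k _.
apply: (Dk_sub (B := [set x : R | x != 0])) => [x /= /gt_eqF -> //|].
by case: smooth_invr.
Qed.

(** Sine and cosine are derivatives of each other up to sign, so one order is
    gained for both at once. *)
Lemma smooth_sin_cos : smooth setT (@sin R) /\ smooth setT (@cos R).
Proof.
suff D k : Dk k setT (@sin R) /\ Dk k setT (@cos R).
  by split; split=> [|k]; [exact: openT|case: (D k)|exact: openT|case: (D k)].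
have ds x : is_diff x (@sin R) (fun v => v * cos x) by exact: is_derive_diff.
have dc x : is_diff x (@cos R) (fun v => v * - sin x) by exact: is_derive_diff.
elim: k => [|k [IHs IHc]]; first by split; split. 
split.
  apply: (@DkSE R R R k setT _ (fun v x => v * cos x) openT) => // v.
  by apply: Dk_mul => //; [exact: openT|exact: (Dk_cst k (v : R) openT)].
apply: (@DkSE R R R k setT _ (fun v x => v * - sin x) openT) => // v.
apply: Dk_mul => //; [exact: openT|exact: (Dk_cst k (v : R) openT)|].
by apply: Dk_opp => //; exact: openT.
Qed.

Lemma smooth_sin {V : normedModType R} (U : set V) (f : V -> R) :
  smooth U f -> smooth U (fun x => sin (f x)).
Proof. by move=> sf; apply: smooth_comp1 sf (smooth_sin_cos.1). Qed.

Lemma smooth_cos {V : normedModType R} (U : set V) (f : V -> R) :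
  smooth U f -> smooth U (fun x => cos (f x)).
Proof. by move=> sf; apply: smooth_comp1 sf (smooth_sin_cos.2). Qed.

End Elementary.

(** * Scalar implicit functions *)
Section Implicit.
Context {R : realType}.

Lemma cont_pair {T U W : topologicalType} (f : T -> U) (g : T -> W) x :
  {for x, continuous f} -> {for x, continuous g} ->
  {for x, continuous (fun y => (f y, g y))}.
Proof. by move=> cf cg; exact: (cvg_pair cf cg). Qed.

Lemma derivable_itv_cont (f df : R -> R) (a b : R) :
  (forall x, a <= x <= b -> is_derive x 1 f (df x)) -> {within `[a, b], continuous f}.
Proof.
move=> h; apply: derivable_within_continuous => x; rewrite in_itv /= => /h[]//.
Qed.

Lemma mvt (f df : R -> R) (a b : R) : a < b ->
  (forall x, a <= x <= b -> is_derive x 1 f (df x)) ->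
  exists2 c, a < c < b & f b - f a = df c * (b - a).
Proof.
move=> ab h.
have h' x : x \in `]a, b[%R -> is_derive x 1 f (df x).
  by rewrite in_itv /= => /andP[/ltW ? /ltW ?]; apply: h; apply/andP.
have [c] := MVT ab h' (derivable_itv_cont h).
by rewrite in_itv /= => cab E; exists c.
Qed.

Lemma mvt_incr (f df : R -> R) (a b : R) : a < b ->
  (forall x, a <= x <= b -> is_derive x 1 f (df x)) ->
  (forall x, a < x < b -> 0 < df x) -> f a < f b.
Proof.
move=> ab h p; have [c cab E] := mvt ab h.
by rewrite -subr_gt0 E mulr_gt0 ?p// subr_gt0.
Qed.

Lemma slice_derive {V : normedModType R} (F : R * V -> R) t x :
  differentiable F (t, x) ->
  is_derive t 1 (fun t => F (t, x)) ('D_((1, 0) : R * V) F (t, x)).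
Proof.
move=> dF.
have dp : is_diff t (fun t => (t, x) : R * V) (fun v => (v, 0)).
  exact: (@is_diff_pair R R R V id id (cst x) (cst 0)).
have dF' : is_diff (t, x) F (fun v => 'D_v F (t, x)).
  by apply: DiffDef => //; apply/funext => v; rewrite deriveE.
by have := is_diff_derive (is_diff_comp dp dF').
Qed.

Section Statement.
Context {V : normedModType R} (s : seq (V * (V -> R))).
Variables (O : set V) (a b : R) (F : R * V -> R) (sg : V -> R).
Hypothesis fs : frame s.
Hypothesis oO : open O.
Let A := [set q : R * V | a < q.1 < b /\ O q.2].
Hypothesis sF : smooth A F.
Hypothesis F1 : forall q, A q -> 0 < 'D_((1, 0) : R * V) F q.
Hypothesis sgP : forall x, O x -> a < sg x < b /\ F (sg x, x) = 0.

Lemma implicit_slice x t : O x -> a < t < b ->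
  is_derive t 1 (fun t => F (t, x)) ('D_((1, 0) : R * V) F (t, x)).
Proof.
by move=> Ox tab; apply: slice_derive; apply: (smooth_diff sF).
Qed.

Lemma implicit_incr x t t' : O x -> a < t -> t < t' -> t' < b -> F (t, x) < F (t', x).
Proof.
move=> Ox ta tt tb.
apply: (mvt_incr (f := fun t => F (t, x)) (df := fun t => 'D_((1, 0) : R * V) F (t, x))) => //.
  by move=> y /andP[ty yt]; apply: implicit_slice => //; rewrite (lt_le_trans ta ty) (le_lt_trans yt tb).
move=> y /andP[ty yt]; apply: F1; split=> //=.
by rewrite (lt_trans ta ty) (lt_trans yt tb).
Qed.

Lemma implicit_cont_at t x : O x -> a < t < b ->
  (fun y => F (t, y)) y @[y --> x] --> F (t, x).
Proof.
move=> Ox tab; have At : A (t, x) by [].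
apply: (@continuous_comp _ _ _ (fun y => (t, y)) F); last exact: smooth_cont sF At.
by apply: cont_pair; [exact: cvg_cst|exact: cvg_id].
Qed.

(** Monotonicity in the first variable traps the zero between arguments at which
    [F] has opposite signs, and these signs persist for nearby [x]. *)
Lemma implicit_cont x : O x -> {for x, continuous sg}.
Proof.
move=> Ox; apply/cvgrPdist_lt => e e0.
have [/andP[xa xb] Fx] := sgP Ox.
pose d := Num.min (e / 2) (Num.min ((sg x - a) / 2) ((b - sg x) / 2)).
have d0 : 0 < d by rewrite !lt_min; apply/and3P; split; lra.
have [d1 d2 d3] : [/\ d <= e / 2, d <= (sg x - a) / 2 & d <= (b - sg x) / 2].
  by rewrite /d !ge_min !lexx ?orbT.
have lo : F (sg x - d, x) < 0 by rewrite -Fx; apply: implicit_incr => //; lra.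
have hi : 0 < F (sg x + d, x) by rewrite -[ltLHS]Fx; apply: implicit_incr => //; lra.
have clo : F (sg x - d, y) @[y --> x] --> F (sg x - d, x) by apply: implicit_cont_at => //; lra.
have chi : F (sg x + d, y) @[y --> x] --> F (sg x + d, x) by apply: implicit_cont_at => //; lra.
have nlo : \forall y \near x, F (sg x - d, y) < 0 by exact: (cvgr_lt _ clo).
have nhi : \forall y \near x, 0 < F (sg x + d, y) by exact: (cvgr_gt _ chi).
near=> y.
have Oy : O y by near: y; exact: open_near.
have [/andP[ya yb] Fy] := sgP Oy.
have ylo : F (sg x - d, y) < 0 by near: y.
have yhi : 0 < F (sg x + d, y) by near: y.
have h1 : sg x - d < sg y.
  rewrite ltNge; apply/negP; rewrite le_eqVlt => /orP[/eqP E|h].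
    by move: ylo; rewrite -E Fy ltxx.
  have : F (sg y, y) < F (sg x - d, y) by apply: implicit_incr => //; lra.
  by rewrite Fy; lra.
have h2 : sg y < sg x + d.
  rewrite ltNge; apply/negP; rewrite le_eqVlt => /orP[/eqP E|h].
    by move: yhi; rewrite E Fy ltxx.
  have : F (sg x + d, y) < F (sg y, y) by apply: implicit_incr => //; lra.
  by rewrite Fy; lra.
rewrite ltr_norml; lra.
Unshelve. all: by end_near. Qed.

Let c x := 'D_((1, 0) : R * V) F (sg x, x).
Let L x v := - ('D_((0, v) : R * V) F (sg x, x) / c x).

(** The expansion of [F] at a zero bounds the deviation of the increment of [sg]
    from its linear part by a small multiple of that increment, which is absorbed. *)
Lemma implicit_diff x : O x -> is_diff x sg (L x).
Proof.
move=> Ox; have [sgx Fx] := sgP Ox.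
have Ax : A (sg x, x) by [].
have dF := smooth_diff sF Ax.
have c0 : 0 < c x by exact: F1.
have dFE k v : 'd F (sg x, x) (k, v) = k * c x + 'd F (sg x, x) (0, v).
  have -> : (k, v) = k *: (1, 0) + (0, v) :> R * V.
    by congr pair; rewrite /= ?scaler0 ?add0r// addr0 /GRing.scale /= mulr1.
  by rewrite linearD linearZ /= /c deriveE.
have LE v : L x v = - ('d F (sg x, x) (0, v) / c x) by rewrite /L deriveE.
have linL : linear (L x).
  move=> k u v; rewrite !LE.
  have -> : (0, k *: u + v) = k *: (0, u) + (0, v) :> R * V.
    by congr pair; rewrite /= scaler0 add0r.
  have -> : 'd F (sg x, x) (k *: (0, u) + (0, v)) =
    k * 'd F (sg x, x) (0, u) + 'd F (sg x, x) (0, v) by rewrite linearP.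
  by rewrite /GRing.scale /=; ring.
have contL : continuous (L x).
  have -> : L x = (fun v => - ('d F (sg x, x) (0, v) / c x)) by apply/funext => v; rewrite LE.
  move=> v; apply: cvgN; apply: cvgMl.
  apply: (@continuous_comp _ _ _ (fun v : V => (0 : R, v)) ('d F (sg x, x))).
    by apply: cont_pair; [exact: cvg_cst|exact: cvg_id].
  exact: diff_continuous.
pose LM := GRing.isLinear.Build _ _ _ _ _ linL.
pose LL : {linear V -> R} := HB.pack (L x) LM.
have [M M0 LM'] := @linear_lipschitz _ _ _ LL contL.
have {}LM' v : `|L x v| <= M * `|v| by exact: LM'.
apply: is_diff_eps => // e e0.
(* The expansion gives |k h - L x h| <= e2 (|k h| + |h|) for the increment k h; as
   e2 <= 1/2, this implies |k h| <= 2 (M + 1) |h|, whence the factor 2 M + 3. *)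
pose e2 := Num.min (1 / 2) (e / (2 * M + 3)).
have e20 : 0 < e2 by rewrite lt_min divr_gt0//= divr_gt0//; lra.
have e2h : e2 <= 1 / 2 by rewrite ge_min lexx.
have e2e : e2 * (2 * M + 3) <= e.
  by rewrite -ler_pdivlMr; [rewrite ge_min lexx orbT|lra].
have De := diff_eps dF (mulr_gt0 e20 c0).
pose k (h : V) := sg (h + x) - sg x.
have k0 : k h @[h --> (0 : V)] --> (0 : R).
  rewrite -[X in _ --> X](subrr (sg x)); apply: cvgB; last exact: cvg_cst.
  have c1 : (h + x) @[h --> (0 : V)] --> x.
    rewrite -[X in _ --> X]add0r; apply: cvgD; [exact: cvg_id|exact: cvg_cst].
  exact: (cvg_comp _ _ c1 (implicit_cont Ox)).
have kc : (k h, h) @[h --> (0 : V)] --> ((0, 0) : R * V).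
  by apply: (cvg_pair k0); exact: cvg_id.
have nk := kc _ De.
near=> h.
have Oh : O (h + x).
  near: h; have := open_near oO Ox; rewrite (near_shift (0 : V)) /= subr0 => H.
  exact: H.
have [_ Fh] := sgP Oh.
have : `|F ((k h, h) + (sg x, x)) - F (sg x, x) - 'd F (sg x, x) (k h, h)| <=
    e2 * c x * `|(k h, h) : R * V| by near: h; exact: nk.
have -> : (k h, h) + (sg x, x) = (sg (h + x), h + x) by congr pair; rewrite /= /k subrK.
rewrite Fh Fx subrr sub0r normrN dFE.
have nle : `|(k h, h) : R * V| <= `|k h| + `|h|.
  by rewrite prod_normE /= ge_max lerDl lerDr !normr_ge0.
have -> : k h * c x + 'd F (sg x, x) (0, h) = c x * (k h - L x h).
  by rewrite LE; field; rewrite gt_eqF.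
rewrite normrM (gtr0_norm c0) [e2 * _]mulrC -mulrA ler_pM2l// => h1.
have h2 : `|k h - L x h| <= e2 * (`|k h| + `|h|).
  by apply: le_trans h1 _; rewrite ler_pM2l.
have h3 : `|k h| <= `|k h - L x h| + `|L x h| by rewrite -[in leLHS](subrK (L x h) (k h)) ler_normD.
have h4 := LM' h.
have hh := normr_ge0 h; have kk := normr_ge0 (k h).
have h5 : `|k h| <= 2 * (M + 1) * `|h| by nra.
rewrite -/(k h); apply: le_trans h2 _.
by apply: le_trans (ler_wpM2r hh e2e); nra.
Unshelve. all: by end_near. Qed.

(** The differential of the implicit function is a quotient of derivatives of
    [F] along its own graph, so each order of smoothness gives the next one. *)
Lemma smooth_implicit : smooth O sg.
Proof.
apply: (smooth_bootstrap (g := fun v x => L x v) oO implicit_diff) => k Dsg v.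
have Dg : Dk k O (fun x => (sg x, x)).
  apply: Dk_pair => //; apply: Dk_lin => // x; exact: cvg_id.
have fr := frame_prodP frame_RP fs.
have oA : open A by case: sF.
have gA x : O x -> A (sg x, x) by move=> Ox; split=> //; have [] := sgP Ox.
apply: Dk_opp => //; apply: Dk_mul => //.
  exact: (Dk_comp fr oO oA gA Dg ((smooth_derive (0, v) sF).2 k)).
apply: Dk_inv => // [|x Ox]; last by rewrite gt_eqF//; apply: F1; exact: gA.
have sc := smooth_derive ((1, 0) : R * V) sF.
exact: (Dk_comp fr oO oA gA Dg (sc.2 k)).
Qed.

End Statement.
End Implicit.

(** * Integrals over a period, with parameters *)
Section Period.
Context {R : realType}.
Implicit Types (f g F : R -> R).

Definition period : R := 2 * pi.

Lemma period_gt0 : 0 < period.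
Proof. by rewrite mulr_gt0 // pi_gt0. Qed.

Definition pint f : R := \int[lebesgue_measure]_(s in `[0, period]) f s.

Lemma near0_le {V : normedModType R} (r : R) : 0 < r ->
  \forall h \near (0 : V), `|h| <= r.
Proof. by move=> r0; apply: (@cvgr0_norm_le _ _ _ (nbhs (0 : V)) _ id) => //; exact: cvg_id. Qed.

Lemma pint_FTC f F : continuous f ->
  (forall s, 0 <= s <= period -> is_derive s 1 F (f s)) -> pint f = F period - F 0.
Proof.
move=> cf Ff; have p0 := period_gt0.
have cF : {within `[0, period], continuous F} := derivable_itv_cont Ff.
have [_ Fl Fr] : [/\ _, _ & _] := (continuous_within_itvP F p0).1 cF.
rewrite /pint /Rintegral (@continuous_FTC2 _ f F) //.
- exact: continuous_subspaceT.
- split => // x; rewrite in_itv /= => /andP[/ltW x0 /ltW x1].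
  by have [] := Ff x; first exact/andP.
- move=> x; rewrite in_itv /= => /andP[/ltW x0 /ltW x1].
  by rewrite derive1E; apply: derive_val; apply: Ff; rewrite x0.
Qed.

(** Linearity and the mean value property of the integral are read off a primitive. *)
Lemma pint_prim f : continuous f -> exists2 F,
  forall s, 0 <= s <= period -> is_derive s 1 F (f s) & pint f = F period - F 0.
Proof.
move=> cf; have p0 := period_gt0.
pose F x := \int[lebesgue_measure]_(t in `[-1, x]) f t.
have FP s : 0 <= s <= period -> is_derive s 1 F (f s).
  move=> /andP[s0 sp].
  have [] := @continuous_FTC1_closed R f (-1) s (period + 1).
  - by rewrite (le_lt_trans sp)// ltrDl.
  - by apply: continuous_compact_integrable; [exact: segment_compact|exact: continuous_subspaceT].
  - by rewrite (lt_le_trans _ s0)// oppr_lt0.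
  - exact: cf.
  by move=> d E; apply: DeriveDef; [exact: d|rewrite -derive1E; exact: E].
by exists F => //; exact: pint_FTC.
Qed.

Lemma pintD f g : continuous f -> continuous g ->
  pint (fun s => f s + g s) = pint f + pint g.
Proof.
move=> cf cg; have [F Ff ->] := pint_prim cf; have [G Gg ->] := pint_prim cg.
have cfg : continuous (fun s => f s + g s).
  by move=> x; apply: cvgD; [exact: cf|exact: cg].
have FG s : 0 <= s <= period -> is_derive s 1 (fun s => F s + G s) (f s + g s).
  by move=> sp; have ? := Ff s sp; have ? := Gg s sp; exact: is_deriveD.
by rewrite (pint_FTC cfg FG); ring.
Qed.

Lemma pintZ (k : R) f : continuous f -> pint (fun s => k * f s) = k * pint f.
Proof.
move=> cf; have [F Ff ->] := pint_prim cf.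
have cg : continuous (fun s => k * f s) by move=> x; apply: cvgMr; exact: cf.
have kF s : 0 <= s <= period -> is_derive s 1 (fun s => k * F s) (k * f s).
  by move=> sp; have ? := Ff s sp; exact: is_deriveZ.
by rewrite (pint_FTC cg kF); ring.
Qed.

Lemma pint_mean f : continuous f -> exists2 c, 0 < c < period & pint f = f c * period.
Proof.
move=> cf; have [F Ff ->] := pint_prim cf.
by have [c cp ->] := mvt period_gt0 Ff; exists c => //; rewrite subr0.
Qed.

Lemma pint_gt0 f : continuous f -> (forall s, 0 < f s) -> 0 < pint f.
Proof. by move=> cf f0; have [c _ ->] := pint_mean cf; rewrite mulr_gt0// period_gt0. Qed.

Lemma pint_bound f C : continuous f -> (forall s, 0 <= s <= period -> `|f s| <= C) ->
  `|pint f| <= C * period.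
Proof.
move=> cf fC; have [c /andP[c0 c1] ->] := pint_mean cf.
rewrite normrM (gtr0_norm period_gt0) ler_pM2r ?period_gt0//.
by apply: fC; rewrite !ltW.
Qed.

Lemma continuous_bounded f : continuous f ->
  exists2 C, 0 < C & forall s, 0 <= s <= period -> `|f s| <= C.
Proof.
move=> cf; have := @EVT_max R (fun s => `|f s|) 0 period (ltW period_gt0).
case.
  by apply: continuous_subspaceT => x; apply: cvg_norm; exact: cf.
move=> c _ cM; exists (`|f c| + 1); first by rewrite ltr_wpDl.
by move=> s sp; rewrite (le_trans (cM s _)) ?in_itv// lerDl.
Qed.

Lemma mvt_between f df (l u x y : R) : l < x < u -> l < y < u ->
  (forall t, l < t < u -> is_derive t 1 f (df t)) ->
  exists c, [/\ Num.min x y <= c, c <= Num.max x y & f y - f x = df c * (y - x)].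
Proof.
move=> /andP[lx xu] /andP[ly yu] fd; have [xy|yx|<-] := ltgtP x y.
- have [|c /andP[/ltW xc /ltW cy] E] := mvt (f := f) (df := df) xy.
    by move=> t /andP[xt ty]; apply: fd; rewrite (lt_le_trans lx xt) (le_lt_trans ty yu).
  by exists c.
- have [|c /andP[/ltW xc /ltW cy] E] := mvt (f := f) (df := df) yx.
    by move=> t /andP[xt ty]; apply: fd; rewrite (lt_le_trans ly xt) (le_lt_trans ty xu).
  by exists c; split => //; rewrite -opprB E; ring.
- by exists x; split => //; rewrite !subrr mulr0.
Qed.

Lemma taylor1 f df ddf (l u p q B x y : R) : l < p -> q < u ->
  (forall t, l < t < u -> is_derive t 1 f (df t)) ->
  (forall t, l < t < u -> is_derive t 1 df (ddf t)) ->
  (forall t, p <= t <= q -> `|ddf t| <= B) ->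
  p <= x <= q -> p <= y <= q -> `|f y - f x - df x * (y - x)| <= B * (y - x) ^+ 2.
Proof.
move=> lp qu fd dfd ddB /andP[px xq] /andP[py yq].
have inlu t : p <= t <= q -> l < t < u.
  by move=> /andP[pt tq]; rewrite (lt_le_trans lp pt) (le_lt_trans tq qu).
have xlu : l < x < u by apply: inlu; rewrite px.
have ylu : l < y < u by apply: inlu; rewrite py.
have [c [c1 c2 E]] := mvt_between xlu ylu fd.
have pcq : p <= c <= q.
  apply/andP; split; first by rewrite (le_trans _ c1)// le_min px py.
  by rewrite (le_trans c2)// ge_max xq yq.
have [d [d1 d2 E2]] := mvt_between xlu (inlu _ pcq) dfd.
have pdq : p <= d <= q.
  have /andP[pc cq] := pcq.
  apply/andP; split; first by rewrite (le_trans _ d1)// le_min px pc.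
  by rewrite (le_trans d2)// ge_max xq cq.
have -> : f y - f x - df x * (y - x) = ddf d * (c - x) * (y - x).
  by rewrite E -E2; ring.
have hc : `|c - x| <= `|y - x|.
  move: c1 c2; case: (leP x y) => xy c1 c2.
    by rewrite !ger0_norm; lra.
  by rewrite !ler0_norm; lra.
rewrite -(real_normK (num_real (y - x))) expr2 !normrM -mulrA.
by apply: ler_pM; rewrite ?ddB ?mulr_ge0// ler_wpM2r.
Qed.

Section Kernel.
Variables (c1 c2 : R -> R) (l u : R) (U : set (R * R)).
Hypothesis (cc1 : continuous c1) (cc2 : continuous c2) (oU : open U).
Hypothesis Ulu : forall z s, U z -> l < c1 s * z.1 + c2 s * z.2 < u.

(** The argument of [f] is linear in the parameter [z], so that derivatives in [z]
    are integrals of the same form. *)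
Definition pintp (k f : R -> R) (z : R * R) : R :=
  pint (fun s => k s * f (c1 s * z.1 + c2 s * z.2)).

Lemma pintp_arg_cont (z : R * R) : continuous (fun s => c1 s * z.1 + c2 s * z.2).
Proof. by move=> s; apply: cvgD; apply: cvgMl; [exact: cc1|exact: cc2]. Qed.

Lemma pintp_cont (k f : R -> R) z : continuous k -> smooth `]l, u[ f -> U z ->
  continuous (fun s => k s * f (c1 s * z.1 + c2 s * z.2)).
Proof.
move=> ck sf Uz s; apply: cvgM; first exact: ck.
apply: (continuous_comp (f := fun s => c1 s * z.1 + c2 s * z.2) (g := f)).
  exact: pintp_arg_cont.
by apply: (smooth_cont sf); rewrite /= in_itv /=; exact: Ulu.
Qed.

(** The arguments of [f] stay in a compact part of the interval of smoothness, where
    the remainder of the first-order expansion is uniformly quadratic. *)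
Lemma pintp_diff (k f : R -> R) z : continuous k -> smooth `]l, u[ f -> U z ->
  is_diff z (pintp k f) (fun v => v.1 * pintp (fun s => k s * c1 s) ('D_1 f) z
                                + v.2 * pintp (fun s => k s * c2 s) ('D_1 f) z).
Proof.
move=> ck sf Uz; set df := 'D_1 f; pose ddf := 'D_1 df.
have sdf : smooth `]l, u[ df by exact: smooth_derive.
have ck1 : continuous (fun s => k s * c1 s) by move=> s; apply: cvgM; [exact: ck|exact: cc1].
have ck2 : continuous (fun s => k s * c2 s) by move=> s; apply: cvgM; [exact: ck|exact: cc2].
pose a s := c1 s * z.1 + c2 s * z.2.
have ca : {within `[0, period], continuous a} by apply: continuous_subspaceT; exact: pintp_arg_cont.
have [smin _ mP] := EVT_min (ltW period_gt0) ca.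
have [smax smaxI MP] := EVT_max (ltW period_gt0) ca.
have /andP[lm _] := Ulu smin Uz; have /andP[_ Mu] := Ulu smax Uz.
rewrite -/(a smin) in lm; rewrite -/(a smax) in Mu.
pose d := Num.min ((a smin - l) / 2) ((u - a smax) / 2).
have d0 : 0 < d by rewrite lt_min; apply/andP; split; lra.
have [d1 d2] : d <= (a smin - l) / 2 /\ d <= (u - a smax) / 2 by rewrite /d !ge_min !lexx orbT.
pose p := a smin - d; pose q := a smax + d.
have lp : l < p by rewrite /p; lra.
have qu : q < u by rewrite /q; lra.
have aminmax : a smin <= a smax by exact: mP.
have pq : p <= q by rewrite /p /q; lra.
have [B B0 ddB] : exists2 B, 0 < B & forall t, p <= t <= q -> `|ddf t| <= B.
  have [|c _ cM] := @EVT_max R (fun t => `|ddf t|) p q pq.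
    apply: continuous_in_subspaceT => x; rewrite inE /= in_itv /= => /andP[px xq].
    have sddf : smooth `]l, u[ ddf by exact: smooth_derive.
    have xlu : `]l, u[%classic x by rewrite /= in_itv /= (lt_le_trans lp px) (le_lt_trans xq qu).
    by apply: cvg_norm; exact: (smooth_cont sddf xlu).
  exists (`|ddf c| + 1); first by rewrite ltr_wpDl.
  by move=> s sp; rewrite (le_trans (cM s _)) ?in_itv// lerDl.
have [C1 C10 c1C] := continuous_bounded cc1.
have [C2 C20 c2C] := continuous_bounded cc2.
have [K K0 kK] := continuous_bounded ck.
pose C := C1 + C2; have C0 : 0 < C by rewrite addr_gt0.
have KB0 : 0 < K * B * C ^+ 2 * period.
  apply: mulr_gt0; last exact: period_gt0.
  by apply: mulr_gt0; [exact: mulr_gt0|exact: exprn_gt0].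
apply: is_diff_eps.
- by move=> b v w /=; rewrite /GRing.scale /=; ring.
- move=> v; apply: cvgD; apply: cvgMl; [exact: cvg_fst|exact: cvg_snd].
move=> e e0; near=> h.
have hd : C * `|h| <= d.
  rewrite -ler_pdivlMl//; near: h.
  by apply: (near0_le (V := (R * R)%type)); rewrite mulr_gt0// invr_gt0.
have he : `|h| <= e / (K * B * C ^+ 2 * period).
  near: h; apply: (near0_le (V := (R * R)%type)).
  exact: divr_gt0.
have Uhz : U (h + z).
  near: h; have := open_near oU Uz; rewrite (near_shift (0 : R * R)) /= subr0 => H.
  exact: H.
have [h1 h2] : `|h.1| <= `|h| /\ `|h.2| <= `|h|.
  by rewrite prod_normE !le_max !lexx orbT.
pose eta s := c1 s * h.1 + c2 s * h.2.
have etaC s : 0 <= s <= period -> `|eta s| <= C * `|h|.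
  move=> sp; rewrite /eta (le_trans (ler_normD _ _))// !normrM mulrDl lerD// ler_pM ?c1C ?c2C//.
have cdf1 := pintp_cont ck1 sdf Uz; have cdf2 := pintp_cont ck2 sdf Uz.
have cf := pintp_cont ck sf Uz; have cfh := pintp_cont ck sf Uhz.
have cZ (x : R) (g : R -> R) : continuous g -> continuous (fun s => x * g s).
  by move=> cg s; apply: cvgMr; exact: cg.
have cD (g g' : R -> R) : continuous g -> continuous g' -> continuous (fun s => g s + g' s).
  by move=> cg cg' s; apply: cvgD; [exact: cg|exact: cg'].
have c12 := cD _ _ (cZ h.1 _ cdf1) (cZ h.2 _ cdf2).
have call := cD _ _ (cD _ _ cfh (cZ (-1) _ cf)) (cZ (-1) _ c12).
have -> : pintp k f (h + z) - pintp k f z -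
    (h.1 * pintp (fun s => k s * c1 s) df z + h.2 * pintp (fun s => k s * c2 s) df z) =
    pint (fun s => k s * f (c1 s * (h + z).1 + c2 s * (h + z).2) +
      -1 * (k s * f (c1 s * z.1 + c2 s * z.2)) +
      -1 * (h.1 * (k s * c1 s * df (c1 s * z.1 + c2 s * z.2)) +
            h.2 * (k s * c2 s * df (c1 s * z.1 + c2 s * z.2)))).
  rewrite (pintD (cD _ _ cfh (cZ (-1) _ cf)) (cZ (-1) _ c12)) (pintD cfh (cZ (-1) _ cf)).
  rewrite (pintZ (-1) cf) (pintZ (-1) c12) (pintD (cZ h.1 _ cdf1) (cZ h.2 _ cdf2)).
  by rewrite (pintZ h.1 cdf1) (pintZ h.2 cdf2) /pintp; ring.
apply: (@le_trans _ _ ((K * (B * (C * `|h|) ^+ 2)) * period)); last first.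
  rewrite ler_pdivlMr// in he.
  have := ler_wpM2r (normr_ge0 h) he.
  by apply: le_trans; rewrite le_eqVlt; apply/orP; left; apply/eqP; ring.
apply: pint_bound; first exact: call.
move=> s sp.
have sE : s \in `[0, period] by rewrite in_itv.
have asm : a smin <= a s <= a smax by rewrite mP// MP.
have ash : c1 s * (h + z).1 + c2 s * (h + z).2 = a s + eta s by rewrite /a /eta /=; ring.
rewrite ash -/(a s).
have -> : k s * f (a s + eta s) + -1 * (k s * f (a s)) +
  -1 * (h.1 * (k s * c1 s * df (a s)) + h.2 * (k s * c2 s * df (a s))) =
  k s * (f (a s + eta s) - f (a s) - df (a s) * (a s + eta s - a s)).
  by rewrite /eta; ring.
rewrite normrM ler_pM// ?kK//.
have ed := le_trans (etaC s sp) hd; rewrite ler_norml in ed.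
have fd t : l < t < u -> is_derive t 1 f (df t).
  by move=> tlu; apply: smooth_is_derive sf _; rewrite /= in_itv.
have dfd t : l < t < u -> is_derive t 1 df (ddf t).
  by move=> tlu; apply: smooth_is_derive sdf _; rewrite /= in_itv.
have pq1 : p <= a s <= q by rewrite /p /q; lra.
have pq2 : p <= a s + eta s <= q by rewrite /p /q; lra.
apply: le_trans (taylor1 lp qu fd dfd ddB pq1 pq2) _.
rewrite ler_pM2l// addrAC subrr add0r -(real_normK (num_real (eta s))).
by rewrite ler_sqr ?nnegrE ?etaC// mulr_ge0// ltW.
Unshelve. all: by end_near. Qed.

(** Differentiating the integral reproduces integrals of the same shape, with the
    kernel multiplied by a coefficient: this makes one estimate enough for all
    orders. *)
Lemma pintp_smooth (k f : R -> R) : continuous k -> smooth `]l, u[ f -> smooth U (pintp k f).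
Proof.
move=> ck sf; split=> // n; elim: n k f ck sf => [|n IH] k f ck sf.
  by split=> // z Uz; have [] := pintp_diff ck sf Uz.
have ck1 : continuous (fun s => k s * c1 s) by move=> s; apply: cvgM; [exact: ck|exact: cc1].
have ck2 : continuous (fun s => k s * c2 s) by move=> s; apply: cvgM; [exact: ck|exact: cc2].
apply: (DkSE oU (fun z Uz => pintp_diff ck sf Uz)) => v.
have sdf : smooth `]l, u[ ('D_1 f) by exact: smooth_derive.
apply: Dk_add => //; apply: Dk_mul => //; (try exact: IH).
- exact: (@Dk_cst R (R * R)%type R n U v.1 oU).
- exact: (@Dk_cst R (R * R)%type R n U v.2 oU).
Qed.

End Kernel.
End Period.

(** * Area-multiplying diffeomorphisms of the plane *)
Section Plane.
Context {R : realType}.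
Notation plane := (R * R)%type.
Implicit Types (z u v : plane).

Lemma is_diff_is_derive {V W : normedModType R} (f df : V -> W) x (w : V) :
  is_diff x f df -> is_derive x w f (df w).
Proof. by move=> d; apply: DeriveDef; [exact: diff_derivable|exact: deriveE_diff]. Qed.

Lemma is_derive_lin {V W : normedModType R} (f : V -> W) (x v : V) :
  linear f -> continuous f -> is_derive x v f (f v).
Proof. by move=> lf cf; exact: is_diff_is_derive v (is_diff_lin x lf cf). Qed.

Lemma is_derive_pair {V W Z : normedModType R} (f : V -> W) (g : V -> Z) x w a b :
  is_derive x w f a -> is_derive x w g b ->
  is_derive x w (fun y => (f y, g y)) (a, b).
Proof.
move=> [df <-] [dg <-]; have h := cvg_pair df dg.
apply: DeriveDef; first by apply/cvg_ex; exists ('D_w f x, 'D_w g x); exact: h.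
by apply: cvg_lim; [exact: norm_hausdorff|exact: h].
Qed.

Lemma derive_pairE {V W Z : normedModType R} (f : V -> W) (g : V -> Z) x w a b :
  is_derive x w f a -> is_derive x w g b -> 'D_w (fun y => (f y, g y)) x = (a, b).
Proof. by move=> df dg; have h := is_derive_pair df dg; exact: derive_val. Qed.

Lemma fst_continuous {V W : topologicalType} : continuous (fst : V * W -> V).
Proof. by move=> p; exact: cvg_fst. Qed.

Lemma snd_continuous {V W : topologicalType} : continuous (snd : V * W -> W).
Proof. by move=> p; exact: cvg_snd. Qed.

Lemma is_derive_fst (z w : plane) : is_derive z w (fun z : plane => z.1) w.1.
Proof. by apply: (is_derive_lin (f := fst)) => //; exact: fst_continuous. Qed.

Lemma is_derive_snd (z w : plane) : is_derive z w (fun z : plane => z.2) w.2.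
Proof. by apply: (is_derive_lin (f := snd)) => //; exact: snd_continuous. Qed.

Lemma smooth_proj1 {V W Z : normedModType R} (U : set V) (f : V -> W * Z) :
  smooth U f -> smooth U (fun x => (f x).1).
Proof. by move=> sf; apply: smooth_lin_comp sf => //; exact: fst_continuous. Qed.

Lemma smooth_proj2 {V W Z : normedModType R} (U : set V) (f : V -> W * Z) :
  smooth U f -> smooth U (fun x => (f x).2).
Proof. by move=> sf; apply: smooth_lin_comp sf => //; exact: snd_continuous. Qed.

Lemma smooth_id {V : normedModType R} (U : set V) : open U -> smooth U (id : V -> V).
Proof. by move=> oU; apply: smooth_lin => // x; exact: cvg_id. Qed.

Lemma is_derive_proj1 {V W Z : normedModType R} (f df : V -> W * Z) x w :
  is_diff x f df -> is_derive x w (fun y => (f y).1) (df w).1.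
Proof.
move=> d; have l := @is_diff_lin _ _ _ (fst : W * Z -> W) (f x) (fun _ _ _ => erefl) fst_continuous.
exact: is_diff_is_derive w (is_diff_comp d l).
Qed.

Lemma is_derive_proj2 {V W Z : normedModType R} (f df : V -> W * Z) x w :
  is_diff x f df -> is_derive x w (fun y => (f y).2) (df w).2.
Proof.
move=> d; have l := @is_diff_lin _ _ _ (snd : W * Z -> Z) (f x) (fun _ _ _ => erefl) snd_continuous.
exact: is_diff_is_derive w (is_diff_comp d l).
Qed.

Lemma is_derive_chain {V : normedModType R} (f : V -> R) (g : R -> R) x w a b :
  differentiable f x -> is_derive x w f a -> is_derive (f x) 1 g b ->
  is_derive x w (fun y => g (f y)) (a * b).
Proof.
move=> d h1 h2; have i : is_diff x f ('d f x) by apply: DiffDef.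
have := is_diff_is_derive w (is_diff_comp i (is_derive_diff h2)) => h.
by apply: (is_derive_eq h) => /=; rewrite -deriveE// (derive_val (is_derive := h1)).
Qed.

Lemma derive_coord (u : plane) (a : plane -> R) z (da : plane -> R) :
  is_diff z a da ->
  'D_u a z = u.1 * 'D_((1, 0) : plane) a z + u.2 * 'D_((0, 1) : plane) a z.
Proof.
move=> d; have d' : differentiable a z by [].
rewrite !deriveE// [in LHS](_ : u = u.1 *: (1, 0) + u.2 *: (0, 1) :> plane).
  by rewrite linearD !linearZ.
by case: u => x y; congr pair; rewrite /= /GRing.scale /= ?mulr0 ?mulr1 ?addr0 ?add0r.
Qed.

Lemma open_strip {V : normedModType R} (a b : R) (O : set V) : open O ->
  open [set q : R * V | a < q.1 < b /\ O q.2].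
Proof.
move=> oO.
have -> : [set q : R * V | a < q.1 < b /\ O q.2] = fst @^-1` `]a, b[%classic `&` snd @^-1` O.
  by apply/seteqP; split=> q; rewrite /= in_itv.
have cf : continuous (fst : R * V -> R) by move=> q; exact: cvg_fst.
have cs : continuous (snd : R * V -> V) by move=> q; exact: cvg_snd.
by apply: openI; apply: open_comp.
Qed.

(** Used for the squared radius as a function of the energy of a well: the
    interval contains the range of energies in its interior, so that smoothness at
    both ends of that range makes sense. *)
Record inverse_pair (f g : R -> R) (a b : R) : Prop := InversePair {
  ip_smooth : smooth `]a, b[ f;
  ip_inv_smooth : smooth `]f a, f b[ g;
  ip_inv : forall y, f a < y < f b -> a < g y < b /\ f (g y) = y;
  ip_fun : forall t, a < t < b -> f a < f t < f b /\ g (f t) = t;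
  ip_derive : forall t, a < t < b -> 0 < 'D_1 f t }.

(** The inverse solves f(t) - y = 0; the larger interval gives the solution room at
    the ends of the smaller one. *)
Lemma smooth_inverse (f : R -> R) (lo lo' hi' hi : R) :
  lo < lo' -> lo' < hi' -> hi' < hi -> smooth `]lo, hi[ f ->
  (forall t, lo < t < hi -> 0 < 'D_1 f t) ->
  exists g : R -> R, inverse_pair f g lo' hi'.
Proof.
move=> lolo lohi hihi sf f1.
have fd t : lo < t < hi -> is_derive t 1 f ('D_1 f t).
  by move=> tI; apply: smooth_is_derive sf _; rewrite /= in_itv.
have incr s t : lo < s -> s < t -> t < hi -> f s < f t.
  move=> ls st th; apply: (mvt_incr st (df := 'D_1 f)) => [x /andP[sx xt]|x /andP[sx xt]].
    by apply: fd; lra.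
  by apply: f1; lra.
have ex y : exists t, f lo' < y < f hi' -> lo' < t < hi' /\ f t = y.
  have [yI|nyI] := boolP (f lo' < y < f hi'); last by exists 0.
  have cf : {within `[lo', hi'], continuous f}.
    by apply: (derivable_itv_cont (df := 'D_1 f)) => x xI; apply: fd; lra.
  have := IVT (ltW lohi) cf (v := y).
  have le1 := incr lo' hi' lolo lohi hihi.
  rewrite (min_l (ltW le1)) (max_r (ltW le1)) => /(_ _)[|t].
    by case/andP: yI => /ltW -> /ltW ->.
  rewrite in_itv /= => /andP[lt th] fty; exists t => _; split => //.
  rewrite !lt_neqAle lt th !andbT; apply/andP; split; apply/eqP => E.
    by move: yI; rewrite -fty -E ltxx.
  by move: yI; rewrite -fty E ltxx andbF.
have [g gP] := choice ex.
exists g; split => //; last by move=> t tI; apply: f1; lra.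
- apply: smooth_subset sf; first exact: interval_open.
  by move=> t; rewrite /= !in_itv /= => tI; lra.
- pose O := `]f lo', f hi'[%classic : set R.
  have oO : open O by exact: interval_open.
  pose F (q : R * R) := f q.1 - q.2.
  pose A := [set q : R * R | lo < q.1 < hi /\ O q.2].
  have oA : open A by exact: open_strip.
  have sF : smooth A F.
    apply: smooth_minus.
      apply: (smooth_comp1 (A := `]lo, hi[%classic) (f := fst)) => //.
        by move=> q [+ _]; rewrite /= in_itv.
      by apply: smooth_lin => // q; exact: cvg_fst.
    by apply: smooth_lin => // q; exact: cvg_snd.
  apply: (smooth_implicit (a := lo) (b := hi) frame_RP oO sF) => [[t y] [/= tI yO]|y].
    have dF := slice_derive (smooth_diff sF (conj tI yO : A (t, y))).
    rewrite -(derive_val (is_derive := dF)).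
    have h : is_derive t 1 (fun t => f t - y) ('D_1 f t).
      have ? := fd t tI; have := @is_deriveB R R R f (cst y) t 1 ('D_1 f t) 0.
      by rewrite subr0; apply.
    by rewrite (derive_val (is_derive := h)); exact: f1.
  rewrite /O /= in_itv /= => /gP[/andP[l1 h1] E]; split; first by lra.
  by rewrite /F /= E subrr.
move=> t /andP[lt th].
have flt : f lo' < f t by apply: incr => //; lra.
have fth : f t < f hi' by apply: incr => //; lra.
have fI : f lo' < f t < f hi' by rewrite flt.
split => //; have [/andP[gl gh] E] := gP _ fI.
have [lt1|gt1|//] := ltgtP (g (f t)) t.
  have : f (g (f t)) < f t by apply: incr => //; lra.
  by rewrite E ltxx.
have : f t < f (g (f t)) by apply: incr => //; lra.
by rewrite E ltxx.
Qed.

Definition area u v : R := u.1 * v.2 - u.2 * v.1.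

Definition area_diffeo (A B : set plane) (Phi Psi : plane -> plane) (J : plane -> R) :=
  [/\ smooth A Phi, smooth B Psi,
      forall z, A z -> B (Phi z) /\ Psi (Phi z) = z,
      forall z, B z -> A (Psi z) /\ Phi (Psi z) = z &
      forall z u v, A z -> area ('D_u Phi z) ('D_v Phi z) = J z * area u v].

Lemma smooth_comp22 {V : normedModType R} (U : set V) (A : set plane)
    (f : V -> plane) (g : plane -> plane) :
  (forall x, U x -> A (f x)) -> smooth U f -> smooth A g -> smooth U (fun x => g (f x)).
Proof.
move=> UA sf sg.
have g1 : smooth A (fun z => (g z).1) by apply: smooth_lin_comp sg => // z; exact: cvg_fst.
have g2 : smooth A (fun z => (g z).2) by apply: smooth_lin_comp sg => // z; exact: cvg_snd.
apply: (smooth_ext (f := fun x => ((g (f x)).1, (g (f x)).2))).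
  by move=> x _; case: (g (f x)).
by apply: smooth_pair; [exact: smooth_comp frame_RRP UA sf g1|exact: smooth_comp frame_RRP UA sf g2].
Qed.

(** The identity Phi (Psi z) = z can be differentiated, as it holds on an open set. *)
Lemma area_diffeo_inv A B Phi Psi J : area_diffeo A B Phi Psi J ->
  forall z u v, B z -> J (Psi z) * area ('D_u Psi z) ('D_v Psi z) = area u v.
Proof.
move=> [sP sQ PQ QP aJ] z u v Bz.
have [Az E] := QP _ Bz.
rewrite -(aJ _ _ _ Az).
have dQ := smooth_is_diff sQ Bz; have dP := smooth_is_diff sP Az.
have h w : 'D_('D_w Psi z) Phi (Psi z) = w.
  have := deriveE_diff w (is_diff_comp dQ dP) => /= <-.
  rewrite (near_eq_derive (g := id)) ?derive_id//.
  by apply: filterS (open_near (smooth_open sQ) Bz) => y /QP[].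
exact: congr2 (h u) (h v).
Qed.

Lemma area_diffeo_comp A B C Phi Psi J Phi' Psi' J' :
  area_diffeo A B Phi Psi J -> area_diffeo B C Phi' Psi' J' ->
  area_diffeo A C (Phi' \o Phi) (Psi \o Psi') (fun z => J' (Phi z) * J z).
Proof.
move=> [sP sQ PQ QP aJ] [sP' sQ' PQ' QP' aJ']; split.
- by apply: smooth_comp22 sP sP' => x /PQ[].
- by apply: smooth_comp22 sQ' sQ => x /QP'[].
- by move=> z /PQ[Bz E]; have [Cz E'] := PQ' _ Bz; split => //=; rewrite E'.
- by move=> z /QP'[Bz E]; have [Cz E'] := QP _ Bz; split => //=; rewrite E'.
- move=> z u v Az; have [Bz _] := PQ _ Az.
  have dP := smooth_is_diff sP Az; have dP' := smooth_is_diff sP' Bz.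
  have h w := deriveE_diff w (is_diff_comp dP dP').
  by rewrite !h /= aJ'// aJ// mulrA.
Qed.

Definition nrm2 z : R := z.1 ^+ 2 + z.2 ^+ 2.
Definition disc (b : R) : set plane := [set z | nrm2 z < b].

Lemma nrm2_ge0 z : 0 <= nrm2 z. Proof. by rewrite addr_ge0 ?sqr_ge0. Qed.

Lemma smooth_fst (U : set plane) : open U -> smooth U (fun z => z.1 : R).
Proof. by move=> oU; apply: smooth_lin => // q; exact: cvg_fst. Qed.

Lemma smooth_snd (U : set plane) : open U -> smooth U (fun z => z.2 : R).
Proof. by move=> oU; apply: smooth_lin => // q; exact: cvg_snd. Qed.

Lemma smooth_nrm2 (U : set plane) : open U -> smooth U nrm2.
Proof.
by move=> oU; apply: smooth_add; apply: smooth_exp; [exact: smooth_fst|exact: smooth_snd].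
Qed.

Lemma open_preim {V : normedModType R} (f : V -> R) (A : set R) :
  smooth setT f -> open A -> open (f @^-1` A).
Proof. by move=> sf; apply: open_comp => x _; exact: smooth_cont sf _. Qed.

Lemma disc_open b : open (disc b).
Proof.
have -> : disc b = nrm2 @^-1` [set x : R | x < b] by [].
by apply: open_preim; [apply: smooth_nrm2; exact: openT|exact: open_lt].
Qed.

Definition rot (s : R) z : plane := (cos s * z.1 - sin s * z.2, sin s * z.1 + cos s * z.2).

Lemma nrm2_rot s z : nrm2 (rot s z) = nrm2 z.
Proof.
have := cos2Dsin2 s => E; rewrite /nrm2 /=.
have -> : (cos s * z.1 - sin s * z.2) ^+ 2 + (sin s * z.1 + cos s * z.2) ^+ 2 =
  (cos s ^+ 2 + sin s ^+ 2) * (z.1 ^+ 2 + z.2 ^+ 2) by ring.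
by rewrite E mul1r.
Qed.

Lemma rotD s t z : rot s (rot t z) = rot (s + t) z.
Proof. by rewrite /rot /= cosD sinD; congr pair; ring. Qed.

Lemma rot0 z : rot 0 z = z.
Proof. by case: z => x y; rewrite /rot /= cos0 sin0; congr pair; ring. Qed.

Lemma smooth_rot {V : normedModType R} (U : set V) (a x y : V -> R) :
  smooth U a -> smooth U x -> smooth U y -> smooth U (fun p => rot (a p) (x p, y p)).
Proof.
move=> sa sx sy; have sc := smooth_cos sa; have ss := smooth_sin sa.
by apply: smooth_pair => /=; [apply: smooth_minus|apply: smooth_add]; exact: smooth_mul.
Qed.

Lemma is_derive_rot (s : R) z :
  is_derive s 1 (fun s : R => (rot s z).1) (- (rot s z).2) /\
  is_derive s 1 (fun s : R => (rot s z).2) (rot s z).1.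
Proof.
rewrite /rot /=; split.
  apply: is_derive_eq; rewrite /GRing.scale /=; ring.
apply: is_derive_eq; rewrite /GRing.scale /=; ring.
Qed.

Lemma unit_angle (a b : R) : a ^+ 2 + b ^+ 2 = 1 -> exists t, cos t = a /\ sin t = b.
Proof.
move=> ab; have a1 : -1 <= a <= 1 by nra.
have sb : Num.sqrt (1 - a ^+ 2) = `|b| by rewrite -ab addrAC subrr add0r sqrtr_sqr.
have [b0|b0] := leP 0 b.
  by exists (acos a); rewrite acosK// sin_acos// sb ger0_norm.
by exists (- acos a); rewrite cosN sinN acosK// sin_acos// sb ltr0_norm// opprK.
Qed.

Lemma polar z : exists t, z = rot t (Num.sqrt (nrm2 z), 0).
Proof.
pose r := Num.sqrt (nrm2 z).
have [r0|rN0] := eqVneq r 0.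
  exists 0; rewrite rot0 -/r r0.
  have : nrm2 z = 0 by apply/eqP; rewrite eq_le nrm2_ge0 -sqrtr_eq0 -/r r0 eqxx.
  by case: z {r r0} => x y; rewrite /nrm2 /= => E; congr pair; nra.
have r2 : r ^+ 2 = nrm2 z by rewrite sqr_sqrtr// nrm2_ge0.
have [|t [ct st]] := @unit_angle (z.1 / r) (z.2 / r).
  by rewrite !expr_div_n -mulrDl -/(nrm2 z) r2 divff// -r2 expf_neq0.
exists t; rewrite /rot /= -/r ct st !mulr0 subr0 addr0 !divfK//.
by case: (z).
Qed.
End Plane.

(** * Averaging a density along circles *)
Section Turning.
Context {R : realType}.
Notation plane := (R * R)%type.
Variables (j : R -> R) (y0 b' y1 : R).
Hypotheses (y00 : y0 < 0) (b'0 : 0 < b') (b'y1 : b' < y1).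
Hypothesis sj : smooth `]y0, y1[ j.
Hypothesis j0 : forall y, y0 < y < y1 -> 0 < j y.

Let r1 := Num.sqrt y1.
Let y10 : 0 < y1. Proof. exact: lt_trans b'y1. Qed.
Let r10 : 0 < r1. Proof. by rewrite sqrtr_gt0. Qed.
Let r1E : r1 ^+ 2 = y1. Proof. by rewrite sqr_sqrtr// ltW. Qed.

Let J (w : R) := j (w ^+ 2).

Let sqr_lt w : - r1 < w < r1 -> w ^+ 2 < y1.
Proof. by move=> h; rewrite -r1E; nra. Qed.

Let sqr_lt' w : w ^+ 2 < y1 -> - r1 < w < r1.
Proof.
rewrite -r1E -ltr_norml -[w ^+ 2](real_normK (num_real w)).
by rewrite (ltr_pXn2r (n := 2)) ?nnegrE ?normr_ge0 ?ltW.
Qed.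

Let sJ : smooth `]- r1, r1[ J.
Proof.
have oI : open (`]- r1, r1[%classic : set R) by exact: interval_open.
apply: (smooth_comp1 (A := `]y0, y1[%classic) (f := fun w : R => w ^+ 2)) => //.
  move=> w; rewrite /= !in_itv /= => /sqr_lt ->; rewrite andbT.
  by rewrite (lt_le_trans y00)// sqr_ge0.
by apply: smooth_exp; apply: smooth_lin => // q; exact: cvg_id.
Qed.

Let J0 w : w ^+ 2 < y1 -> 0 < J w.
Proof. by move=> h; apply: j0; rewrite h (lt_le_trans y00)// sqr_ge0. Qed.

Let U := disc y1.
Let oU : open U := @disc_open R y1.

Let c1 : R -> R := cos.
Let c2 (s : R) : R := - sin s.
Let cc1 : continuous c1. Proof. exact: continuous_cos. Qed.
Let cc2 : continuous c2. Proof. by move=> s; apply: cvgN; exact: continuous_sin. Qed.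

Let argE s (z : plane) : c1 s * z.1 + c2 s * z.2 = (rot s z).1.
Proof. by rewrite /c1 /c2 /= mulNr. Qed.

Let rot1_lt s z : U z -> (rot s z).1 ^+ 2 < y1.
Proof.
move=> Uz; apply: le_lt_trans Uz; rewrite -(nrm2_rot s z) /nrm2.
by rewrite lerDl sqr_ge0.
Qed.

Let Ulu (z : plane) s : U z -> - r1 < c1 s * z.1 + c2 s * z.2 < r1.
Proof. by move=> Uz; rewrite argE; apply: sqr_lt'; exact: rot1_lt. Qed.

Let T k f := pintp c1 c2 k f.
Let M : plane -> R := T (cst 1) J.
Let N : plane -> R := T id J.

Let sM : smooth U M.
Proof. by apply: (pintp_smooth cc1 cc2 oU Ulu) => // s; exact: cvg_cst. Qed.
Let sN : smooth U N.
Proof. by apply: (pintp_smooth cc1 cc2 oU Ulu) => // s; exact: cvg_id. Qed.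

Let cJrot z : U z -> continuous (fun s : R => J (rot s z).1).
Proof.
move=> Uz; have c1' : continuous (fun _ : R => 1 : R) by move=> s; exact: cvg_cst.
have := pintp_cont cc1 cc2 Ulu c1' sJ Uz.
have -> : (fun s : R => 1 * J (c1 s * z.1 + c2 s * z.2)) = (fun s : R => J (rot s z).1).
  by apply/funext => s; rewrite mul1r argE.
by [].
Qed.

Let ME z : M z = pint (fun s : R => J (rot s z).1).
Proof. by rewrite /M /T /pintp; congr pint; apply/funext => s; rewrite argE mul1r. Qed.

Let NE z : N z = pint (fun s : R => s * J (rot s z).1).
Proof. by rewrite /N /T /pintp; congr pint; apply/funext => s; rewrite argE. Qed.

Let M_gt0 z : U z -> 0 < M z.
Proof.
by move=> Uz; rewrite ME; apply: pint_gt0 => [|s]; [exact: cJrot|apply: J0; exact: rot1_lt].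
Qed.

Let iz z : plane := (- z.2, z.1).

Let is_derive_Jrot z (s : R) : U z ->
  is_derive s 1 (fun s : R => J (rot s z).1) ('D_1 J (rot s z).1 * - (rot s z).2).
Proof.
move=> Uz; have [d1 _] := is_derive_rot s z.
have dJ : is_derive (rot s z).1 1 J ('D_1 J (rot s z).1).
  by apply: smooth_is_derive sJ _; rewrite /= in_itv /=; apply: sqr_lt'; exact: rot1_lt.
have := is_diff_derive (is_diff_comp (is_derive_diff d1) (is_derive_diff dJ)).
by rewrite /= mul1r mulrC.
Qed.

(** Rotating the point is shifting the integration variable, so the derivative
    along the circle is the integral of a derivative. *)
Let T_rot (k dk : R -> R) z : continuous k -> continuous dk ->
  (forall s : R, is_derive s 1 k (dk s)) -> U z ->
  'D_(iz z) (T k J) z = k period * J z.1 - k 0 * J z.1 - T dk J z.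
Proof.
move=> ck cdk dk' Uz.
rewrite (deriveE_diff _ (pintp_diff cc1 cc2 oU Ulu ck sJ Uz)) /=.
have sdJ : smooth `]- r1, r1[ ('D_1 J) by exact: smooth_derive.
have ck1 : continuous (fun s => k s * c1 s) by move=> s; apply: cvgM; [exact: ck|exact: cc1].
have ck2 : continuous (fun s => k s * c2 s) by move=> s; apply: cvgM; [exact: ck|exact: cc2].
have cA := pintp_cont cc1 cc2 Ulu ck1 sdJ Uz.
have cB := pintp_cont cc1 cc2 Ulu ck2 sdJ Uz.
have cC := pintp_cont cc1 cc2 Ulu cdk sJ Uz.
have cZ (x : R) (g : R -> R) : continuous g -> continuous (fun s => x * g s).
  by move=> cg s; apply: cvgMr; exact: cg.
have cD (g g' : R -> R) : continuous g -> continuous g' -> continuous (fun s => g s + g' s).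
  by move=> cg cg' s; apply: cvgD; [exact: cg|exact: cg'].
have cAB := cD _ _ (cZ (- z.2) _ cA) (cZ z.1 _ cB).
have FF s : 0 <= s <= period -> is_derive s 1 (fun s : R => k s * J (rot s z).1)
    (- z.2 * (k s * c1 s * 'D_1 J (c1 s * z.1 + c2 s * z.2)) +
     z.1 * (k s * c2 s * 'D_1 J (c1 s * z.1 + c2 s * z.2)) +
     dk s * J (c1 s * z.1 + c2 s * z.2)).
  move=> _; have h1 := is_derive_Jrot s Uz; have h2 := dk' s.
  apply: is_derive_eq; rewrite !argE /GRing.scale /= /c1 /c2; ring.
have E := pint_FTC (cD _ _ cAB cC) FF.
rewrite (pintD cAB cC) (pintD (cZ (- z.2) _ cA) (cZ z.1 _ cB)) in E.
rewrite (pintZ (- z.2) cA) (pintZ z.1 cB) in E.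
rewrite /T /pintp; have -> : k period * J z.1 = k period * J (rot period z).1.
  by rewrite /rot /= /period mulr_natl cos2pi sin2pi mul0r mul1r subr0.
have -> : k 0 * J z.1 = k 0 * J (rot 0 z).1 by rewrite rot0.
by rewrite -E; ring.
Qed.

Let M_rot z : U z -> 'D_(iz z) M z = 0.
Proof.
move=> Uz; rewrite /M (@T_rot _ (cst 0))//; try by move=> s; exact: cvg_cst.
rewrite subrr sub0r /T /pintp.
have -> : (fun s : R => cst 0 s * J (c1 s * z.1 + c2 s * z.2)) = (fun s : R => 0 * 0).
  by apply/funext => s; rewrite /cst !mul0r.
by rewrite pintZ ?mul0r ?oppr0// => s; exact: cvg_cst.
Qed.

Let N_rot z : U z -> 'D_(iz z) N z = period * J z.1 - M z.
Proof.
move=> Uz; rewrite /N (@T_rot _ (cst 1))//; try by move=> s; exact: cvg_cst.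
  by rewrite mul0r subr0.
by move=> s; exact: cvg_id.
Qed.

Let rotU t z : U z -> U (rot t z).
Proof. by rewrite /U /disc /= nrm2_rot. Qed.

Let orbit_derive (g : plane -> R) z (t : R) : smooth U g -> U z ->
  is_derive t 1 (fun t : R => g (rot t z)) ('D_(iz (rot t z)) g (rot t z)).
Proof.
move=> sg Uz; have dg := smooth_is_diff sg (rotU t Uz).
have [d1 d2] := is_derive_rot t z.
have dp := is_diff_pair (is_derive_diff d1) (is_derive_diff d2).
have rE : (fun t : R => ((rot t z).1, (rot t z).2)) = (fun t : R => rot t z) by [].
rewrite rE in dp.
have := is_diff_derive (is_diff_comp dp dg).
by rewrite /= !mul1r.
Qed.

Let M_inv t z : U z -> M (rot t z) = M z.
Proof.
move=> Uz; rewrite -[in RHS](rot0 z).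
apply: (@is_derive_0_is_cst R (fun t : R => M (rot t z))) => s.
by have := @orbit_derive M z s sM Uz; rewrite M_rot//; exact: rotU.
Qed.

(** [N / M] is the average of the angle over the circle through [z], weighted by the
    density at the point turned by that angle.  Moving [z] along the circle shifts the
    angle, so that the derivative of this average gives back the density
    ([delta_rot]). *)
Let delta z := N z / M z - pi.

Let sdelta : smooth U delta.
Proof.
apply: smooth_minus; last exact: (smooth_cst (pi : R) oU).
by apply: smooth_div => // z /M_gt0; rewrite lt0r => /andP[].
Qed.

Let delta_rot z : U z -> 1 + 'D_(iz z) delta z = period * J z.1 / M z.
Proof.
move=> Uz; have M0 := M_gt0 Uz.
have i1 := is_diff_is_derive (iz z) (smooth_is_diff sdelta Uz).
have i2 := is_diff_is_derive (iz z) (smooth_is_diff sM Uz).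
have i3 := is_deriveM (is_deriveD i1 (is_derive_cst (pi : R) z (iz z))) i2.
have /= := derive_val (is_derive := i3).
rewrite (near_eq_derive (f := (delta + cst pi) * M) (g := N)); last first.
  apply: filterS (open_near oU Uz) => y Uy.
  change ((N y / M y - pi + pi) * M y = N y).
  by rewrite subrK divfK// gt_eqF// M_gt0.
rewrite M_rot// N_rot// scaler0 add0r addr0 /GRing.scale /= => E.
have -> : period * J z.1 = M z * 'D_(iz z) delta z + M z by rewrite -E subrK.
by field; rewrite gt_eqF.
Qed.

(** [N / M] is a weighted average of angles between 0 and [period]. *)
Let delta_bound z : U z -> - pi <= delta z <= pi.
Proof.
move=> Uz; have M0 := M_gt0 Uz.
have N0 : 0 <= N z.
  rewrite NE; have [|c /andP[c0 _] ->] := @pint_mean R (fun s => s * J (rot s z).1).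
    by move=> s; apply: cvgM; [exact: cvg_id|exact: cJrot].
  have Jc := J0 (rot1_lt c Uz); have pp := @period_gt0 R.
  by apply: mulr_ge0; [apply: mulr_ge0|]; exact: ltW.
have N1 : N z <= period * M z.
  rewrite -subr_ge0 NE ME -pintZ; last exact: cJrot.
  rewrite -[- pint _]mulN1r -pintZ; last first.
    by move=> s; apply: cvgM; [exact: cvg_id|exact: cJrot].
  have cA : continuous (fun s : R => period * J (rot s z).1).
    by move=> s; apply: cvgMr; exact: cJrot.
  have cB : continuous (fun s : R => -1 * (s * J (rot s z).1)).
    by move=> s; apply: cvgMr; apply: cvgM; [exact: cvg_id|exact: cJrot].
  rewrite -pintD//.
  have [|c /andP[_ c0] ->] := @pint_mean R (fun s : R => period * J (rot s z).1 + -1 * (s * J (rot s z).1)).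
    by move=> s; apply: cvgD; [exact: cA|exact: cB].
  apply: mulr_ge0; last by rewrite ltW// period_gt0.
  have -> : period * J (rot c z).1 + -1 * (c * J (rot c z).1) = (period - c) * J (rot c z).1 by ring.
  by rewrite mulr_ge0// ?subr_ge0 ltW//; apply: J0; exact: rot1_lt.
have d0 : 0 <= N z / M z by rewrite divr_ge0// ltW.
have d1 : N z / M z <= period by rewrite ler_pdivrMr.
by rewrite /delta; move: d0 d1; rewrite /period; lra.
Qed.

Let Phi2 z := rot (delta z) z.

(** As [Phi2 (rot s z)] is [rot (G (s, z)) z], the inverse of [Phi2] is found by solving
    G (s, z) = 0 for s. *)
Let G (q : R * plane) := q.1 + delta (rot q.1 q.2).

Let sG : smooth [set q : R * plane | - (pi + 1) < q.1 < pi + 1 /\ U q.2] G.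
Proof.
set A := [set q : R * plane | _]; have oA : open A by exact: open_strip.
have s1 : smooth A (fun q : R * plane => q.1) by apply: smooth_lin => // q; exact: cvg_fst.
have s2 : smooth A (fun q : R * plane => q.2) by apply: smooth_lin => // q; exact: cvg_snd.
have s21 : smooth A (fun q : R * plane => q.2.1).
  by apply: (smooth_lin_comp (l := fst) _ _ s2) => // q; exact: cvg_fst.
have s22 : smooth A (fun q : R * plane => q.2.2).
  by apply: (smooth_lin_comp (l := snd) _ _ s2) => // q; exact: cvg_snd.
apply: smooth_add => //.
apply: (smooth_comp frame_RRP (A := U)) sdelta => //.
  by move=> q [_ Uq]; exact: rotU.
apply: (smooth_ext (f := fun q : R * plane => rot q.1 (q.2.1, q.2.2))).
  by move=> [s [x y]].
exact: smooth_rot.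
Qed.

Let G_slice (s : R) z : U z -> is_derive s 1 (fun s : R => G (s, z))
  (period * J (rot s z).1 / M (rot s z)).
Proof.
move=> Uz; rewrite -delta_rot; last exact: rotU.
have := orbit_derive s sdelta Uz => h.
exact: (is_deriveD (f := id)).
Qed.

Let G_pos s z : U z -> 0 < period * J (rot s z).1 / M (rot s z).
Proof.
move=> Uz; apply: divr_gt0; last exact/M_gt0/rotU.
by apply: mulr_gt0; [exact: period_gt0|exact/J0/rot1_lt].
Qed.

Let G_incr s t z : U z -> s < t -> G (s, z) < G (t, z).
Proof.
move=> Uz st; apply: (mvt_incr (f := fun s : R => G (s, z)) st
  (df := fun s => period * J (rot s z).1 / M (rot s z))) => x _.
  exact: G_slice.
exact: G_pos.
Qed.

Let ex_sg z : exists s, U z -> - (pi + 1) < s < pi + 1 /\ G (s, z) = 0.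
Proof.
have [Uz|nU] := pselect (U z); last by exists 0.
have p0 := pi_gt0 R.
have pp : - (pi : R) <= pi by lra.
have cG : {within `[- pi, pi], continuous (fun s : R => G (s, z))}.
  by apply: (derivable_itv_cont (df := fun s => period * J (rot s z).1 / M (rot s z))) => x _; exact: G_slice.
have := IVT pp cG (v := 0).
have /andP[a1 a2] := delta_bound (rotU (- pi) Uz).
have /andP[b1 b2] := delta_bound (rotU pi Uz).
have l0 : G (- pi, z) <= 0 by rewrite /G /=; lra.
have h0 : 0 <= G (pi, z) by rewrite /G /=; lra.
have lh := le_trans l0 h0.
rewrite (min_l lh) (max_r lh) => /(_ _)[|s]; first exact/andP.
by rewrite in_itv /= => sI E; exists s => _; split => //; lra.
Qed.

Let sg := projT1 (choice ex_sg).
Let sgP z : U z -> - (pi + 1) < sg z < pi + 1 /\ G (sg z, z) = 0.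
Proof. exact: projT2 (choice ex_sg) z. Qed.

Let ssg : smooth U sg.
Proof.
apply: (smooth_implicit (frame_RRP) oU sG) => [[s z] [/= sI Uz]|z Uz]; last exact: sgP.
have dG : is_derive s 1 (fun s : R => G (s, z)) ('D_((1, 0) : R * plane) G (s, z)).
  by have h := slice_derive (smooth_diff sG (conj sI Uz : _ (s, z))); exact: h.
rewrite -(derive_val (is_derive := dG)) (derive_val (is_derive := G_slice s Uz)).
exact: G_pos.
Qed.

Let Psi2 z := rot (sg z) z.

Let smooth_turn (A : set plane) (a : plane -> R) : smooth A a ->
  smooth A (fun z => rot (a z) z).
Proof.
move=> sa; have oA := smooth_open sa.
apply: (smooth_ext (f := fun z : plane => rot (a z) (z.1, z.2))); first by move=> [].
by apply: smooth_rot => //; [exact: smooth_fst|exact: smooth_snd].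
Qed.

(** Rotations preserve area, and the variation of the angle matters only in the
    direction of the circle. *)
Let turn_area (a : plane -> R) z u v : smooth U a -> U z ->
  area ('D_u (fun z => rot (a z) z) z) ('D_v (fun z => rot (a z) z) z) =
  (1 + 'D_(iz z) a z) * area u v.
Proof.
move=> sa Uz; have da := smooth_is_diff sa Uz.
have ac := is_diff_comp da (is_derive_diff (is_derive_cos (a z))).
have as' := is_diff_comp da (is_derive_diff (is_derive_sin (a z))).
have h w : 'D_w (fun z => rot (a z) z) z =
  (cos (a z) * w.1 - sin (a z) * w.2 - (rot (a z) z).2 * 'D_w a z,
   sin (a z) * w.1 + cos (a z) * w.2 + (rot (a z) z).1 * 'D_w a z).
  have i1 : is_derive z w (cos \o a) ('D_w a z * - sin (a z)) := is_diff_is_derive w ac.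
  have i2 : is_derive z w (sin \o a) ('D_w a z * cos (a z)) := is_diff_is_derive w as'.
  have i3 := is_derive_fst z w; have i4 := is_derive_snd z w.
  apply: derive_pairE.
    apply: (is_derive_eq (is_deriveB (is_deriveM i1 i3) (is_deriveM i2 i4))).
    by rewrite /GRing.scale /=; ring.
  apply: (is_derive_eq (is_deriveD (is_deriveM i2 i3) (is_deriveM i1 i4))).
  by rewrite /GRing.scale /=; ring.
have aL : 'D_(iz z) a z = - z.2 * 'D_((1, 0) : plane) a z + z.1 * 'D_((0, 1) : plane) a z.
  exact: derive_coord.
have cs := cos2Dsin2 (a z).
rewrite !h /area /= aL (derive_coord u da) (derive_coord v da).
rewrite [RHS](_ : _ = (cos (a z) ^+ 2 + sin (a z) ^+ 2) *
  ((1 + (- z.2 * 'D_((1, 0) : plane) a z + z.1 * 'D_((0, 1) : plane) a z)) *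
   (u.1 * v.2 - u.2 * v.1))); last by rewrite cs mul1r.
by ring.
Qed.

Let U' := disc b'.
Let oU' : open U' := @disc_open R b'.
Let U'U z : U' z -> U z. Proof. by move=> h; exact: lt_trans h b'y1. Qed.

Let diffeo2 : area_diffeo U' U' Phi2 Psi2 (fun z => period * J z.1 / M z).
Proof.
have GE z : U z -> sg z + delta (rot (sg z) z) = 0 by move=> /sgP[].
split.
- by apply: smooth_turn; apply: smooth_subset sdelta.
- by apply: smooth_turn; apply: smooth_subset ssg.
- move=> z U'z; have Uz := U'U U'z; split; first by rewrite /U' /disc /= nrm2_rot.
  have U2 : U (Phi2 z) by exact: rotU.
  have E : G (- delta z, Phi2 z) = 0.
    by rewrite /G /Phi2 /= rotD addNr rot0 addNr.
  have [_ E'] := sgP U2.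
  have -> : Psi2 (Phi2 z) = rot (- delta z) (Phi2 z).
    congr rot; have [h|h|//] := ltgtP (sg (Phi2 z)) (- delta z).
      by have := G_incr U2 h; rewrite E E' ltxx.
    by have := G_incr U2 h; rewrite E E' ltxx.
  by rewrite /Phi2 rotD addNr rot0.
- move=> z U'z; have Uz := U'U U'z; split; first by rewrite /U' /disc /= nrm2_rot.
  by rewrite /Phi2 /Psi2 rotD addrC GE// rot0.
- move=> z u v U'z; have Uz := U'U U'z.
  by rewrite /Phi2 turn_area// delta_rot.
Qed.

Lemma circle_mean_rot t z : disc y1 z ->
  pint (fun s => j ((rot s (rot t z)).1 ^+ 2)) = pint (fun s => j ((rot s z).1 ^+ 2)).
Proof. by move=> Uz; have := M_inv t Uz; rewrite !ME. Qed.

Lemma circle_mean_gt0 z : disc y1 z -> 0 < pint (fun s => j ((rot s z).1 ^+ 2)).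
Proof. by move=> Uz; have := M_gt0 Uz; rewrite ME. Qed.

(** Turning each point by an angle that depends on it replaces a density by its mean
    over circles.  This is the angle coordinate of a system of one degree of
    freedom, written so that its smoothness at the equilibrium is visible. *)
Lemma circle_turning : exists Phi Psi : plane -> plane,
  (forall z, nrm2 (Phi z) = nrm2 z) /\
  area_diffeo (disc b') (disc b') Phi Psi
    (fun z => period * j (z.1 ^+ 2) / pint (fun s => j ((rot s z).1 ^+ 2))).
Proof.
exists Phi2, Psi2; split; first by move=> z; exact: nrm2_rot.
have [? ? ? ? aJ] := diffeo2; split => // z u v h.
by rewrite aJ// ME.
Qed.

End Turning.

(** * Straightening a density on a disc *)
Section Radial.
Context {R : realType}.
Notation plane := (R * R)%type.
Variables (j : R -> R) (y0 b' y1 : R).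
Hypotheses (y00 : y0 < 0) (b'0 : 0 < b') (b'y1 : b' < y1).
Hypothesis sj : smooth `]y0, y1[ j.
Hypothesis j0 : forall y, y0 < y < y1 -> 0 < j y.

Let y10 : 0 < y1. Proof. exact: lt_trans b'y1. Qed.
Let J (w : R) := j (w ^+ 2).
Let U := disc y1.
Let oU : open U := @disc_open R y1.
Let U' := disc b'.
Let oU' : open U' := @disc_open R b'.
Let U'U z : U' z -> U z. Proof. by move=> h; exact: lt_trans h b'y1. Qed.
Let M (z : plane) := pint (fun s : R => J (rot s z).1).
Let ME z : M z = pint (fun s : R => J (rot s z).1). Proof. by []. Qed.
Let M_inv t z : U z -> M (rot t z) = M z. Proof. exact: (circle_mean_rot y00 b'0 b'y1 sj). Qed.
Let M_gt0 z : U z -> 0 < M z. Proof. exact: (circle_mean_gt0 y00 b'0 b'y1 sj j0). Qed.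

Let cq (s : R) : R := cos s ^+ 2.
Let sq (s : R) : R := sin s ^+ 2.
Let co : R -> R := cst 0.
Let ccq : continuous cq.
Proof. by move=> s; apply: cvgM; exact: continuous_cos. Qed.
Let csq : continuous sq.
Proof. by move=> s; apply: cvgM; exact: continuous_sin. Qed.
Let cco : continuous co. Proof. by move=> s; exact: cvg_cst. Qed.
Let c1s : continuous (cst 1 : R -> R). Proof. by move=> s; exact: cvg_cst. Qed.

Let strip := [set z : plane | y0 < z.1 < y1].
Let ostrip : open strip.
Proof.
have -> : strip = [set z : plane | y0 < z.1 < y1 /\ setT z.2].
  by apply/seteqP; split=> z //= [].
exact: open_strip openT.
Qed.

Let cq01 s : 0 <= cq s <= 1.
Proof.
have := cos2Dsin2 s; have := sqr_ge0 (cos s); have := sqr_ge0 (sin s).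
by rewrite /cq; lra.
Qed.

Let stripP (z : plane) s : strip z -> y0 < cq s * z.1 + co s * z.2 < y1.
Proof.
rewrite /strip /= /co /cst mul0r addr0 => /andP[z0 z1]; have /andP[q0 q1] := cq01 s.
have [h|/ltW h] := leP 0 z.1.
  have h1 := mulr_ge0 q0 h; have h2 := ler_wpM2r h q1; rewrite mul1r in h2.
  by rewrite (lt_le_trans y00 h1) (le_lt_trans h2 z1).
have h1 := mulr_ge0_le0 q0 h; have h2 := ler_wnM2r h q1; rewrite mul1r in h2.
by rewrite (lt_le_trans z0 h2) (le_lt_trans h1 y10).
Qed.

Let Q k f (rho : R) := pintp cq co k f (rho, 0).

Let QE k f rho : Q k f rho = pint (fun s => k s * f (cq s * rho)).
Proof.
by rewrite /Q /pintp; congr pint; apply/funext => s; rewrite /co /cst mul0r addr0.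
Qed.

Let stripE rho : y0 < rho < y1 -> strip (rho, 0). Proof. by []. Qed.

Let sQ k f : continuous k -> smooth `]y0, y1[ f -> smooth `]y0, y1[ (Q k f).
Proof.
move=> ck sf; have oI : open (`]y0, y1[%classic : set R) by exact: interval_open.
have sT := pintp_smooth ccq cco ostrip stripP ck sf.
have s1 : smooth `]y0, y1[ (id : R -> R) by apply: smooth_lin => // q; exact: cvg_id.
have s2 : smooth `]y0, y1[ (cst 0 : R -> R) by exact: smooth_cst.
by apply: (smooth_comp2 _ s1 s2 sT) => x; rewrite /= in_itv.
Qed.

Let cQ (k f : R -> R) rho : continuous k -> smooth `]y0, y1[ f -> y0 < rho < y1 ->
  continuous (fun s : R => k s * f (cq s * rho)).
Proof.
move=> ck sf h; have H := pintp_cont ccq cco stripP ck sf (stripE h).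
have E : (fun s : R => k s * f (cq s * rho)) =
    (fun s : R => k s * f (cq s * (rho, 0 : R).1 + co s * (rho, 0 : R).2)) :> (R -> R).
  by apply: funext => s; rewrite /co /cst mul0r addr0.
by rewrite E.
Qed.

Let dQ k f (rho : R) : continuous k -> smooth `]y0, y1[ f -> y0 < rho < y1 ->
  is_derive rho 1 (Q k f) (Q (fun s => k s * cq s) ('D_1 f) rho).
Proof.
move=> ck sf h.
have d := pintp_diff ccq cco ostrip stripP ck sf (stripE h).
have dp : is_diff rho (fun t : R => (t, 0 : R)) (fun v : R => (v, 0 : R)).
  exact: (@is_diff_pair R R R R id id (cst 0) (cst 0)).
have := is_diff_derive (is_diff_comp dp d).
by rewrite /= mul1r mul0r addr0.
Qed.

(** [Lam rho] is 1 / pi times the weighted area of the disc of squared radius [rho].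
    The factor [rho] is split off because the dilation ratio, the square root of
    [L2], must be smooth at the centre. *)
Let L2 rho := pi^-1 * Q sq j rho.
Let Lam rho := rho * L2 rho.
Let M0 rho := Q (cst 1) j rho.

Let oI : open (`]y0, y1[%classic : set R). Proof. exact: interval_open. Qed.

Let sL2 : smooth `]y0, y1[ L2.
Proof. by apply: smooth_mul; [exact: smooth_cst|exact: sQ]. Qed.

Let sLam : smooth `]y0, y1[ Lam.
Proof. by apply: smooth_mul => //; apply: smooth_lin => // q; exact: cvg_id. Qed.

Let pi0 : (pi : R) != 0. Proof. by rewrite gt_eqF// pi_gt0. Qed.

(** The derivative of [Lam] is the mean of the density over the circle: integrate the
    derivative of sin s cos s j(rho cos^2 s) over a period. *)
Let dLam (rho : R) : y0 < rho < y1 -> is_derive rho 1 Lam (M0 rho / period).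
Proof.
move=> h; have d := dQ csq sj h.
have dL : is_derive rho 1 L2 (pi^-1 * Q (fun s => sq s * cq s) ('D_1 j) rho).
  exact: (@is_deriveZ R R R (Q sq j) pi^-1 rho 1 _ d).
have dI := is_derive_id rho (1 : R).
apply: (is_derive_eq (is_deriveM dI dL)); rewrite /GRing.scale /=.
have csqcq : continuous (fun s => sq s * cq s).
  by move=> s; apply: cvgM; [exact: csq|exact: ccq].
have sdj : smooth `]y0, y1[ ('D_1 j) by exact: smooth_derive.
have ccs : continuous (fun s => cq s + -1 * sq s).
  by move=> s; apply: cvgD; [exact: ccq|apply: cvgMr; exact: csq].
have cA := cQ csq sj h; have cB := cQ csqcq sdj h; have cC := cQ c1s sj h.
have cD := cQ ccs sj h.
have cB' : continuous (fun s => (- 2 * rho) * (sq s * cq s * 'D_1 j (cq s * rho))).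
  by move=> s; apply: cvgMr; exact: cB.
have FF s : 0 <= s <= period -> is_derive s 1 (fun s : R => sin s * cos s * j (cq s * rho))
   ((cq s + -1 * sq s) * j (cq s * rho) + (- 2 * rho) * (sq s * cq s * 'D_1 j (cq s * rho))).
  move=> _.
  have dc : is_derive s 1 (fun s : R => cq s * rho) (- 2 * cos s * sin s * rho).
    rewrite /cq; apply: is_derive_eq; rewrite /GRing.scale /=; ring.
  have jI : `]y0, y1[%classic (cq s * rho).
    by rewrite /= in_itv /=; have := stripP s (stripE h); rewrite /co /cst mul0r addr0.
  have dj := is_diff_derive (is_diff_comp (is_derive_diff dc) (is_derive_diff (smooth_is_derive sj jI))).
  have dsc : is_derive s 1 (fun s : R => sin s * cos s) (cq s + -1 * sq s).
    apply: is_derive_eq; rewrite /GRing.scale /= /cq /sq; ring.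
  apply: (is_derive_eq (is_deriveM dsc dj)).
  by rewrite /GRing.scale /= /cq /sq /=; ring.
have cDB : continuous (fun s => (cq s + -1 * sq s) * j (cq s * rho) +
    (- 2 * rho) * (sq s * cq s * 'D_1 j (cq s * rho))).
  by move=> s; apply: cvgD; [exact: cD|exact: cB'].
have E := pint_FTC cDB FF.
have E0 : (sin (period : R) = 0) by rewrite /period mulr_natl sin2pi.
rewrite E0 sin0 !mul0r subrr (pintD cD cB') (pintZ _ cB) in E.
have cA2 : continuous (fun s => 2 * (sq s * j (cq s * rho))).
  by move=> s; apply: cvgMr; exact: cA.
have E1 : pint (fun s => cst 1 s * j (cq s * rho)) =
  2 * pint (fun s => sq s * j (cq s * rho)) + pint (fun s => (cq s + -1 * sq s) * j (cq s * rho)).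
  rewrite -(pintZ 2 cA) -(pintD cA2 cD); congr pint; apply/funext => s.
  have -> : cst 1 s = cq s + sq s by rewrite /cq /sq cos2Dsin2.
  by ring.
rewrite /M0 !QE E1 /L2 QE /period.
have -> : pint (fun s => (cq s + -1 * sq s) * j (cq s * rho)) =
  2 * rho * pint (fun s => sq s * cq s * 'D_1 j (cq s * rho)) by lra.
by move: pi0; generalize (pi : R) => p p0; field; exact: p0.
Qed.

Let M0E z : U z -> M0 (nrm2 z) = M z.
Proof.
move=> Uz; have [t E] := polar z.
have r2 : Num.sqrt (nrm2 z) ^+ 2 = nrm2 z by rewrite sqr_sqrtr// nrm2_ge0.
have Ur : U (Num.sqrt (nrm2 z), 0).
  by rewrite /U /disc /= {1}/nrm2 /= r2 expr0n /= addr0.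
rewrite [in RHS]E M_inv// /M0 QE ME; congr pint; apply/funext => s.
by rewrite /cst mul1r /rot /= mulr0 subr0 /J exprMn r2.
Qed.

Let nrmI z : U z -> y0 < nrm2 z < y1.
Proof. by move=> Uz; rewrite (lt_le_trans y00 (nrm2_ge0 z)). Qed.

Let M0_gt0 rho : y0 < rho < y1 -> 0 < M0 rho.
Proof.
move=> h; rewrite /M0 QE; apply: pint_gt0 => [|s]; first exact: cQ.
by rewrite mul1r j0//; have := stripP s (stripE h); rewrite /co /cst mul0r addr0.
Qed.

Let Lam_pos rho : y0 < rho < y1 -> 0 < M0 rho / period.
Proof. by move=> h; rewrite divr_gt0 ?period_gt0// M0_gt0. Qed.

Let Lam_incr s t : y0 < s -> s < t -> t < y1 -> Lam s < Lam t.
Proof.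
move=> h1 h2 h3; apply: (mvt_incr h2 (df := fun r => M0 r / period)) => x h.
  by apply: dLam; lra.
by apply: Lam_pos; lra.
Qed.

Let Lam0 : Lam 0 = 0. Proof. by rewrite /Lam mul0r. Qed.

Let L2_gt0 rho : y0 < rho < y1 -> 0 < L2 rho.
Proof.
move=> h; have [r0|r0|r0] := ltgtP rho 0.
- have : Lam rho < Lam 0 by apply: Lam_incr => //; lra.
  by rewrite Lam0 /Lam nmulr_rlt0.
- have : Lam 0 < Lam rho by apply: Lam_incr => //; lra.
  by rewrite Lam0 /Lam pmulr_rgt0.
have dL := smooth_is_derive sL2 (_ : `]y0, y1[%classic 0).
have I0 : y0 < 0 < y1 by rewrite y00.
have {}dL : is_derive (0 : R) 1 L2 ('D_1 L2 0) by apply: dL; rewrite /= in_itv.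
have E := derive_val (is_derive := is_deriveM (is_derive_id (0 : R) 1) dL).
have E' := derive_val (is_derive := dLam I0).
have := Lam_pos I0; rewrite -E'.
have -> : 'D_1 Lam 0 = 'D_1 ((id : R -> R) * L2) 0 by [].
by rewrite E /GRing.scale /= mul0r add0r mulr1 r0.
Qed.

Let l0 := y0 / 2.
Let exRf : exists g, inverse_pair Lam g l0 b'.
Proof.
have y0n := y00; have l0E : l0 = y0 / 2 by [].
have h1 : y0 < l0 by rewrite l0E; lra.
have h2 : l0 < b' by apply: lt_trans b'0; rewrite l0E; lra.
apply: (@smooth_inverse _ Lam y0 l0 b' y1) => //.
by move=> t /[dup] h /dLam d; rewrite (derive_val (is_derive := d)) Lam_pos.
Qed.

Let lam rho := Num.sqrt (L2 rho).
Let slam : smooth `]y0, y1[ lam.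
Proof. by apply: smooth_sqrt => // x; rewrite /= in_itv /= => /L2_gt0. Qed.
Let lam2 rho : y0 < rho < y1 -> lam rho ^+ 2 = L2 rho.
Proof. by move=> /L2_gt0/ltW h; rewrite sqr_sqrtr. Qed.
Let lam_gt0 rho : y0 < rho < y1 -> 0 < lam rho.
Proof. by move=> /L2_gt0 h; rewrite sqrtr_gt0. Qed.

Let dil (a : R) (z : plane) : plane := (a * z.1, a * z.2).

Let nrm2_dil a z : nrm2 (dil a z) = a ^+ 2 * nrm2 z.
Proof. by rewrite /nrm2 /dil /=; ring. Qed.

Let dilK a z : a != 0 -> dil a^-1 (dil a z) = z.
Proof. by case: z => x y a0; rewrite /dil /= !mulKf. Qed.

Let dilVK a z : a != 0 -> dil a (dil a^-1 z) = z.
Proof. by case: z => x y a0; rewrite /dil /= !mulVKf. Qed.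

Let smooth_dil (A : set plane) (a : plane -> R) : smooth A a ->
  smooth A (fun z => dil (a z) z).
Proof.
move=> sa; have oA := smooth_open sa.
by apply: smooth_pair; apply: smooth_mul => //; [exact: smooth_fst|exact: smooth_snd].
Qed.

Let Phi3 z := dil (lam (nrm2 z)) z.

Let slamn : smooth U (fun z => lam (nrm2 z)).
Proof.
apply: smooth_comp1 slam; last exact: smooth_nrm2.
by move=> x Ux; rewrite /= in_itv /=; exact: nrmI.
Qed.

Let nrm2_Phi3 z : U z -> nrm2 (Phi3 z) = Lam (nrm2 z).
Proof. by move=> Uz; rewrite nrm2_dil lam2 ?nrmI// mulrC. Qed.

(** The Jacobian of a radial map is the derivative of the new squared radius with
    respect to the old one. *)
Let area3 z u v : U z ->
  area ('D_u Phi3 z) ('D_v Phi3 z) = M0 (nrm2 z) / period * area u v.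
Proof.
move=> Uz; have I := nrmI Uz.
have I' : `]y0, y1[%classic (nrm2 z) by rewrite /= in_itv.
have dl := smooth_is_derive slam I'.
have dn w : is_derive z w nrm2 (2 * (z.1 * w.1 + z.2 * w.2)).
  have i3 := is_derive_fst z w; have i4 := is_derive_snd z w.
  have := is_deriveD (is_deriveX 2 i3) (is_deriveX 2 i4).
  move=> h; apply: (is_derive_eq h).
  by rewrite /GRing.scale /=; ring.
have sn := smooth_nrm2 oU.
have dln w : is_derive z w (fun z => lam (nrm2 z)) (2 * (z.1 * w.1 + z.2 * w.2) * 'D_1 lam (nrm2 z)).
  have h := is_diff_is_derive w (is_diff_comp (smooth_is_diff sn Uz) (is_derive_diff dl)).
  by apply: (is_derive_eq h); rewrite /= (derive_val (is_derive := dn w)).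
set k := 'D_1 lam (nrm2 z) in dln.
have h w : 'D_w Phi3 z =
  (2 * (z.1 * w.1 + z.2 * w.2) * k * z.1 + lam (nrm2 z) * w.1,
   2 * (z.1 * w.1 + z.2 * w.2) * k * z.2 + lam (nrm2 z) * w.2).
  have i3 := is_derive_fst z w; have i4 := is_derive_snd z w.
  apply: derive_pairE.
    by apply: (is_derive_eq (is_deriveM (dln w) i3)); rewrite /GRing.scale /=; ring.
  by apply: (is_derive_eq (is_deriveM (dln w) i4)); rewrite /GRing.scale /=; ring.
have E : M0 (nrm2 z) / period = lam (nrm2 z) ^+ 2 + nrm2 z * (2 * lam (nrm2 z) * k).
  have dLL := is_deriveM (is_derive_id (nrm2 z) (1 : R)) (is_deriveX 2 dl).
  have := derive_val (is_derive := dLam I) => <-.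
  rewrite (near_eq_derive (g := id * (lam ^+ 2))); last first.
    apply: filterS (open_near oI I') => y; rewrite /= in_itv /= => yI.
    by rewrite /Lam -lam2.
  have l2 : (lam ^+ 2) (nrm2 z) = lam (nrm2 z) ^+ 2 by [].
  by rewrite (derive_val (is_derive := dLL)) l2 /GRing.scale /= -/k; ring.
rewrite !h /area E /nrm2 /=; ring.
Qed.

(** First turn each point so that the density becomes constant on each circle, then
    dilate radially, the new squared radius being the weighted area enclosed by the
    circle, divided by pi. *)
Theorem circle_straightening : exists (Phi Psi : plane -> plane) (L g : R -> R) (a : R),
  [/\ a < 0, L 0 = 0, inverse_pair L g a b',
      area_diffeo (disc b') (disc (L b')) Phi Psi (fun z => j (z.1 ^+ 2)) &
      forall z, disc b' z -> nrm2 (Phi z) = L (nrm2 z)].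
Proof.
have [Phi2 [Psi2 [nPhi2 diffeo2]]] := circle_turning y00 b'0 b'y1 sj j0.
have [g ip] := exRf; have [sL sg' gP LP _] := ip.
have y0n : y0 < 0 := y00; have b'p : b' < y1 := b'y1.
have l00 : l0 < 0 by rewrite /l0; lra.
have nrmI' z : U' z -> l0 < nrm2 z < b'.
  by move=> h; rewrite (lt_le_trans l00 (nrm2_ge0 z)).
have Lpos z : Lam l0 < nrm2 z.
  apply: lt_le_trans (nrm2_ge0 z); rewrite -Lam0; apply: Lam_incr => //.
  by rewrite /l0; lra.
pose Psi3 z := dil (lam (g (nrm2 z)))^-1 z.
have gI z : disc (Lam b') z -> y0 < g (nrm2 z) < y1.
  move=> h; have [|] := gP (nrm2 z); first by rewrite Lpos.
  by rewrite /l0 => /andP[? ?] _; apply/andP; split; lra.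
have d3 : area_diffeo U' (disc (Lam b')) Phi3 Psi3 (fun z => M0 (nrm2 z) / period).
  split.
  - by apply: smooth_dil; apply: smooth_subset slamn.
  - apply: smooth_dil; apply: smooth_inv => [|z dz]; last by rewrite gt_eqF// lam_gt0// gI.
    apply: (smooth_comp1 (f := fun z => g (nrm2 z))) slam => [z dz|]; first by rewrite /= in_itv /= gI.
    apply: smooth_comp1 sg' => [z dz|]; first by rewrite /= in_itv /= Lpos.
    by apply: smooth_nrm2; exact: disc_open.
  - move=> z U'z; have Uz := U'U U'z.
    have [/andP[_ h] E] := LP _ (nrmI' _ U'z).
    split; first by rewrite /disc /= nrm2_Phi3.
    rewrite /Psi3 nrm2_Phi3// E /Phi3 dilK//.
    by rewrite gt_eqF// lam_gt0// nrmI.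
  - move=> z dz.
    have [|/andP[gl gb] E] := gP (nrm2 z); first by rewrite Lpos.
    have l1 : lam (g (nrm2 z)) != 0 by rewrite gt_eqF// lam_gt0// gI.
    have L1 : L2 (g (nrm2 z)) != 0 by rewrite gt_eqF// L2_gt0// gI.
    have EE : nrm2 (Psi3 z) = g (nrm2 z).
      rewrite /Psi3 nrm2_dil exprVn lam2 ?gI//.
      by rewrite -[X in _ * X]E /Lam; field.
    split; first by rewrite /U' /disc /= EE.
    by rewrite /Phi3 EE /Psi3 dilVK.
  - by move=> z u v U'z; apply: area3; exact: U'U.
have [sF sI d1 d2 aJ] := area_diffeo_comp diffeo2 d3.
exists (Phi3 \o Phi2), (Psi2 \o Psi3), Lam, g, l0; split => //.
  split => // z u v U'z; rewrite aJ//; congr (_ * _).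
  have Uz := U'U U'z; rewrite nPhi2 M0E// -/(J z.1) -/(M z).
  by field; rewrite !gt_eqF ?M_gt0 ?period_gt0.
move=> z U'z /=; have Uz := U'U U'z.
by rewrite nrm2_Phi3 /U /disc /= nPhi2.
Qed.

End Radial.

(** * Action-angle coordinates of a one-degree-of-freedom well *)
Section Well.
Context {R : realType}.
Notation plane := (R * R)%type.
Variables (Q d : R -> R) (lo hi' hi b : R).

(** Here [t] is the square of the position variable [u], so that the potential is
    the square of 2 u sqrt(Q(u^2)). *)
Definition well_potential (t : R) : R := 4 * t * Q t.
Local Notation P := well_potential.

Definition well_energy (z : plane) : R := P (z.1 ^+ 2) + z.2 ^+ 2.
Definition well_domain (b' : R) : set plane :=
  [set z | z.1 ^+ 2 < hi' /\ well_energy z < b'].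

Hypotheses (lo0 : lo < 0) (hi'0 : 0 < hi') (hihi : hi' < hi).
Hypotheses (sQ : smooth setT Q) (sd : smooth `]lo, hi[ d).
Hypothesis Q0 : forall t, lo < t < hi -> 0 < Q t.
Hypothesis d0 : forall t, lo < t < hi -> 0 < d t.
Hypothesis P1 : forall t, lo < t < hi -> 0 < 'D_1 P t.
Hypotheses (b0 : 0 < b) (bP : b < P hi').

Lemma smooth_well_potential : smooth setT P.
Proof.
apply: smooth_mul => //; apply: smooth_mul; first exact: (smooth_cst (4 : R) openT).
exact: smooth_id openT.
Qed.

Lemma well_domain_open b' : open (well_domain b').
Proof.
have s1 : smooth setT (fun z : plane => z.1 ^+ 2).
  by apply: smooth_exp; apply: smooth_fst; exact: openT.
have s2 : smooth setT well_energy.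
  apply: smooth_add; first by apply: smooth_comp1 s1 smooth_well_potential.
  by apply: smooth_exp; apply: smooth_snd; exact: openT.
have -> : well_domain b' = (fun z : plane => z.1 ^+ 2) @^-1` [set x | x < hi']
    `&` well_energy @^-1` [set x | x < b'] by [].
by apply: openI; apply: open_preim => //; exact: open_lt.
Qed.

(** In the coordinates (u, p), where the position x satisfies dx = d(u^2) du, the
    energy is P(u^2) + p^2.  The substitution w = 2 u sqrt(Q(u^2)) turns it into
    w^2 + p^2 and the area form into a density that is even in w, which the previous
    part straightens.  All maps are defined beyond the energy [b]. *)
Theorem well_action_angle : exists (Phi Psi : plane -> plane) (L g : R -> R) (a b' : R),
  [/\ a < 0, b < b', L 0 = 0 /\ inverse_pair L g a b',
      area_diffeo (well_domain b') (disc (L b')) Phi Psi (fun z => d (z.1 ^+ 2)) &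
      forall z, well_domain b' z -> nrm2 (Phi z) = L (well_energy z)].
Proof.
have lo0_ := lo0; have hi'0_ := hi'0; have hihi_ := hihi; have b0_ := b0; have bP_ := bP.
have sP := smooth_well_potential.
have sPI : smooth `]lo, hi[ P by apply: smooth_subset sP; [exact: interval_open|].
have P0 : P 0 = 0 by rewrite /P mulr0 mul0r.
have hlo : lo < lo / 2 by lra.
have hlohi : lo / 2 < hi' by lra.
have [tau [_ stau tauP Ptau _]] := smooth_inverse hlo hlohi hihi sPI P1.
set y0 := P (lo / 2) in stau tauP Ptau; set y1 := P hi' in stau tauP Ptau.
have y00 : y0 < 0.
  have I0 : lo / 2 < 0 < hi' by apply/andP; split; lra.
  by have [/andP[+ _] _] := Ptau 0 I0; rewrite P0.
pose b' := (b + y1) / 2.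
have bb' : b < b' by rewrite /b' /y1; lra.
have b'y1 : b' < y1 by rewrite /b' /y1; lra.
have b'0 : 0 < b' by lra.
pose Y := `]y0, y1[%classic : set R.
have tauI y : y0 < y < y1 -> lo < tau y < hi.
  by move=> /tauP[/andP[h1 h2] _]; apply/andP; split; lra.
pose dP := 'D_1 P.
have sdP : smooth setT dP by exact: smooth_derive.
(* [tau] inverts P, so t = tau(w^2) and dx = d(t) du = j(w^2) dw. *)
pose j y := d (tau y) * (2 * Num.sqrt (Q (tau y))) / dP (tau y).
have sj : smooth Y j.
  have sdt : smooth Y (fun y => d (tau y)).
    by apply: smooth_comp1 stau sd => y; rewrite /Y /= !in_itv /=; exact: tauI.
  have sQt : smooth Y (fun y => Q (tau y)) by apply: smooth_comp1 stau sQ.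
  have sPt : smooth Y (fun y => dP (tau y)) by apply: smooth_comp1 stau sdP.
  apply: smooth_div => // [|y]; last first.
    by rewrite /Y /= in_itv /= => /tauI/P1; rewrite lt0r => /andP[].
  apply: smooth_mul => //; apply: smooth_mul; first exact: (smooth_cst (2 : R) (smooth_open stau)).
  by apply: smooth_sqrt => // y; rewrite /Y /= in_itv /= => /tauI/Q0.
have j0 y : y0 < y < y1 -> 0 < j y.
  move=> /tauI h; rewrite /j divr_gt0 ?P1// mulr_gt0 ?d0// mulr_gt0// sqrtr_gt0.
  exact: Q0.
have [Phi [Psi [L [g [a [a0 L0 ip df nP]]]]]] := circle_straightening y00 b'0 b'y1 sj j0.
pose A := well_domain b'.
have oA : open A by exact: well_domain_open.
have su : smooth A (fun z : plane => z.1) by exact: smooth_fst.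
have sp : smooth A (fun z : plane => z.2) by exact: smooth_snd.
have uI z : A z -> lo / 2 < z.1 ^+ 2 < hi'.
  by move=> [h _]; rewrite h andbT (lt_le_trans _ (sqr_ge0 _))//; lra.
have uI' z : A z -> lo < z.1 ^+ 2 < hi.
  by move=> /uI /andP[h1 h2]; apply/andP; split; lra.
pose sq (z : plane) := Num.sqrt (Q (z.1 ^+ 2)).
have ssq : smooth A sq.
  apply: smooth_sqrt => [|z /uI'/Q0//].
  by apply: smooth_comp1 (smooth_exp 2 su) sQ.
have sq2 z : A z -> sq z ^+ 2 = Q (z.1 ^+ 2).
  by move=> /uI'/Q0/ltW h; rewrite /sq sqr_sqrtr.
have sq0 z : A z -> 0 < sq z by move=> /uI'/Q0 h; rewrite sqrtr_gt0.
pose F (z : plane) : plane := (2 * z.1 * sq z, z.2).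
pose G (z : plane) : plane := (z.1 / (2 * Num.sqrt (Q (tau (z.1 ^+ 2)))), z.2).
have F2 z : A z -> (F z).1 ^+ 2 = P (z.1 ^+ 2).
  by move=> Az; rewrite /F /= !exprMn sq2// /P; ring.
have nF z : A z -> nrm2 (F z) = well_energy z.
  by move=> Az; rewrite /nrm2 F2.
have wI z : disc b' z -> y0 < z.1 ^+ 2 < y1.
  rewrite /disc /= /nrm2 => h; rewrite (lt_le_trans y00 (sqr_ge0 _)) /=.
  by apply: le_lt_trans b'y1; apply: ltW; apply: le_lt_trans h; rewrite lerDl sqr_ge0.
have GE z : disc b' z -> (G z).1 ^+ 2 = tau (z.1 ^+ 2).
  move=> dz; have [_ E] := tauP _ (wI _ dz).
  have Qp := Q0 (tauI _ (wI _ dz)).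
  rewrite /G /= expr_div_n exprMn sqr_sqrtr ?ltW// -[X in X / _]E /P.
  by field; rewrite gt_eqF.
have dF : area_diffeo A (disc b') F G (fun z => dP (z.1 ^+ 2) / (2 * sq z)).
  have sF1 : smooth A (fun z : plane => 2 * z.1 * sq z).
    by apply: smooth_mul => //; apply: smooth_mul => //; exact: (smooth_cst (2 : R) oA).
  split.
  - by apply: smooth_pair.
  - have oD := @disc_open R b'.
    have s1 := smooth_fst oD.
    apply: smooth_pair; last exact: smooth_snd.
    have st : smooth (disc b') (fun z : plane => tau (z.1 ^+ 2)).
      apply: smooth_comp1 (smooth_exp 2 s1) stau => z /wI.
      by rewrite /= in_itv.
    apply: smooth_div => // [|z dz]; last first.
      by rewrite mulf_neq0// gt_eqF// sqrtr_gt0 Q0// tauI// wI.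
    apply: smooth_mul; first exact: (smooth_cst (2 : R) oD).
    apply: smooth_sqrt => [|z dz]; last by rewrite Q0// tauI// wI.
    by apply: smooth_comp1 st sQ.
  - move=> z Az; split; first by rewrite /disc /= nF//; case: Az.
    have [_ E] := Ptau _ (uI _ Az).
    rewrite /G F2// E /F /= -/(sq z).
    have := sq0 _ Az; case: (z) => u p /= s0; congr pair; field.
    by rewrite gt_eqF.
  - move=> z dz; have E := GE _ dz.
    have [/andP[t1 t2] Et] := tauP _ (wI _ dz).
    have AG : A (G z).
      split; first by rewrite E.
      by rewrite /well_energy E Et.
    split => //; rewrite /F /sq E /G /=.
    have : Num.sqrt (Q (tau (z.1 ^+ 2))) != 0.
      by rewrite gt_eqF// sqrtr_gt0 Q0// tauI// wI.
    by case: (z) => w p /= s0; congr pair; field.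
  - move=> z u v Az.
    have Qz := Q0 (uI' _ Az).
    have dQ : is_derive (z.1 ^+ 2) 1 Q ('D_1 Q (z.1 ^+ 2)) by apply: smooth_is_derive sQ _.
    have dsq w : is_derive z w sq (2 * z.1 * w.1 * 'D_1 Q (z.1 ^+ 2) / (2 * sq z)).
      have i1 : is_derive z w (fun z : plane => z.1 ^+ 2) (2 * z.1 * w.1).
        have h := is_deriveX 2 (is_derive_fst z w).
        by apply: (is_derive_eq h); rewrite /GRing.scale /=; ring.
      have i2 := is_diff_comp (smooth_is_diff (smooth_exp 2 su) Az) (is_derive_diff dQ).
      have ds := is_derive1_sqrt Qz.
      have i3 := is_diff_is_derive w (is_diff_comp i2 (is_derive_diff ds)).
      by apply: (is_derive_eq i3); rewrite /= (derive_val (is_derive := i1)).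
    have dPE : dP (z.1 ^+ 2) = 4 * Q (z.1 ^+ 2) + 4 * z.1 ^+ 2 * 'D_1 Q (z.1 ^+ 2).
      have i1 : is_derive (z.1 ^+ 2) 1 (fun t : R => 4 * t) 4.
        by have := @is_deriveZ R R R id 4 (z.1 ^+ 2) 1 1 (is_derive_id _ _); rewrite /GRing.scale /= mulr1.
      rewrite /dP (derive_val (is_derive := is_deriveM i1 dQ)) /GRing.scale /=; ring.
    have h w : 'D_w F z = (dP (z.1 ^+ 2) / (2 * sq z) * w.1, w.2).
      apply: derive_pairE; last exact: is_derive_snd.
      have i1 : is_derive z w (fun z : plane => 2 * z.1) (2 * w.1).
        by have := @is_deriveZ R plane R (fun z : plane => z.1) 2 z w _ (is_derive_fst z w).
      apply: (is_derive_eq (is_deriveM i1 (dsq w))); rewrite /GRing.scale /= dPE -sq2//.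
      by field; rewrite gt_eqF// sq0.
    by rewrite !h /area /=; ring.
exists (Phi \o F), (G \o Psi), L, g, a, b'; split => //.
  have [sF' sG' h1 h2 aJ] := area_diffeo_comp dF df.
  split => // z u v Az; rewrite aJ//; congr (_ * _).
  have [_ E] := Ptau _ (uI _ Az).
  rewrite F2// /j E -/(sq z).
  by field; rewrite !gt_eqF ?sq0//; exact: P1 (uI' _ Az).
move=> z Az /=; rewrite nP ?nF//.
by have [_ _ /(_ _ Az)[]] := dF.
Qed.

End Well.

(** * Toric domains bounded by a sum of increasing functions *)
Section SmoothSum.
Context {R : realType}.

Lemma smooth_sum {V W : normedModType R} (U : set V) n (f : 'I_n -> V -> W) :
  open U -> (forall j, smooth U (f j)) -> smooth U (fun x => \sum_(j < n) f j x).
Proof.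
by move=> oU sf; split=> // k; apply: Dk_sum => // j _; case: (sf j).
Qed.

Lemma smooth_row {V : normedModType R} (U : set V) n (f : 'I_n -> V -> R) :
  open U -> (forall j, smooth U (f j)) -> smooth U (fun x => \row_(j < n) f j x).
Proof.
move=> oU sf.
apply: (smooth_ext (f := fun x => \sum_(j < n) f j x *: (delta_mx ord0 j : 'rV[R]_n))).
  move=> x _; rewrite [RHS]row_sum_delta; apply: eq_bigr => j _.
  by rewrite mxE.
by apply: smooth_sum => // j; apply: smooth_scalel.
Qed.

Lemma smooth_coord n (U : set 'rV[R]_n) j : open U ->
  smooth U (fun x : 'rV[R]_n => x ord0 j).
Proof.
move=> oU; apply: smooth_lin => //; first by move=> c u v; rewrite !mxE.
exact: coord_continuous.
Qed.

Lemma open_all {T : topologicalType} n (A : 'I_n -> set T) :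
  (forall j, open (A j)) -> open [set x | forall j, A j x].
Proof.
move=> oA; rewrite openE => x Ax; rewrite /interior.
by apply: filter_forall => j; apply: open_near => //; exact: Ax.
Qed.

Lemma open_between {V : normedModType R} (f : V -> R) (c d : R) :
  smooth setT f -> open [set x | c < f x < d].
Proof.
move=> sf; have -> : [set x | c < f x < d] = f @^-1` `]c, d[%classic.
  by apply/seteqP; split=> x; rewrite /= in_itv.
by apply: open_preim; last exact: interval_open.
Qed.

Lemma star_connected {V : normedModType R} (A : set V) : A 0 ->
  (forall x s, A x -> 0 <= s <= 1 -> A (s *: x)) -> connected A.
Proof.
move=> A0 AS.
have -> : A = \bigcup_(x in A) ((fun s : R => s *: x) @` `[0, 1]).
  apply/seteqP; split=> [x Ax|y [x Ax [s + <-]]].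
    by exists x => //; exists 1; rewrite ?scale1r//= in_itv /= ler01 lexx.
  by rewrite /= in_itv /= => s01; exact: AS.
apply: bigcup_connected => [|x Ax].
  by exists 0 => x Ax; exists 0; rewrite ?scale0r//= in_itv /= lexx ler01.
apply: connected_continuous_connected; first exact: segment_connected.
by apply: continuous_subspaceT => s; exact: scalel_continuous.
Qed.

Lemma continuous_within {T U : topologicalType} (A : set T) (f : T -> U) :
  (forall x, A x -> {for x, continuous f}) -> {within A, continuous f}.
Proof.
by move=> cf; apply: continuous_in_subspaceT => x /set_mem; exact: cf.
Qed.

Lemma inverse_pair_incr (f g : R -> R) (a b s t : R) : inverse_pair f g a b ->
  a < s -> s < t -> t < b -> f s < f t.
Proof.
move=> ip sa st tb; apply: (mvt_incr st (df := 'D_1 f)) => x.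
  move=> /andP[h1 h2]; apply: smooth_is_derive (ip_smooth ip) _.
  by rewrite /= in_itv /=; apply/andP; split; lra.
by move=> /andP[h1 h2]; apply: (ip_derive ip); apply/andP; split; lra.
Qed.

Lemma inverse_pair_derive (f g : R -> R) (a b y : R) : inverse_pair f g a b ->
  f a < y < f b -> 0 < 'D_1 g y.
Proof.
move=> ip yI; have [gI E] := ip_inv ip yI.
have yI' : `]f a, f b[%classic y by rewrite /= in_itv.
have gI' : `]a, b[%classic (g y) by rewrite /= in_itv.
have dg := smooth_is_derive (ip_inv_smooth ip) yI'.
have df := smooth_is_derive (ip_smooth ip) gI'.
have h := is_diff_derive (is_diff_comp (is_derive_diff dg) (is_derive_diff df)).
have := derive_val (is_derive := h).
rewrite (near_eq_derive (g := id)) ?derive_id/=; last first.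
  apply: filterS (open_near (smooth_open (ip_inv_smooth ip)) yI') => x.
  by rewrite /= in_itv /= => /(ip_inv ip)[].
have := ip_derive ip gI => D0 E1.
have D1 : 0 < 'D_1 f (g y) * 'D_1 g y by rewrite mulrC -[X in _ < X * _]mul1r -E1 ltr01.
by rewrite pmulr_rgt0 in D1.
Qed.

End SmoothSum.

Section ToricSublevel.
Context {R : realType} {n : nat}.
Variables (L g : 'I_n -> R -> R) (a b' : 'I_n -> R) (b : R).
Hypotheses (b0 : 0 < b) (bb' : forall j, b < b' j) (a0 : forall j, a j < 0).
Hypothesis ip : forall j, inverse_pair (L j) (g j) (a j) (b' j).
Hypothesis L0 : forall j, L j 0 = 0.

Definition simplex : set 'rV[R]_n :=
  [set r | (forall j, 0 <= r ord0 j) /\ \sum_(j < n) r ord0 j <= b].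

(** [L j] is the squared radius in the j-th factor as a function of the energy, so
    that [pi * L j] is the action. *)
Definition actions (r : 'rV[R]_n) : 'rV[R]_n := \row_j (pi * L j (r ord0 j)).

Definition toric_sublevel : set 'rV[R]_n := actions @` simplex.

Definition action_range : set 'rV[R]_n :=
  [set x | forall j, L j (a j) < x ord0 j / pi < L j (b' j)].

Definition total_energy (x : 'rV[R]_n) : R := \sum_(j < n) g j (x ord0 j / pi).

Local Notation Omega := toric_sublevel.

Let pi0 : 0 < (pi : R) := pi_gt0 R.
Let piN0 : (pi : R) != 0. Proof. by rewrite gt_eqF. Qed.

Lemma action_range_open : open action_range.
Proof.
apply: open_all => j; apply: (open_between (f := fun x : 'rV[R]_n => x ord0 j / pi)).
apply: smooth_mul; first by apply: smooth_coord; exact: openT.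
exact: (smooth_cst (pi^-1 : R) openT).
Qed.

Lemma total_energy_smooth : smooth action_range total_energy.
Proof.
apply: smooth_sum => [|j]; first exact: action_range_open.
apply: (smooth_comp1 (f := fun x : 'rV[R]_n => x ord0 j * pi^-1)) (ip_inv_smooth (ip j)).
  by move=> x /(_ j); rewrite /= in_itv.
apply: smooth_mul; first by apply: smooth_coord; exact: action_range_open.
exact: (smooth_cst (pi^-1 : R) action_range_open).
Qed.

Lemma simplex_coord r j : simplex r -> 0 <= r ord0 j <= b.
Proof.
move=> [r0 rb]; rewrite r0 (le_trans _ rb)// (bigD1 j)//= lerDl.
by rewrite sumr_ge0.
Qed.

Lemma energy_range t j : 0 <= t <= b -> a j < t < b' j.
Proof. by move=> /andP[t0 tb]; rewrite (lt_le_trans (a0 j) t0) (le_lt_trans tb (bb' j)). Qed.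

Lemma L_ge0 j t : 0 <= t < b' j -> 0 <= L j t.
Proof.
move=> /andP[]; rewrite le_eqVlt => /orP[/eqP <-|t0] tb; first by rewrite L0.
by rewrite -[X in X <= _](L0 j) ltW// (inverse_pair_incr (ip j)).
Qed.

Lemma g_ge0 j y : 0 <= y < L j (b' j) -> 0 <= g j y < b' j.
Proof.
move=> /andP[y0 yb].
have La : L j (a j) < 0.
  have b'0 : 0 < b' j by apply: lt_trans b0 (bb' j).
  by have [|/andP[+ _] _] := ip_fun (ip j) (t := 0); rewrite ?L0 ?a0 ?b'0.
have [|/andP[ga gb] E] := ip_inv (ip j) (y := y).
  by rewrite yb (lt_le_trans La).
rewrite gb andbT leNgt; apply/negP => g0.
have b'0 : 0 < b' j by apply: lt_trans b0 (bb' j).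
by have := inverse_pair_incr (ip j) ga g0 b'0; rewrite L0 E ltNge y0.
Qed.

(** The energies are increasing functions of the actions, so that the image of the
    simplex of energies is cut out by inequalities on the actions. *)
Lemma toric_sublevelP x : Omega x <->
  [/\ forall j, 0 <= x ord0 j, action_range x & total_energy x <= b].
Proof.
split=> [[r sr <-]|[x0 xI xb]].
  have rI j := simplex_coord j sr.
  have rI' j : a j < r ord0 j < b' j by apply: energy_range.
  have xE j : actions r ord0 j / pi = L j (r ord0 j) by rewrite mxE mulrC mulKf.
  split=> [j|j|].
  - rewrite mxE; apply: mulr_ge0; first exact: ltW.
    apply: L_ge0.
    by have /andP[-> _] := rI j; have /andP[_ ->] := rI' j.
  - by rewrite xE; have [] := ip_fun (ip j) (rI' j).
  - rewrite /total_energy (eq_bigr (fun j => r ord0 j)); first by case: sr.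
    by move=> j _; rewrite xE; have [] := ip_fun (ip j) (rI' j).
exists (\row_j g j (x ord0 j / pi)).
  split=> [j|]; last by under eq_bigr do rewrite mxE.
  rewrite mxE; have /andP[_ h] := xI j.
  by have /andP[] : 0 <= g j (x ord0 j / pi) < b' j by apply: g_ge0; rewrite h divr_ge0// ltW.
apply/rowP => j; rewrite !mxE; have [_ ->] := ip_inv (ip j) (xI j).
by rewrite mulrC divfK.
Qed.

Let strip : set 'rV[R]_n := [set r | forall j, a j < r ord0 j < b' j].

Let strip_open : open strip.
Proof.
apply: open_all => j; apply: (open_between (f := fun x : 'rV[R]_n => x ord0 j)).
by apply: smooth_coord; exact: openT.
Qed.

Let simplex_strip r : simplex r -> strip r.
Proof. by move=> sr j; apply: energy_range; exact: simplex_coord. Qed.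

Lemma actions_smooth : smooth strip actions.
Proof.
apply: smooth_row => // j; apply: smooth_mul; first exact: (smooth_cst (pi : R) strip_open).
apply: (smooth_comp1 (f := fun x : 'rV[R]_n => x ord0 j)) (ip_smooth (ip j)).
  by move=> x /(_ j); rewrite /= in_itv.
exact: smooth_coord.
Qed.

Let within_actions : {within simplex, continuous actions}.
Proof.
by apply: continuous_within => r /simplex_strip; exact: smooth_cont actions_smooth.
Qed.

Lemma simplex_compact : compact simplex.
Proof.
have box : compact [set r : 'rV[R]_n | forall j, `[0, b]%classic (r ord0 j)].
  by apply: (@rV_compact R n (fun=> `[0, b]%classic)) => j; exact: segment_compact.
apply: subclosed_compact box _; last by move=> r sr j; rewrite /= in_itv; exact: simplex_coord.
have -> : simplex = \bigcap_(j in setT) [set r : 'rV[R]_n | 0 <= r ord0 j] `&`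
    (fun r : 'rV[R]_n => \sum_(j < n) r ord0 j) @^-1` [set x | x <= b].
  apply/seteqP; split=> r /=; first by move=> [h1 h2]; split => // j _; exact: h1.
  by move=> [h1 h2]; split => // j; exact: h1.
apply: closedI.
  apply: closed_bigI => j _.
  have -> : [set r : 'rV[R]_n | 0 <= r ord0 j] = (fun r : 'rV[R]_n => r ord0 j) @^-1` [set x | 0 <= x] by [].
  by apply: closed_comp => [r _|]; [exact: coord_continuous|exact: closed_ge].
apply: closed_comp => [r _|]; last exact: closed_le.
apply: (smooth_cont (U := setT)) => //; apply: smooth_sum => [|j]; first exact: openT.
by apply: smooth_coord; exact: openT.
Qed.

Lemma toric_sublevel_compact : compact Omega.
Proof. by apply: continuous_compact => //; exact: simplex_compact. Qed.

Lemma toric_sublevel_closed : closed Omega.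
Proof. by apply: compact_closed; [exact: norm_hausdorff|exact: toric_sublevel_compact]. Qed.

Let simplex0 : simplex 0.
Proof.
split=> [j|]; first by rewrite mxE.
by rewrite big1 ?ltW// => j _; rewrite mxE.
Qed.

Let near_pos (x : 'rV[R]_n) : (forall j, 0 < x ord0 j) ->
  \forall y \near x, forall j, 0 <= (y : 'rV[R]_n) ord0 j.
Proof.
move=> xp.
have H j : \forall y \near x, 0 <= (y : 'rV[R]_n) ord0 j.
  have := cvgr_gt (x ord0 j) (@coord_continuous _ _ _ ord0 j x) 0 (xp j).
  by move=> /(_ (nbhs_filter x)); apply: filterS => y; exact: ltW.
exact: (filter_forall (nbhs_filter x) H).
Qed.

Lemma toric_sublevel_domain : orthant_domain Omega.
Proof.
split.
- by move=> x /toric_sublevelP[].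
- by exists (actions 0); exists 0.
- apply: connected_continuous_connected => //; apply: star_connected => //.
  move=> r s [r0 rb] /andP[s0 s1]; split=> [j|]; first by rewrite mxE mulr_ge0.
  under eq_bigr do rewrite mxE.
  by rewrite -mulr_sumr (le_trans _ rb)// ler_piMl// sumr_ge0.
move=> _ [r sr <-] B nB.
(* Moving the energies towards the barycentre of the simplex leaves the faces. *)
pose e : R := b / (2 * n.+1%:R).
have n0 : 0 < (n.+1%:R : R) by rewrite ltr0n.
have e0 : 0 < e by rewrite divr_gt0// mulr_gt0.
pose p (s : R) : 'rV[R]_n := r + s *: (const_mx e - r).
have p0 : p 0 = r by rewrite /p scale0r addr0.
have cp : p s @[s --> (0 : R)] --> r.
  rewrite -[X in _ --> X]addr0; apply: cvgD; first exact: cvg_cst.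
  rewrite -(scale0r (const_mx e - r)); exact: scalel_continuous.
have cap : actions (p s) @[s --> (0 : R)] --> actions r.
  by apply: (cvg_comp _ _ cp); exact: smooth_cont actions_smooth (simplex_strip sr).
have nearB : \forall s \near (0 : R), B (actions (p s)) by exact: cap.
have /nbhs_ballP[d /= d0 dB] := nearB.
pose s := Num.min (d / 2) (1 / 2).
have s0 : 0 < s by rewrite lt_min divr_gt0//=; lra.
have [s1 sd] : s <= 1 / 2 /\ s <= d / 2 by rewrite /s !ge_min !lexx orbT.
exists (actions (p s)); split; last first.
  by apply: dB; rewrite /ball /= sub0r normrN gtr0_norm//; lra.
have pE j : p s ord0 j = (1 - s) * r ord0 j + s * e by rewrite /p !mxE; ring.
have ps j : 0 < p s ord0 j.
  by rewrite pE ltr_wpDl ?mulr_gt0// mulr_ge0//; [lra|case: sr].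
have psum : \sum_(j < n) p s ord0 j < b.
  under eq_bigr do rewrite pE.
  rewrite big_split /= -mulr_sumr sumr_const card_ord.
  have h1 : (1 - s) * \sum_(j < n) r ord0 j <= (1 - s) * b.
    by apply: ler_wpM2l; [lra|case: sr].
  have h2 : s * e *+ n <= s * (b / 2).
    rewrite -mulrnAr ler_pM2l// -[e *+ n]mulr_natr /e.
    have -> : b / 2 = b / (2 * n.+1%:R) * n.+1%:R by field; rewrite gt_eqF.
    by rewrite ler_pM2l// ler_nat.
  have h3 : 0 < s * b by rewrite mulr_gt0.
  lra.
have sps : simplex (p s) by split=> [j|]; rewrite ltW.
have [_ xI _] := (toric_sublevelP (actions (p s))).1 (ex_intro2 _ _ (p s) sps erefl).
have xE j : actions (p s) ord0 j / pi = L j (p s ord0 j) by rewrite mxE mulrC mulKf.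
have tE : total_energy (actions (p s)) < b.
  rewrite /total_energy (eq_bigr (fun j => p s ord0 j))// => j _.
  by rewrite xE; have [] := ip_fun (ip j) (simplex_strip sps j).
have ct := smooth_cont total_energy_smooth xI.
have xp j : 0 < actions (p s) ord0 j.
  rewrite mxE mulr_gt0// -[X in X < _](L0 j) (inverse_pair_incr (ip j))//.
  by have /andP[] := simplex_strip sps j.
rewrite /interior; near=> x.
apply/toric_sublevelP; split.
- by near: x; exact: near_pos.
- by near: x; exact: (open_near action_range_open xI).
- by apply: ltW; near: x; exact: (cvgr_lt _ ct).
Unshelve. all: by end_near. Qed.

Lemma total_energy_boundary x : boundary Omega x -> Omega x /\ total_energy x = b \/
  Omega x /\ exists j, x ord0 j = 0.
Proof.
move=> [clx nix]; have Ox : Omega x by apply: toric_sublevel_closed.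
have [x0 xI xb] := (toric_sublevelP x).1 Ox.
have [E|nE] := eqVneq (total_energy x) b; first by left.
have [[j xj]|nx] := pselect (exists j, x ord0 j = 0); first by right; split => //; exists j.
exfalso; apply: nix.
have lt : total_energy x < b by rewrite lt_neqAle nE.
have xp j : 0 < x ord0 j.
  by rewrite lt_neqAle x0 andbT; apply/eqP => E; apply: nx; exists j.
have ct := smooth_cont total_energy_smooth xI.
rewrite /interior; near=> y.
apply/toric_sublevelP; split.
- by near: y; exact: near_pos.
- by near: y; exact: (open_near action_range_open xI).
- by apply: ltW; near: y; exact: (cvgr_lt _ ct).
Unshelve. all: by end_near. Qed.

Lemma total_energy_derive x j : action_range x ->
  0 < 'D_(delta_mx ord0 j) total_energy x.
Proof.
move=> xI.
have dg i : is_diff x (fun x : 'rV[R]_n => g i (x ord0 i / pi))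
    (fun v => v ord0 i / pi * 'D_1 (g i) (x ord0 i / pi)).
  have xI' : `]L i (a i), L i (b' i)[%classic (x ord0 i / pi) by rewrite /= in_itv /=; exact: xI.
  have d1 := smooth_is_derive (ip_inv_smooth (ip i)) xI'.
  have lin : linear (fun x : 'rV[R]_n => x ord0 i / pi).
    by move=> c u v; rewrite !mxE /GRing.scale /=; ring.
  have cl : continuous (fun x : 'rV[R]_n => x ord0 i / pi).
    have sm : smooth setT (fun x : 'rV[R]_n => x ord0 i / pi).
      apply: smooth_mul; first by apply: smooth_coord; exact: openT.
      exact: (smooth_cst (pi^-1 : R) openT).
    by move=> y; exact: smooth_cont sm (I : setT y).
  exact: is_diff_comp (is_diff_lin x lin cl) (is_derive_diff d1).
have -> : total_energy = \sum_(i < n) (fun x : 'rV[R]_n => g i (x ord0 i / pi)).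
  by apply/funext => y; rewrite fct_sumE.
rewrite derive_sum; last by move=> i; apply: diff_derivable; case: (dg i).
rewrite (bigD1 j)//= big1 => [|i ij].
  rewrite addr0 (deriveE_diff _ (dg j)) mxE !eqxx /= mul1r.
  by rewrite mulr_gt0 ?invr_gt0// (inverse_pair_derive (ip j)).
by rewrite (deriveE_diff _ (dg i)) mxE (negbTE ij) /= !mul0r.
Qed.

(** Moving one coordinate down, or one down and another one slightly up, lowers the
    total energy and so leads into the domain, where a defining function is not
    positive: this gives the signs of its derivatives. *)
Lemma toric_sublevel_monotone x v : boundary_plus Omega x -> outward_normal Omega x v ->
  forall j, 0 < v ord0 j.
Proof.
move=> [bx xp] [h [sh hO [w0 hw0]] hv].
have [[Ox Eb]|[_ [j E]]] := total_energy_boundary bx; last by have := xp j; rewrite E ltxx.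
have [x0 xI _] := (toric_sublevelP x).1 Ox.
have [V [oV xV ckh]] := sh.
have [[ch0 _] [_ ckh1]] := (ckh 0%N, ckh 1%N).
have ch : {for x, continuous h} by apply: ch0; exact: xV.
have dh w : derivable h x w by case: (ckh1 w) => + _; apply; exact: xV.
have hx : h x = 0.
  apply/eqP; rewrite eq_le; apply/andP; split; first by have := nbhs_singleton hO => -[+ _]; apply.
  rewrite leNgt; apply/negP => hneg; have [_ nix] := bx; apply: nix.
  have hlt : \forall y \near x, h y < 0 by exact: (cvgr_lt _ ch).
  rewrite /interior; near=> y.
  have : Omega y <-> h y <= 0 by near: y.
  by move=> [_]; apply; apply: ltW; near: y.
have dE w : derivable total_energy x w by apply: diff_derivable; exact: smooth_diff total_energy_smooth xI.
have inward w : 'D_w total_energy x < 0 -> 'D_w h x <= 0.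
  move=> dw.
  have cw : (fun t : R => t *: w + x) t @[t --> 0^'+] --> x.
    apply: cvg_at_right_filter; rewrite -[X in _ --> X]add0r -(scale0r w).
    by apply: cvgD; [exact: scalel_continuous|exact: cvg_cst].
  have qE : (t^-1 *: (total_energy (t *: w + x) - total_energy x)) @[t --> 0^'+]
      --> 'D_w total_energy x.
    by apply: cvg_dnbhs_at_right; exact: dE.
  have qh : (t^-1 *: (h (t *: w + x) - h x)) @[t --> 0^'+] --> 'D_w h x.
    by apply: cvg_dnbhs_at_right; exact: dh.
  have nE : \forall t \near 0^'+, t^-1 *: (total_energy (t *: w + x) - total_energy x) < 0.
    exact: (cvgr_lt _ qE).
  have n1 : \forall t \near 0^'+, action_range (t *: w + x) := cw _ (open_near action_range_open xI).
  have n2 : \forall t \near 0^'+, forall j, 0 <= (t *: w + x) ord0 j := cw _ (near_pos xp).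
  have n3 : \forall t \near 0^'+, Omega (t *: w + x) <-> h (t *: w + x) <= 0 := cw _ hO.
  rewrite -[leLHS](cvg_lim _ qh)//.
  apply: limr_le; first by apply/cvg_ex; exists ('D_w h x).
  near=> t.
  have t0 : 0 < t by near: t; exact: nbhs_right_gt.
  have yI : action_range (t *: w + x).
    by near: t.
  have yp : forall j, 0 <= (t *: w + x) ord0 j by near: t.
  have yE : total_energy (t *: w + x) <= b.
    have : t^-1 *: (total_energy (t *: w + x) - total_energy x) < 0 by near: t.
    by rewrite Eb pmulr_rlt0 ?invr_gt0// subr_lt0 => /ltW.
  have Oy : Omega (t *: w + x) by apply/toric_sublevelP.
  have : Omega (t *: w + x) <-> h (t *: w + x) <= 0 by near: t.
  move=> [/(_ Oy) hy _].
  by rewrite hx subr0 mulr_ge0_le0// invr_ge0 ltW.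
pose k j := 'D_(delta_mx ord0 j) total_energy x.
have k0 j : 0 < k j by exact: total_energy_derive.
have dEl c i j : 'D_(c *: delta_mx ord0 i - delta_mx ord0 j) total_energy x = c * k i - k j.
  have df := smooth_diff total_energy_smooth xI.
  by rewrite /k !deriveE// linearB linearZ.
have vE c i j : 'D_(c *: delta_mx ord0 i - delta_mx ord0 j) h x = c * v ord0 i - v ord0 j.
  rewrite hv.
  have coef l : (c *: delta_mx ord0 i - delta_mx ord0 j : 'rV[R]_n) ord0 l = c * (l == i)%:R - (l == j)%:R.
    by rewrite !mxE eqxx.
  under eq_bigr do rewrite coef mulrBr.
  rewrite big_split /= sumrN; congr (_ - _).
    rewrite (bigD1 i)//= eqxx big1 => [|l li]; first by rewrite addr0 mulr1 mulrC.
    by rewrite (negbTE li) !mulr0.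
  rewrite (bigD1 j)//= eqxx big1 => [|l lj]; first by rewrite addr0 mulr1.
  by rewrite (negbTE lj) mulr0.
have v0 j : 0 <= v ord0 j.
  have := inward (0 *: delta_mx ord0 j - delta_mx ord0 j).
  by rewrite dEl vE !mul0r !sub0r oppr_lt0 oppr_le0; apply.
have [i vi] : exists i, 0 < v ord0 i.
  apply: contrapT => nv; move/eqP: hw0; apply; rewrite hv big1// => l _.
  have -> : v ord0 l = 0; last by rewrite mul0r.
  apply/eqP; rewrite eq_le v0 andbT leNgt; apply/negP => vl; apply: nv; by exists l.
move=> j.
pose c := k j / (2 * k i).
have c0 : 0 < c by rewrite divr_gt0// mulr_gt0.
have := inward (c *: delta_mx ord0 i - delta_mx ord0 j).
rewrite dEl vE /c.
have -> : k j / (2 * k i) * k i - k j = - (k j / 2).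
  by move: (k j) (k i) (k0 i) => kj ki ki0; field; rewrite gt_eqF.
rewrite oppr_lt0 divr_gt0// => /(_ isT); rewrite subr_le0; apply: lt_le_trans.
exact: mulr_gt0.
Unshelve. all: by end_near. Qed.

End ToricSublevel.

Section LinearDerive.
Context {R : realType}.

Definition re_coord n (j : 'I_n) (z : Cn R n) : R := z.1 ord0 j.
Definition im_coord n (j : 'I_n) (z : Cn R n) : R := z.2 ord0 j.

Lemma re_coord_lin n j : linear (@re_coord n j).
Proof. by move=> c u v; rewrite /re_coord !mxE. Qed.

Lemma im_coord_lin n j : linear (@im_coord n j).
Proof. by move=> c u v; rewrite /im_coord !mxE. Qed.

Lemma re_coord_cont n j : continuous (@re_coord n j).
Proof.
move=> z; have h := smooth_cont (@smooth_coord R n setT j openT) (I : setT z.1).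
have c : (fst : 'rV[R]_n * 'rV[R]_n -> 'rV[R]_n) w @[w --> (z : 'rV[R]_n * 'rV[R]_n)] --> fst z by exact: cvg_fst.
exact: (cvg_comp _ _ c h).
Qed.

Lemma im_coord_cont n j : continuous (@im_coord n j).
Proof.
move=> z; have h := smooth_cont (@smooth_coord R n setT j openT) (I : setT z.2).
have c : (snd : 'rV[R]_n * 'rV[R]_n -> 'rV[R]_n) w @[w --> (z : 'rV[R]_n * 'rV[R]_n)] --> snd z by exact: cvg_snd.
exact: (cvg_comp _ _ c h).
Qed.

Lemma re_coord_smooth n j (U : set (Cn R n)) : open U -> smooth U (@re_coord n j).
Proof. by move=> oU; apply: smooth_lin => //; [exact: re_coord_lin|exact: re_coord_cont]. Qed.

Lemma im_coord_smooth n j (U : set (Cn R n)) : open U -> smooth U (@im_coord n j).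
Proof. by move=> oU; apply: smooth_lin => //; [exact: im_coord_lin|exact: im_coord_cont]. Qed.

Definition sqmod n (j : 'I_n) (z : Cn R n) : R := re_coord j z ^+ 2 + im_coord j z ^+ 2.

Lemma sqmod_smooth n j (U : set (Cn R n)) : open U -> smooth U (@sqmod n j).
Proof.
by move=> oU; apply: smooth_add; apply: smooth_exp; [exact: re_coord_smooth|exact: im_coord_smooth].
Qed.

Lemma sqmod_ge0 n j z : 0 <= @sqmod n j z.
Proof. by rewrite addr_ge0 ?sqr_ge0. Qed.

Lemma momentE n (z : Cn R n) j : moment z ord0 j = pi * sqmod j z.
Proof. by rewrite mxE. Qed.

Lemma moment_continuous n : continuous (@moment R n).
Proof.
move=> z; apply: (smooth_cont (U := setT)) => //; apply: smooth_row => [|j]; first exact: openT.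
apply: smooth_mul; first exact: (smooth_cst (pi : R) openT).
by apply: sqmod_smooth; exact: openT.
Qed.

End LinearDerive.

Section ToricSublevel.
Context {R : realType} {n : nat}.
Variables (L g : 'I_n -> R -> R) (a b' : 'I_n -> R) (b : R).
Hypotheses (b0 : 0 < b) (bb' : forall j, b < b' j) (a0 : forall j, a j < 0).
Hypothesis ip : forall j, inverse_pair (L j) (g j) (a j) (b' j).
Hypothesis L0 : forall j, L j 0 = 0.

Local Notation Omega := (toric_sublevel L b).

Definition toric_range : set (Cn R n) := [set z | forall j, sqmod j z < L j (b' j)].
Definition toric_energy (z : Cn R n) : R := \sum_(j < n) g j (sqmod j z).

Let pi0 : 0 < (pi : R) := pi_gt0 R.
Let piN0 : (pi : R) != 0. Proof. by rewrite gt_eqF. Qed.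

Lemma L_lower j : L j (a j) < 0.
Proof.
have b'0 : 0 < b' j by apply: lt_trans b0 (bb' j).
by have [|/andP[+ _] _] := ip_fun (ip j) (t := 0); rewrite ?L0 ?a0 ?b'0.
Qed.

Lemma toric_range_open : open toric_range.
Proof.
apply: open_all => j; apply: (open_preim (f := sqmod j) (A := [set x | x < L j (b' j)])).
  by apply: sqmod_smooth; exact: openT.
exact: open_lt.
Qed.

Lemma toric_range_lower z j : toric_range z -> L j (a j) < sqmod j z < L j (b' j).
Proof. by move=> zr; rewrite zr andbT (lt_le_trans (L_lower j)) ?sqmod_ge0. Qed.

Lemma toric_energy_smooth : smooth toric_range toric_energy.
Proof.
apply: smooth_sum => [|j]; first exact: toric_range_open.
apply: (smooth_comp1 (f := sqmod j)) (ip_inv_smooth (ip j)).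
  by move=> x /(toric_range_lower j); rewrite /= in_itv.
by apply: sqmod_smooth; exact: toric_range_open.
Qed.

Lemma toricP z : toric Omega z <-> toric_range z /\ toric_energy z <= b.
Proof.
have mE j : moment z ord0 j / pi = sqmod j z by rewrite momentE mulrC mulKf.
have tE : total_energy g (moment z) = toric_energy z by apply: eq_bigr => j _; rewrite mE.
split=> [/(toric_sublevelP b0 bb' a0 ip L0)[_ zr]|[zr zb]].
  by rewrite tE; split => // j; have /andP[_] := zr j; rewrite mE.
apply/(toric_sublevelP b0 bb' a0 ip L0); split.
- by move=> j; rewrite momentE mulr_ge0 ?sqmod_ge0// ltW.
- by move=> j; rewrite mE; exact: toric_range_lower.
- by rewrite tE.
Qed.

Lemma toric_closed : closed (toric Omega).
Proof.
apply: closed_comp => [z _|]; first exact: moment_continuous.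
exact: toric_sublevel_closed bb' a0 ip.
Qed.

Lemma toric_compact : compact (toric Omega).
Proof.
pose C j := L j b + 1.
pose I := fun j => `[- C j, C j]%classic : set R.
have box : compact [set r : 'rV[R]_n | forall j, I j (r ord0 j)].
  by apply: (@rV_compact R n I) => j; exact: segment_compact.
apply: (subclosed_compact toric_closed (compact_setX box box)) => z tz.
have bnd j : sqmod j z <= L j b.
  have [[r sr E] _] := (tz, 0%N).
  have E' : moment z ord0 j = pi * L j (r ord0 j) by rewrite -E mxE.
  rewrite momentE in E'; rewrite (mulfI piN0 E').
  have /andP[r0 rb] := simplex_coord j sr.
  move: rb; rewrite le_eqVlt => /orP[/eqP -> //|rb].
  by rewrite ltW// (inverse_pair_incr (ip j))// (lt_le_trans (a0 j)).
have sq1 (x : R) j : x ^+ 2 <= L j b -> - C j <= x <= C j.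
  by move=> h; rewrite /C; apply/andP; split; nra.
split=> j; rewrite /I /= in_itv /=; apply: sq1; apply: le_trans (bnd j).
  by rewrite lerDl sqr_ge0.
by rewrite lerDr sqr_ge0.
Qed.

(** The derivative of the total energy in the radial direction vanishes only at the
    origin, where the energy is 0 < b. *)
Lemma toric_smooth_boundary : has_smooth_boundary (toric Omega).
Proof.
move=> z [clz niz]; have tz : toric Omega z by exact: toric_closed.
have [zr zb] := (toricP z).1 tz.
have cE := smooth_cont toric_energy_smooth zr.
have Ez : toric_energy z = b.
  apply/eqP; rewrite eq_le zb leNgt; apply/negP => h; apply: niz.
  have hlt : \forall w \near z, toric_energy w < b by exact: (cvgr_lt _ cE).
  rewrite /interior; near=> w; apply/toricP; split.
    by near: w; exact: (open_near toric_range_open zr).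
  by apply: ltW; near: w.
exists (fun w => toric_energy w - b); split.
- exists toric_range; split; [exact: toric_range_open|by move=> _ ->|].
  apply: smooth_Ck; apply: smooth_minus; first exact: toric_energy_smooth.
  exact: (smooth_cst (b : R) toric_range_open).
- near=> w.
  have wr : toric_range w by near: w; exact: (open_near toric_range_open zr).
  by rewrite subr_le0; split=> [/toricP[]//|h]; apply/toricP.
exists z.
have ds j : is_derive z z (fun w => g j (sqmod j w)) (2 * sqmod j z * 'D_1 (g j) (sqmod j z)).
  have yI : `]L j (a j), L j (b' j)[%classic (sqmod j z).
    by rewrite /= in_itv /=; exact: toric_range_lower.
  have d1 := smooth_is_derive (ip_inv_smooth (ip j)) yI.
  have i1 := is_derive_lin z z (@re_coord_lin R n j) (@re_coord_cont R n j).
  have i2 := is_derive_lin z z (@im_coord_lin R n j) (@im_coord_cont R n j).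
  have i3 : is_derive z z (sqmod j) (2 * sqmod j z).
    apply: (is_derive_eq (is_deriveD (is_deriveX 2 i1) (is_deriveX 2 i2))).
    by rewrite /GRing.scale /= /sqmod; ring.
  have d2 := smooth_is_diff (@sqmod_smooth R n j setT openT) (I : setT z).
  have := is_diff_is_derive z (is_diff_comp d2 (is_derive_diff d1)).
  by move=> h; apply: (is_derive_eq h); rewrite /= (derive_val (is_derive := i3)).
have dT : is_derive z z (fun w => toric_energy w - b)
    (\sum_(j < n) (2 * sqmod j z * 'D_1 (g j) (sqmod j z))).
  have h := is_derive_sum ds.
  have fE : toric_energy = \sum_(j < n) (fun w => g j (sqmod j w)).
    by apply/funext => y; rewrite fct_sumE.
  have := is_deriveB h (is_derive_cst (b : R) z z); rewrite subr0 -fE.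
  by [].
rewrite (derive_val (is_derive := dT)).
have term j : 0 <= 2 * sqmod j z * 'D_1 (g j) (sqmod j z).
  rewrite mulr_ge0 ?mulr_ge0 ?sqmod_ge0// ltW// (inverse_pair_derive (ip j))//.
  exact: toric_range_lower.
rewrite gt_eqF// lt_neqAle sumr_ge0// andbT eq_sym psumr_eq0//.
apply/negP => /allP all0.
have s0 j : sqmod j z = 0.
  have /eqP/eqP := all0 j (mem_index_enum j).
  rewrite mulf_eq0 => /orP[|/eqP D0]; first by rewrite mulf_eq0 pnatr_eq0 /= => /eqP.
  have := inverse_pair_derive (ip j) (toric_range_lower j zr).
  by rewrite D0 ltxx.
have g00 j : g j 0 = 0.
  have b'0 : 0 < b' j by apply: lt_trans b0 (bb' j).
  by have [|_] := ip_fun (ip j) (t := 0); rewrite ?L0 ?a0 ?b'0.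
move: b0; rewrite -Ez /toric_energy big1 ?ltxx// => j _.
by rewrite s0 g00.
Unshelve. all: by end_near. Qed.

Theorem toric_sublevel_strictly_monotone : strictly_monotone Omega.
Proof.
split.
- exact: (toric_sublevel_domain b0 bb' a0 ip L0).
- exact: toric_compact.
- exact: toric_smooth_boundary.
- exact: (toric_sublevel_monotone b0 bb' a0 ip L0).
Qed.

End ToricSublevel.

(** * The cotangent bundle of the cylinder near a well *)
Section Cylinder.
Context {R : realType}.
Notation plane := (R * R)%type.

Definition sinh (x : R) : R := (expR x - expR (- x)) / 2.
Definition arsinh (u : R) : R := ln (u + Num.sqrt (1 + u ^+ 2)).

Lemma cosh_half (x : R) : cosh x = 1 + 2 * sinh (x / 2) ^+ 2.
Proof.
rewrite /cosh /sinh.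
have e1 : expR x = expR (x / 2) ^+ 2 by rewrite expr2 -expRD; congr expR; field.
have e2 : expR (- x) = expR (- (x / 2)) ^+ 2 by rewrite expr2 -expRD; congr expR; field.
have e3 : expR (x / 2) * expR (- (x / 2)) = 1 by rewrite -expRD subrr expR0.
rewrite e1 e2.
have -> : 1 + 2 * ((expR (x / 2) - expR (- (x / 2))) / 2) ^+ 2 =
  (expR (x / 2) ^+ 2 + expR (- (x / 2)) ^+ 2) / 2 + (1 - expR (x / 2) * expR (- (x / 2))) by field.
by rewrite e3 subrr addr0.
Qed.

Lemma sqrt1D_gt (u : R) : `|u| < Num.sqrt (1 + u ^+ 2).
Proof.
rewrite -(ltr_pXn2r (n := 2)) ?nnegrE ?sqrtr_ge0// sqr_sqrtr; last by rewrite addr_ge0 ?sqr_ge0.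
by rewrite real_normK ?num_real// ltrDr.
Qed.

Lemma arsinh_arg_gt0 (u : R) : 0 < u + Num.sqrt (1 + u ^+ 2).
Proof. by have := sqrt1D_gt u; rewrite ltr_norml => /andP[h _]; rewrite addrC -ltrBlDr sub0r ltrNl. Qed.

Lemma sinhK : cancel sinh arsinh.
Proof.
move=> x; rewrite /arsinh.
have h : Num.sqrt (1 + sinh x ^+ 2) = (expR x + expR (- x)) / 2.
  have e3 : expR x * expR (- x) = 1 by rewrite -expRD subrr expR0.
  have -> : 1 + sinh x ^+ 2 = ((expR x + expR (- x)) / 2) ^+ 2.
    have -> : ((expR x + expR (- x)) / 2) ^+ 2 =
      ((expR x - expR (- x)) / 2) ^+ 2 + expR x * expR (- x) by field.
    by rewrite e3 addrC.
  by rewrite sqrtr_sqr ger0_norm// divr_ge0// addr_ge0 ?expR_ge0.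
rewrite h /sinh.
have -> : (expR x - expR (- x)) / 2 + (expR x + expR (- x)) / 2 = expR x by field.
exact: expRK.
Qed.

Lemma arsinhK : cancel arsinh sinh.
Proof.
move=> u; rewrite /sinh /arsinh expRN lnK ?posrE ?arsinh_arg_gt0//.
have q2 : Num.sqrt (1 + u ^+ 2) ^+ 2 = 1 + u ^+ 2 by rewrite sqr_sqrtr// addr_ge0 ?sqr_ge0.
have q0 := arsinh_arg_gt0 u.
set q := Num.sqrt _ in q2 q0 *.
have -> : (u + q)^-1 = q - u.
  apply: (mulfI (lt0r_neq0 q0)); rewrite divff ?lt0r_neq0//.
  have -> : (u + q) * (q - u) = q ^+ 2 - u ^+ 2 by ring.
  by rewrite q2 addrK.
by field.
Qed.

Lemma is_derive_arsinh (u : R) : is_derive u 1 arsinh ((Num.sqrt (1 + u ^+ 2))^-1).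
Proof.
have q0 : 0 < 1 + u ^+ 2 by rewrite ltr_wpDr ?sqr_ge0.
have s0 : 0 < Num.sqrt (1 + u ^+ 2) by rewrite sqrtr_gt0.
have i1 : is_derive u 1 (fun u : R => 1 + u ^+ 2) (2 * u).
  by apply: is_derive_eq; rewrite /GRing.scale /=; ring.
have i2 := is_diff_derive (is_diff_comp (is_derive_diff i1) (is_derive_diff (is_derive1_sqrt q0))).
have i3 := is_deriveD (is_derive_id u (1 : R)) i2.
have i4 := is_diff_derive (is_diff_comp (is_derive_diff i3)
  (is_derive_diff (is_derive1_ln (arsinh_arg_gt0 u)))).
apply: (is_derive_eq i4) => /=.
have := arsinh_arg_gt0 u; set q := Num.sqrt _ in s0 * => h.
by field; rewrite !lt0r_neq0.
Qed.

Lemma arsinh_smooth : smooth setT arsinh.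
Proof.
have su : smooth setT (id : R -> R).
  exact: smooth_id openT.
apply: smooth_comp1 smooth_ln => [x _|]; first exact: arsinh_arg_gt0.
apply: smooth_add => //; apply: smooth_sqrt => [|x _]; last by rewrite ltr_wpDr ?sqr_ge0.
by apply: smooth_add; [exact: (smooth_cst (1 : R) openT)|exact: smooth_exp].
Qed.

Lemma sinh_smooth : smooth setT sinh.
Proof.
have su : smooth setT (id : R -> R).
  exact: smooth_id openT.
apply: smooth_mul; last exact: (smooth_cst (2^-1 : R) openT).
apply: smooth_minus; first exact: smooth_expR.
by apply: smooth_comp1 smooth_expR => //; exact: smooth_opp.
Qed.

Implicit Types w : @ambient R.

Lemma mu_smooth : smooth setT (fun w => w.1.1 : R).
Proof. by do 2!apply: smooth_proj1; exact: smooth_id openT. Qed.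
Lemma pmu_smooth : smooth setT (fun w => w.2.1 : R).
Proof. by apply: smooth_proj1; apply: smooth_proj2; exact: smooth_id openT. Qed.
Lemma pnu_smooth : smooth setT (fun w => w.2.2 : R).
Proof. by do 2!apply: smooth_proj2; exact: smooth_id openT. Qed.
Lemma cosnu_smooth : smooth setT (fun w => w.1.2.1 : R).
Proof. by apply: smooth_proj1; apply: smooth_proj2; apply: smooth_proj1; exact: smooth_id openT. Qed.
Lemma sinnu_smooth : smooth setT (fun w => w.1.2.2 : R).
Proof. by do 2!apply: smooth_proj2; apply: smooth_proj1; exact: smooth_id openT. Qed.

Variable s : R.
Hypothesis s1 : s ^+ 2 = 1.

(** The position variables are sinh (mu / 2) in the first factor and, in the second
    one, the sine of half the angle from the point with cosine [s], for [s] equal to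
    1 or -1. *)
Definition cyl_emb (z : plane * plane) : @ambient R :=
  ((2 * arsinh z.1.1, (s * (1 - 2 * z.2.1 ^+ 2), s * (2 * z.2.1 * Num.sqrt (1 - z.2.1 ^+ 2)))),
   (z.1.2, z.2.2)).

Definition cyl_chart (w : @ambient R) : plane * plane :=
  ((sinh (w.1.1 / 2), w.2.1), (s * w.1.2.2 / Num.sqrt (2 * (1 + s * w.1.2.1)), w.2.2)).

Lemma phase_spaceP (w : @ambient R) : phase_space w <-> w.1.2.1 ^+ 2 + w.1.2.2 ^+ 2 = 1.
Proof.
split=> [[mu [nu [pmu [pnu ->]]]]|]; first exact: cos2Dsin2.
move: w => [[mu [x y]] [pmu pnu]] /= /unit_angle[nu [cx sy]].
by exists mu, nu, pmu, pnu; rewrite /cot cx sy.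
Qed.

Lemma cyl_emb_phase z : z.2.1 ^+ 2 < 1 -> phase_space (cyl_emb z).
Proof.
move=> h; apply/phase_spaceP; rewrite /cyl_emb /=.
rewrite !exprMn sqr_sqrtr ?subr_ge0 ?ltW// s1; ring.
Qed.

Lemma cyl_embK z : z.2.1 ^+ 2 < 1 -> cyl_chart (cyl_emb z) = z.
Proof.
move=> h; have h0 : 0 < 1 - z.2.1 ^+ 2 by rewrite subr_gt0.
rewrite /cyl_chart /cyl_emb /=.
have -> : 2 * arsinh z.1.1 / 2 = arsinh z.1.1 by field.
rewrite arsinhK.
have -> : 2 * (1 + s * (s * (1 - 2 * z.2.1 ^+ 2))) = (2 * Num.sqrt (1 - z.2.1 ^+ 2)) ^+ 2.
  by rewrite exprMn sqr_sqrtr ?ltW// mulrA -expr2 s1; ring.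
have q0 : 0 < Num.sqrt (1 - z.2.1 ^+ 2) by rewrite sqrtr_gt0.
rewrite sqrtr_sqr ger0_norm ?mulr_ge0 ?ltW//.
have -> : s * (s * (2 * z.2.1 * Num.sqrt (1 - z.2.1 ^+ 2))) /
    (2 * Num.sqrt (1 - z.2.1 ^+ 2)) = s ^+ 2 * z.2.1 by field; rewrite gt_eqF.
by rewrite s1 mul1r; case: (z) => [[? ?] [? ?]].
Qed.

Lemma cyl_chart_sqr1 w : (cyl_chart w).1.1 ^+ 2 = (cosh w.1.1 - 1) / 2.
Proof. by rewrite /= (cosh_half w.1.1); field. Qed.

Lemma cyl_chart_sqr2 w : phase_space w -> 0 < 1 + s * w.1.2.1 ->
  (cyl_chart w).2.1 ^+ 2 = (1 - s * w.1.2.1) / 2.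
Proof.
move=> /phase_spaceP E h; rewrite /= expr_div_n exprMn s1 mul1r sqr_sqrtr ?mulr_ge0 ?ltW//.
have -> : w.1.2.2 ^+ 2 = (1 + s * w.1.2.1) * (1 - s * w.1.2.1).
  have -> : (1 + s * w.1.2.1) * (1 - s * w.1.2.1) = 1 - s ^+ 2 * w.1.2.1 ^+ 2 by ring.
  by rewrite s1 mul1r -E; ring.
by field; rewrite gt_eqF.
Qed.

Lemma cyl_chartK w : phase_space w -> 0 < 1 + s * w.1.2.1 -> cyl_emb (cyl_chart w) = w.
Proof.
move=> ph h; have E2 := cyl_chart_sqr2 ph h.
rewrite /cyl_emb E2.
have -> : 1 - (1 - s * w.1.2.1) / 2 = (Num.sqrt (2 * (1 + s * w.1.2.1)) / 2) ^+ 2.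
  by rewrite expr_div_n sqr_sqrtr ?mulr_ge0 ?ltW//; field.
have q0 : 0 < Num.sqrt (2 * (1 + s * w.1.2.1)) by rewrite sqrtr_gt0 mulr_gt0.
rewrite sqrtr_sqr ger0_norm ?divr_ge0 ?ltW// /cyl_chart /= sinhK.
have -> : s * (1 - 2 * ((1 - s * w.1.2.1) / 2)) = s ^+ 2 * w.1.2.1 by field.
have -> : s * (2 * (s * w.1.2.2 / Num.sqrt (2 * (1 + s * w.1.2.1))) *
  (Num.sqrt (2 * (1 + s * w.1.2.1)) / 2)) = s ^+ 2 * w.1.2.2 by field; rewrite gt_eqF.
rewrite s1 !mul1r.
have -> : 2 * (w.1.1 / 2) = w.1.1 by field.
by case: (w) => [[? [? ?]] [? ?]].
Qed.

End Cylinder.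

(** * Sublevel sets of a sum of two well energies *)
Section TwoWells.
Context {R : realType}.
Notation plane := (R * R)%type.
Implicit Types w : @ambient R.
Variables (s b : R) (Q1 Q2 : R -> R) (lo1 hi1' hi1 lo2 hi2' hi2 : R).

(** The squares of the position variables of the chart. *)
Definition height1 w : R := (cosh w.1.1 - 1) / 2.
Definition height2 w : R := (1 - s * w.1.2.1) / 2.
Definition cyl_energy w : R :=
  well_potential Q1 (height1 w) + w.2.1 ^+ 2 + (well_potential Q2 (height2 w) + w.2.2 ^+ 2).
Definition cyl_window : set (@ambient R) :=
  [set w | [/\ phase_space w, height1 w < hi1' & height2 w < hi2']].
Definition cyl_sublevel : set (@ambient R) := cyl_window `&` [set w | cyl_energy w <= b].
Definition cyl_level : set (@ambient R) := cyl_window `&` [set w | cyl_energy w = b].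

Hypothesis s1 : s ^+ 2 = 1.
Hypotheses (b0 : 0 < b) (lo10 : -1 <= lo1 < 0) (lo20 : lo2 < 0).
Hypotheses (hi1'0 : 0 < hi1' < hi1) (hi2'0 : 0 < hi2' < hi2) (hi21 : hi2 <= 1).
Hypotheses (sQ1 : smooth setT Q1) (sQ2 : smooth setT Q2).
Hypothesis Q10 : forall t, lo1 < t < hi1 -> 0 < Q1 t.
Hypothesis Q20 : forall t, lo2 < t < hi2 -> 0 < Q2 t.
Hypothesis P1 : forall t, lo1 < t < hi1 -> 0 < 'D_1 (well_potential Q1) t.
Hypothesis P2 : forall t, lo2 < t < hi2 -> 0 < 'D_1 (well_potential Q2) t.
Hypotheses (bP1 : b < well_potential Q1 hi1') (bP2 : b < well_potential Q2 hi2').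

(** For the position variables u1 and u2 of the chart, d mu = d1(u1^2) du1 and
    d nu = d2(u2^2) du2. *)
Let d1 (t : R) := 2 / Num.sqrt (1 + t).
Let d2 (t : R) := 2 / Num.sqrt (1 - t).

Let sid (A : set R) : open A -> smooth A (id : R -> R).
Proof. by move=> oA; apply: smooth_lin => // x; exact: cvg_id. Qed.

Let sd1 : smooth `]lo1, hi1[ d1.
Proof.
have oI : open (`]lo1, hi1[%classic : set R) by exact: interval_open.
have /andP[l1 _] := lo10.
have p t : `]lo1, hi1[%classic t -> 0 < 1 + t.
  by rewrite /= in_itv /= => /andP[h _]; lra.
apply: smooth_div; first exact: (smooth_cst (2 : R) oI).
  apply: smooth_sqrt => [|t /p//].
  by apply: smooth_add; [exact: (smooth_cst (1 : R) oI)|exact: sid].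
by move=> t /p h; rewrite gt_eqF// sqrtr_gt0.
Qed.

Let sd2 : smooth `]lo2, hi2[ d2.
Proof.
have oI : open (`]lo2, hi2[%classic : set R) by exact: interval_open.
have h21 := hi21.
have p t : `]lo2, hi2[%classic t -> 0 < 1 - t.
  by rewrite /= in_itv /= => /andP[_ h]; lra.
apply: smooth_div; first exact: (smooth_cst (2 : R) oI).
  apply: smooth_sqrt => [|t /p//].
  by apply: smooth_minus; [exact: (smooth_cst (1 : R) oI)|exact: sid].
by move=> t /p h; rewrite gt_eqF// sqrtr_gt0.
Qed.

Let d10 t : lo1 < t < hi1 -> 0 < d1 t.
Proof.
by move=> /andP[h _]; have /andP[l1 _] := lo10; rewrite divr_gt0// sqrtr_gt0; lra.
Qed.

Let d20 t : lo2 < t < hi2 -> 0 < d2 t.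
Proof. by move=> /andP[_ h]; have h21 := hi21; rewrite divr_gt0// sqrtr_gt0; lra. Qed.

Definition pick {T} (x y : T) (j : 'I_2) : T := if j == ord0 then x else y.

Let j1 : 'I_2 := lift ord0 ord0.

Let ord2P (j : 'I_2) : j = ord0 \/ j = j1.
Proof.
case: (unliftP ord0 j) => [k ->|->]; last by left.
by right; rewrite (ord1 k).
Qed.

Definition factor (j : 'I_2) (z : Cn R 2) : plane := (re_coord j z, im_coord j z).
Definition join (z1 z2 : plane) : Cn R 2 := (\row_j pick z1.1 z2.1 j, \row_j pick z1.2 z2.2 j).

Let factor0 z1 z2 : factor ord0 (join z1 z2) = z1.
Proof. by case: z1 => x y; rewrite /factor /re_coord /im_coord !mxE. Qed.
Let factor1 z1 z2 : factor j1 (join z1 z2) = z2.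
Proof. by case: z2 => x y; rewrite /factor /re_coord /im_coord !mxE. Qed.
Let joinK z : join (factor ord0 z) (factor j1 z) = z.
Proof.
case: z => x y; congr pair; apply/rowP => j; rewrite mxE.
  by case: (ord2P j) => ->.
by case: (ord2P j) => ->.
Qed.

Let factor_lin j : linear (factor j).
Proof. by move=> c u v; congr pair; [exact: re_coord_lin|exact: im_coord_lin]. Qed.

Let factor_smooth j (U : set (Cn R 2)) : open U -> smooth U (factor j).
Proof. by move=> oU; apply: smooth_pair; [exact: re_coord_smooth|exact: im_coord_smooth]. Qed.

Let factor_cont j : continuous (factor j).
Proof. by move=> z; exact: smooth_cont (factor_smooth j openT) (I : setT z). Qed.

Let factor_diff j z : is_diff z (factor j) (factor j).
Proof.
have d := smooth_is_diff (factor_smooth j openT) (I : setT z).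
apply: DiffDef; first by case: d.
apply/funext => v; have -> : 'd (factor j) z v = 'D_v (factor j) z by rewrite deriveE//; case: d.
have h : is_derive z v (factor j) (factor j v).
  apply: is_derive_lin; [exact: factor_lin|exact: factor_cont].
exact: derive_val.
Qed.

Let std_formE z u v : std_form z u v =
  area (factor ord0 u) (factor ord0 v) + area (factor j1 u) (factor j1 v).
Proof. by rewrite /std_form !big_ord_recl big_ord0 addr0. Qed.

Let canonical_formE (z u v : @ambient R) (x y w t x' y' w' t' : R) :
  u.1.1 = x -> u.2.1 = y -> u.2.2 = w -> dnu z u = t ->
  v.1.1 = x' -> v.2.1 = y' -> v.2.2 = w' -> dnu z v = t' ->
  canonical_form z u v = (x * y' - y * x') + (t * w' - w * t').
Proof. by rewrite /canonical_form => -> -> -> -> -> -> -> ->. Qed.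

Section Coordinates.
Variables (Phi1 Psi1 Phi2 Psi2 : plane -> plane) (L1 g1 L2 g2 : R -> R).
Variables (a1 b1 a2 b2 : R).
Hypotheses (a10 : a1 < 0) (bb1 : b < b1) (L10 : L1 0 = 0) (ip1 : inverse_pair L1 g1 a1 b1).
Hypotheses (a20 : a2 < 0) (bb2 : b < b2) (L20 : L2 0 = 0) (ip2 : inverse_pair L2 g2 a2 b2).
Hypothesis df1 : area_diffeo (well_domain Q1 hi1' b1) (disc (L1 b1)) Phi1 Psi1
  (fun z => d1 (z.1 ^+ 2)).
Hypothesis df2 : area_diffeo (well_domain Q2 hi2' b2) (disc (L2 b2)) Phi2 Psi2
  (fun z => d2 (z.1 ^+ 2)).
Hypothesis E1 : forall z, well_domain Q1 hi1' b1 z -> nrm2 (Phi1 z) = L1 (well_energy Q1 z).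
Hypothesis E2 : forall z, well_domain Q2 hi2' b2 z -> nrm2 (Phi2 z) = L2 (well_energy Q2 z).

Let L := pick L1 L2.
Let g := pick g1 g2.
Let a := pick a1 a2.
Let b' := pick b1 b2.

Let bb' j : b < b' j. Proof. by case: (ord2P j) => ->. Qed.
Let a0 j : a j < 0. Proof. by case: (ord2P j) => ->. Qed.
Let ip j : inverse_pair (L j) (g j) (a j) (b' j). Proof. by case: (ord2P j) => ->. Qed.
Let L0 j : L j 0 = 0. Proof. by case: (ord2P j) => ->. Qed.

Let X := toric (toric_sublevel L b).
Let A4 := toric_range L b'.
Let oA4 : open A4. Proof. exact: toric_range_open. Qed.

Let XP z : X z <-> A4 z /\ toric_energy g z <= b := toricP b0 bb' a0 ip L0 z.

Let teE z : toric_energy g z = g1 (sqmod ord0 z) + g2 (sqmod j1 z).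
Proof. by rewrite /toric_energy !big_ord_recl big_ord0 addr0. Qed.

Let A4P z : A4 z <-> disc (L1 b1) (factor ord0 z) /\ disc (L2 b2) (factor j1 z).
Proof.
split=> [h|[h1 h2] j]; first by split; [exact: (h ord0)|exact: (h j1)].
by case: (ord2P j) => ->.
Qed.

Let well_energy_ge0 (Q : R -> R) (lo hi' hi : R) (z : plane) : lo < 0 -> hi' < hi ->
  (forall t, lo < t < hi -> 0 < Q t) -> z.1 ^+ 2 < hi' -> 0 <= well_energy Q z.
Proof.
move=> lo0 hh Q0 h.
have Qp : 0 < Q (z.1 ^+ 2).
  by apply: Q0; rewrite (lt_le_trans lo0 (sqr_ge0 _)) (lt_trans h hh).
apply: addr_ge0; last exact: sqr_ge0.
by apply: mulr_ge0; [apply: mulr_ge0 => //; exact: sqr_ge0|exact: ltW].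
Qed.

Let we1 z : z.1 ^+ 2 < hi1' -> 0 <= well_energy Q1 z.
Proof.
by have /andP[_ l] := lo10; have /andP[_ h] := hi1'0; exact: (well_energy_ge0 l h Q10).
Qed.

Let we2 z : z.1 ^+ 2 < hi2' -> 0 <= well_energy Q2 z.
Proof. by have /andP[_ h] := hi2'0; exact: (well_energy_ge0 lo20 h Q20). Qed.

Let Psi1E z : disc (L1 b1) z -> well_energy Q1 (Psi1 z) = g1 (nrm2 z).
Proof.
move=> dz; have [_ _ _ QP _] := df1; have [D E] := QP _ dz.
have [h1 h2] := D; rewrite -[in RHS]E E1//.
have [|_ ->] // := ip_fun ip1 (t := well_energy Q1 (Psi1 z)).
by rewrite h2 (lt_le_trans a10 (we1 h1)).
Qed.

Let Psi2E z : disc (L2 b2) z -> well_energy Q2 (Psi2 z) = g2 (nrm2 z).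
Proof.
move=> dz; have [_ _ _ QP _] := df2; have [D E] := QP _ dz.
have [h1 h2] := D; rewrite -[in RHS]E E2//.
have [|_ ->] // := ip_fun ip2 (t := well_energy Q2 (Psi2 z)).
by rewrite h2 (lt_le_trans a20 (we2 h1)).
Qed.

Let phi (z : Cn R 2) : @ambient R := cyl_emb s (Psi1 (factor ord0 z), Psi2 (factor j1 z)).
Let psi w : Cn R 2 := join (Phi1 (cyl_chart s w).1) (Phi2 (cyl_chart s w).2).

Let u2_lt1 z : disc (L2 b2) z -> (Psi2 z).1 ^+ 2 < 1.
Proof.
move=> dz; have [_ _ _ QP _] := df2; have [[h _] _] := QP _ dz.
have /andP[_ h'] := hi2'0; exact: lt_le_trans (lt_trans h h') hi21.
Qed.

Let height_emb z : height1 (cyl_emb s z) = z.1.1 ^+ 2 /\ height2 (cyl_emb s z) = z.2.1 ^+ 2.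
Proof.
split; rewrite /height1 /height2 /cyl_emb /=.
  have -> : cosh (2 * arsinh z.1.1) = 1 + 2 * z.1.1 ^+ 2.
    rewrite cosh_half; have -> : 2 * arsinh z.1.1 / 2 = arsinh z.1.1 by field.
    by rewrite arsinhK.
  by field.
by rewrite mulrA -expr2 s1; field.
Qed.

Let phiP z : A4 z -> cyl_window (phi z) /\ cyl_energy (phi z) = toric_energy g z.
Proof.
move=> /A4P[z1 z2].
have [_ _ _ QP1 _] := df1; have [[h1 _] _] := QP1 _ z1.
have [_ _ _ QP2 _] := df2; have [[h2 _] _] := QP2 _ z2.
have [e1 e2] := height_emb (Psi1 (factor ord0 z), Psi2 (factor j1 z)).
split; first by split; [exact/cyl_emb_phase/u2_lt1|rewrite e1|rewrite e2].
have -> : toric_energy g z = g1 (nrm2 (factor ord0 z)) + g2 (nrm2 (factor j1 z)) := teE z.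
by rewrite /cyl_energy e1 e2 -Psi1E// -Psi2E.
Qed.

Let window_cos w : cyl_window w -> 0 < 1 + s * w.1.2.1.
Proof.
by move=> [_ _ h]; have /andP[_ h'] := hi2'0; have h'' := hi21; rewrite /height2 in h; lra.
Qed.

Let chart_energy w : cyl_window w ->
  [/\ (cyl_chart s w).1.1 ^+ 2 = height1 w, (cyl_chart s w).2.1 ^+ 2 = height2 w &
   well_energy Q1 (cyl_chart s w).1 + well_energy Q2 (cyl_chart s w).2 = cyl_energy w].
Proof.
move=> hw; have [ph h1 h2] := hw.
have e1 := cyl_chart_sqr1 s w; have e2 := cyl_chart_sqr2 s1 ph (window_cos hw).
by split => //; rewrite /cyl_energy /well_energy e1 e2.
Qed.

Let phi_surj w : cyl_window w -> cyl_energy w <= b -> A4 (psi w) /\ phi (psi w) = w.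
Proof.
move=> hw hb; have [ph h1 h2] := hw.
have [e1 e2 e] := chart_energy hw.
have p1 : 0 <= well_energy Q1 (cyl_chart s w).1 by apply: we1; rewrite e1.
have p2 : 0 <= well_energy Q2 (cyl_chart s w).2 by apply: we2; rewrite e2.
have D1 : well_domain Q1 hi1' b1 (cyl_chart s w).1.
  by split; [rewrite e1|apply: le_lt_trans bb1; apply: le_trans hb; rewrite -e lerDl].
have D2 : well_domain Q2 hi2' b2 (cyl_chart s w).2.
  by split; [rewrite e2|apply: le_lt_trans bb2; apply: le_trans hb; rewrite -e lerDr].
have [_ _ PQ1 _ _] := df1; have [_ _ PQ2 _ _] := df2.
have [d1' k1] := PQ1 _ D1; have [d2' k2] := PQ2 _ D2.
split; first by apply/A4P; rewrite factor0 factor1.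
by rewrite /phi factor0 factor1 k1 k2 -surjective_pairing cyl_chartK// window_cos.
Qed.

Let phi_image : phi @` X = cyl_sublevel.
Proof.
apply/seteqP; split=> [_ [z /XP[zA zb] <-]|w [hw hb]].
  by have [h1 h2] := phiP zA; split => //=; rewrite h2.
have [h1 h2] := phi_surj hw hb; exists (psi w) => //; apply/XP; split => //.
by have [_ <-] := phiP h1; rewrite h2.
Qed.

Let phi_smooth : smooth A4 phi.
Proof.
have [_ sP1 _ QP1 _] := df1; have [_ sP2 _ QP2 _] := df2.
have c1 : smooth A4 (fun z => Psi1 (factor ord0 z)).
  by apply: smooth_comp22 sP1; [move=> z /A4P[]|exact: factor_smooth].
have c2 : smooth A4 (fun z => Psi2 (factor j1 z)).
  by apply: smooth_comp22 sP2; [move=> z /A4P[]|exact: factor_smooth].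
have c11 := smooth_proj1 c1.
have c12 := smooth_proj2 c1.
have c21 := smooth_proj1 c2.
have c22 := smooth_proj2 c2.
have k (r : R) : smooth A4 (cst r) by exact: smooth_cst.
have sv : smooth A4 (fun z => 1 - (Psi2 (factor j1 z)).1 ^+ 2).
  exact: smooth_minus (k 1) (smooth_exp 2 c21).
apply: smooth_pair; last exact: smooth_pair.
apply: smooth_pair.
  by apply: (smooth_mul (k 2)); apply: smooth_comp1 c11 arsinh_smooth.
apply: smooth_pair; apply: (smooth_mul (k s)).
  exact: smooth_minus (k 1) (smooth_mul (k 2) (smooth_exp 2 c21)).
apply: smooth_mul; first exact: smooth_mul (k 2) c21.
by apply: smooth_sqrt => // z /A4P[_ /u2_lt1]; rewrite subr_gt0.
Qed.

Let psi_smooth : exists N : set (@ambient R), cyl_sublevel `<=` N /\ smooth N psi.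
Proof.
pose N0 : set (@ambient R) := [set w | 0 < 1 + s * w.1.2.1].
have smu := @mu_smooth R; have spm := @pmu_smooth R; have spn := @pnu_smooth R.
have sx := @cosnu_smooth R; have sy := @sinnu_smooth R.
have kT (r : R) : smooth (setT : set (@ambient R)) (cst r) by apply: smooth_cst; exact: openT.
have sA : smooth setT (fun w => 1 + s * w.1.2.1).
  by apply: smooth_add; [exact: kT|apply: smooth_mul => //; exact: kT].
have oN0 : open N0 by exact: (open_preim sA open_gt0).
have sub0 f : smooth setT f -> smooth N0 (f : @ambient R -> R) by move=> sf; apply: smooth_subset sf.
have c1 : smooth N0 (fun w => (cyl_chart s w).1).
  apply: smooth_pair; last exact: sub0.
  apply: sub0; apply: smooth_comp1 (sinh_smooth (R := R)) => //.
  by apply: smooth_mul => //; exact: kT.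
have c2 : smooth N0 (fun w => (cyl_chart s w).2).
  apply: smooth_pair; last exact: sub0.
  have sA2 : smooth N0 (fun w => 2 * (1 + s * w.1.2.1)).
    by apply: sub0; apply: smooth_mul => //; exact: kT.
  apply: smooth_div.
  - by apply: sub0; apply: smooth_mul => //; exact: kT.
  - by apply: smooth_sqrt => // w w0; rewrite mulr_gt0.
  - by move=> w w0; rewrite gt_eqF// sqrtr_gt0 mulr_gt0.
pose N := N0 `&` (fun w => (cyl_chart s w).1) @^-1` well_domain Q1 hi1' b1
             `&` (fun w => (cyl_chart s w).2) @^-1` well_domain Q2 hi2' b2.
have oN : open N.
  have oD1 := @well_domain_open R Q1 hi1' sQ1 b1.
  have oD2 := @well_domain_open R Q2 hi2' sQ2 b2.
  rewrite openE => w [[w0 w1] w2]; rewrite /interior.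
  have n0 := open_near oN0 w0.
  have n1 := smooth_cont c1 w0 (open_near oD1 w1).
  have n2 := smooth_cont c2 w0 (open_near oD2 w2).
  near=> y; split; first split.
  - by near: y.
  - by near: y; exact: n1.
  - by near: y; exact: n2.
exists N; split.
  move=> w [hw hb]; have [e1 e2 e] := chart_energy hw; have [ph h1 h2] := hw.
  have p1 : 0 <= well_energy Q1 (cyl_chart s w).1 by apply: we1; rewrite e1.
  have p2 : 0 <= well_energy Q2 (cyl_chart s w).2 by apply: we2; rewrite e2.
  split; first split; first exact: window_cos.
    by split; [rewrite /= -/(cyl_chart s w) e1|apply: le_lt_trans bb1; apply: le_trans hb; rewrite -e lerDl].
  by split; [rewrite /= e2|apply: le_lt_trans bb2; apply: le_trans hb; rewrite -e lerDr].
have [sP1 _ _ _ _] := df1; have [sP2 _ _ _ _] := df2.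
have f1 : smooth N (fun w => Phi1 (cyl_chart s w).1).
  apply: (smooth_comp22 (A := well_domain Q1 hi1' b1)) sP1 => [w [[]]//|].
  by apply: smooth_subset c1 => // w [[]].
have f2 : smooth N (fun w => Phi2 (cyl_chart s w).2).
  apply: (smooth_comp22 (A := well_domain Q2 hi2' b2)) sP2 => [w []//|].
  by apply: smooth_subset c2 => // w [[]].
by apply: smooth_pair; apply: smooth_row => // j; case: (ord2P j) => ->;
  [exact: smooth_proj1 f1|exact: smooth_proj1 f2|exact: smooth_proj2 f1|exact: smooth_proj2 f2].
Unshelve. all: by end_near. Qed.

Let phi_form z u v : A4 z ->
  canonical_form (phi z) ('D_u phi z) ('D_v phi z) = std_form z u v.
Proof.
move=> zA; have [z1 z2] := (A4P z).1 zA.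
have [_ sP1 _ QP1 _] := df1; have [_ sP2 _ QP2 _] := df2.
have dP1 := is_diff_comp (factor_diff ord0 z) (smooth_is_diff sP1 z1).
have dP2 := is_diff_comp (factor_diff j1 z) (smooth_is_diff sP2 z2).
pose A (w : Cn R 2) := 'D_(factor ord0 w) Psi1 (factor ord0 z).
pose B (w : Cn R 2) := 'D_(factor j1 w) Psi2 (factor j1 z).
have i11 (w : Cn R 2) : is_derive z w (fun z => (Psi1 (factor ord0 z)).1) (A w).1.
  exact: (@is_derive_proj1 R (Cn R 2) R R _ _ z w dP1).
have i12 (w : Cn R 2) : is_derive z w (fun z => (Psi1 (factor ord0 z)).2) (A w).2.
  exact: (@is_derive_proj2 R (Cn R 2) R R _ _ z w dP1).
have i21 (w : Cn R 2) : is_derive z w (fun z => (Psi2 (factor j1 z)).1) (B w).1.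
  exact: (@is_derive_proj1 R (Cn R 2) R R _ _ z w dP2).
have i22 (w : Cn R 2) : is_derive z w (fun z => (Psi2 (factor j1 z)).2) (B w).2.
  exact: (@is_derive_proj2 R (Cn R 2) R R _ _ z w dP2).
have sPf1 : smooth A4 (fun z => Psi1 (factor ord0 z)).
  by apply: smooth_comp22 sP1; [move=> y /A4P[]|exact: factor_smooth].
have sPf2 : smooth A4 (fun z => Psi2 (factor j1 z)).
  by apply: smooth_comp22 sP2; [move=> y /A4P[]|exact: factor_smooth].
have D1 := smooth_diff (smooth_proj1 sPf1) zA.
have D2 := smooth_diff (smooth_proj1 sPf2) zA.
set U1 := (Psi1 (factor ord0 z)).1; set V1 := (Psi2 (factor j1 z)).1.
have V1lt : 0 < 1 - V1 ^+ 2 by rewrite subr_gt0; exact: u2_lt1.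
have q0 : 0 < Num.sqrt (1 - V1 ^+ 2) by rewrite sqrtr_gt0.
have q2 : Num.sqrt (1 - V1 ^+ 2) ^+ 2 = 1 - V1 ^+ 2 by rewrite sqr_sqrtr// ltW.
pose q := Num.sqrt (1 - V1 ^+ 2).
have iar (w : Cn R 2) : is_derive z w (fun z => arsinh (Psi1 (factor ord0 z)).1)
    ((A w).1 * (Num.sqrt (1 + U1 ^+ 2))^-1).
  exact: is_derive_chain D1 (i11 w) (is_derive_arsinh U1).
have ixx (w : Cn R 2) : is_derive z w (fun z => s * (1 - 2 * (Psi2 (factor j1 z)).1 ^+ 2))
    ((B w).1 * (- (4 * s * V1))).
  have h1 : is_derive V1 1 (fun t : R => s * (1 - 2 * t ^+ 2)) (- (4 * s * V1)).
    by apply: is_derive_eq; rewrite /GRing.scale /=; ring.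
  exact: is_derive_chain D2 (i21 w) h1.
have iyy (w : Cn R 2) : is_derive z w (fun z => s * (2 * (Psi2 (factor j1 z)).1 *
    Num.sqrt (1 - (Psi2 (factor j1 z)).1 ^+ 2)))
    ((B w).1 * (s * (2 * q - 2 * V1 ^+ 2 / q))).
  have h1 : is_derive V1 1 (fun t : R => 1 - t ^+ 2) (- (2 * V1)).
    by apply: is_derive_eq; rewrite /GRing.scale /=; ring.
  have h2 := is_diff_derive (is_diff_comp (is_derive_diff h1) (is_derive_diff (is_derive1_sqrt V1lt))).
  have h2' : is_derive V1 1 (fun t : R => Num.sqrt (1 - t ^+ 2)) (- (V1 / q)).
    by apply: (is_derive_eq h2) => /=; rewrite -/q; field; rewrite gt_eqF.
  have h3 : is_derive V1 1 (fun t : R => 2 * t) 2.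
    by apply: is_derive_eq; rewrite /GRing.scale /=; ring.
  have h4 := @is_deriveZ R R R _ s V1 1 _ (is_deriveM h3 h2').
  have h5 : is_derive V1 1 (fun t : R => s * (2 * t * Num.sqrt (1 - t ^+ 2)))
      (s * (2 * q - 2 * V1 ^+ 2 / q)).
    by apply: (is_derive_eq h4); rewrite /GRing.scale /= -/q; field; rewrite gt_eqF.
  exact: is_derive_chain D2 (i21 w) h5.
have D (w : Cn R 2) : 'D_w phi z =
  ((2 * ((A w).1 * (Num.sqrt (1 + U1 ^+ 2))^-1),
    ((B w).1 * (- (4 * s * V1)), (B w).1 * (s * (2 * q - 2 * V1 ^+ 2 / q)))),
   ((A w).2, (B w).2)).
  have i0 : is_derive z w (fun z => 2 * arsinh (Psi1 (factor ord0 z)).1)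
      (2 * ((A w).1 * (Num.sqrt (1 + U1 ^+ 2))^-1)) := @is_deriveZ R (Cn R 2) R _ 2 z w _ (iar w).
  have h := is_derive_pair (is_derive_pair i0 (is_derive_pair (ixx w) (iyy w)))
    (is_derive_pair (i12 w) (i22 w)).
  exact: (derive_val (is_derive := h)).
have a1' := area_diffeo_inv df1 (factor ord0 u) (factor ord0 v) z1.
have a2' := area_diffeo_inv df2 (factor j1 u) (factor j1 v) z2.
rewrite -/(A u) -/(A v) -/U1 /d1 in a1'.
rewrite -/(B u) -/(B v) -/V1 -/q /d2 -/q in a2'.
have dnuE (w : Cn R 2) : dnu (phi z) ('D_w phi z) = 2 / q * (B w).1.
  rewrite /dnu !D /= -/V1 -/q.
  have V2 : V1 ^+ 2 = 1 - q ^+ 2 by rewrite q2; ring.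
  have -> : s * (1 - 2 * V1 ^+ 2) * ((B w).1 * (s * (2 * q - 2 * V1 ^+ 2 / q))) -
    s * (2 * V1 * q) * ((B w).1 * - (4 * s * V1)) =
    s ^+ 2 * ((1 - 2 * V1 ^+ 2) * (2 * q - 2 * V1 ^+ 2 / q) + 8 * V1 ^+ 2 * q) * (B w).1.
    by field; rewrite gt_eqF.
  by rewrite s1 V2; field; rewrite gt_eqF.
have E11 (w : Cn R 2) : ('D_w phi z).1.1 = 2 * ((A w).1 * (Num.sqrt (1 + U1 ^+ 2))^-1).
  by rewrite D.
have E21 (w : Cn R 2) : ('D_w phi z).2.1 = (A w).2 by rewrite D.
have E22 (w : Cn R 2) : ('D_w phi z).2.2 = (B w).2 by rewrite D.
clearbody A B.
transitivity (2 / Num.sqrt (1 + U1 ^+ 2) * area (A u) (A v) + 2 / q * area (B u) (B v)).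
  rewrite (canonical_formE (E11 u) (E21 u) (E22 u) (dnuE u) (E11 v) (E21 v) (E22 v) (dnuE v)).
  move: (A u) (A v) (B u) (B v) => Au Av Bu Bv.
  by rewrite /area; ring.
by rewrite a1' a2' std_formE.
Qed.

Let psiK z : A4 z -> psi (phi z) = z.
Proof.
move=> /A4P[z1 z2]; have [_ _ _ QP1 _] := df1; have [_ _ _ QP2 _] := df2.
rewrite /psi /phi cyl_embK ?u2_lt1//=.
by rewrite (QP1 _ z1).2 (QP2 _ z2).2 joinK.
Qed.

Lemma cyl_symplectomorphic : symplectomorphic X std_form cyl_sublevel canonical_form.
Proof.
exists phi, psi; split.
- exists A4; split => //; first by move=> z /XP[].
  exact: smooth_Ck phi_smooth.
- have [N [sN psN]] := psi_smooth; exists N; split => //; first by case: psN.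
  exact: smooth_Ck psN.
- exact: phi_image.
- by move=> z /XP[zA _]; exact: psiK.
- by move=> z u v /XP[zA _]; exact: phi_form.
Qed.

Let phi_within (A : set (Cn R 2)) : A `<=` A4 -> {within A, continuous phi}.
Proof. by move=> AA; apply: continuous_within => z /AA zA; exact: smooth_cont phi_smooth zA. Qed.

Let X_sub : X `<=` A4. Proof. by move=> z /XP[]. Qed.

Lemma cyl_sublevel_compact : compact cyl_sublevel.
Proof.
rewrite -phi_image; apply: continuous_compact; first exact: phi_within.
exact: toric_compact bb' a0 ip.
Qed.

Let sqmodZ j (c : R) (z : Cn R 2) : sqmod j (c *: z) = c ^+ 2 * sqmod j z.
Proof. by rewrite /sqmod /re_coord /im_coord !mxE; ring. Qed.

Let LL j : L j (a j) < 0 := L_lower b0 bb' a0 ip L0 j.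

(** In the disc coordinates the sublevel set is star-shaped about the origin. *)
Lemma cyl_sublevel_connected : connected cyl_sublevel.
Proof.
rewrite -phi_image; apply: connected_continuous_connected; last exact: phi_within.
have incr j x y : 0 <= x -> x <= y -> y < L j (b' j) -> g j x <= g j y.
  move=> x0; rewrite le_eqVlt => /orP[/eqP ->//|xy] yb.
  have Ia (u : R) : 0 <= u -> u <= y -> L j (a j) < u < L j (b' j).
    by move=> u0 uy; rewrite (lt_le_trans (LL j) u0) (le_lt_trans uy yb).
  have [xa xE] := ip_inv (ip j) (Ia _ x0 (ltW xy)).
  have [ya yE] := ip_inv (ip j) (Ia _ (le_trans x0 (ltW xy)) (lexx y)).
  rewrite leNgt; apply/negP => h.
  have /andP[ay _] := ya; have /andP[_ xb] := xa.
  by have := inverse_pair_incr (ip j) ay h xb; rewrite xE yE ltNge (ltW xy).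
have gz j : g j 0 = 0.
  have b'0 : 0 < b' j by apply: lt_trans b0 (bb' j).
  by have [|_] := ip_fun (ip j) (t := 0); rewrite ?L0 ?a0.
have sq0 j : sqmod j (0 : Cn R 2) = 0 by rewrite /sqmod /re_coord /im_coord !mxE; ring.
have Lb j : 0 < L j (b' j).
  have b'0 : 0 < b' j by apply: lt_trans b0 (bb' j).
  by have [|/andP[_ +] _] := ip_fun (ip j) (t := 0); rewrite ?L0 ?a0.
apply: star_connected.
  apply/XP; split; first by move=> j; rewrite sq0.
  by rewrite /toric_energy big1 ?ltW// => j _; rewrite sq0.
move=> z c /XP[zA zb] /andP[c0 c1].
have le j : sqmod j (c *: z) <= sqmod j z.
  by rewrite sqmodZ ler_piMl ?sqmod_ge0// expr_le1.
apply/XP; split; first by move=> j; exact: le_lt_trans (le j) (zA j).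
apply: le_trans zb; apply: ler_sum => j _; apply: incr => //; exact: sqmod_ge0.
Qed.

(** The energy [b] is distributed over the two wells as b cos^2 and b sin^2, and in
    either factor the point runs over the circle of the given energy. *)
Let level_param (p : R * (R * R)) : Cn R 2 :=
  join (rot p.2.1 (Num.sqrt (L1 (b * cos p.1 ^+ 2)), 0))
       (rot p.2.2 (Num.sqrt (L2 (b * sin p.1 ^+ 2)), 0)).

Let polar_cont (T : topologicalType) (r t : T -> R) (p : T) :
  {for p, continuous r} -> {for p, continuous t} ->
  {for p, continuous (fun p => rot (t p) (Num.sqrt (r p), 0))}.
Proof.
move=> cr ct.
have cs : Num.sqrt (r q) @[q --> p] --> Num.sqrt (r p).
  exact: (cvg_comp _ _ cr (@sqrt_continuous _ _)).
have cc : cos (t q) @[q --> p] --> cos (t p) by exact: (cvg_comp _ _ ct (@continuous_cos _ _)).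
have csn : sin (t q) @[q --> p] --> sin (t p) by exact: (cvg_comp _ _ ct (@continuous_sin _ _)).
have c0 : (fun=> 0 : R) q @[q --> p] --> (0 : R) by exact: cvg_cst.
apply: cont_pair.
  exact: cvgB (cvgM cc cs) (cvgM csn c0).
exact: cvgD (cvgM csn cs) (cvgM cc c0).
Qed.

Let join_cont (T : topologicalType) (f1 f2 : T -> plane) (p : T) :
  {for p, continuous f1} -> {for p, continuous f2} -> {for p, continuous (fun p => join (f1 p) (f2 p))}.
Proof.
move=> c1 c2.
have sj : smooth setT (fun y : plane * plane => join y.1 y.2).
  have s1' : smooth setT (fun y : plane * plane => y.1) by apply: smooth_proj1; exact: smooth_id openT.
  have s2' : smooth setT (fun y : plane * plane => y.2) by apply: smooth_proj2; exact: smooth_id openT.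
  apply: smooth_pair; apply: smooth_row => [|j]; try exact: openT; case: (ord2P j) => -> /=.
  - exact: smooth_proj1 s1'.
  - exact: smooth_proj1 s2'.
  - exact: smooth_proj2 s1'.
  - exact: smooth_proj2 s2'.
have cj := smooth_cont sj (I : setT (f1 p, f2 p)).
exact: (cvg_comp _ _ (cont_pair c1 c2) cj).
Qed.

Let ip_cont (f h : R -> R) (x y t : R) : inverse_pair f h x y -> x < t < y -> {for t, continuous f}.
Proof. by move=> i xty; apply: smooth_cont (ip_smooth i) _; rewrite /= in_itv. Qed.

Let param_range (x y t : R) : x < 0 -> b < y -> 0 <= t <= 1 -> x < b * t < y.
Proof. by have h := b0; move=> x0 by' /andP[t0 t1]; apply/andP; split; nra. Qed.

Let cos01 (t : R) : 0 <= cos t ^+ 2 <= 1.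
Proof. by rewrite sqr_ge0 -(cos2Dsin2 t) lerDl sqr_ge0. Qed.

Let sin01 (t : R) : 0 <= sin t ^+ 2 <= 1.
Proof. by rewrite sqr_ge0 -(cos2Dsin2 t) lerDr sqr_ge0. Qed.

Let level_param_cont : continuous level_param.
Proof.
move=> p; have h1 := cos01 p.1; have h2 := sin01 p.1.
have cp1 : {for p, continuous (fun p : R * (R * R) => p.1)} by exact: cvg_fst.
have cp2 : {for p, continuous (fun p : R * (R * R) => p.2)} by exact: cvg_snd.
have cp21 : {for p, continuous (fun p : R * (R * R) => p.2.1)} by exact: (cvg_comp _ _ cp2 cvg_fst).
have cp22 : {for p, continuous (fun p : R * (R * R) => p.2.2)} by exact: (cvg_comp _ _ cp2 cvg_snd).
have cc : cos q.1 @[q --> p] --> cos p.1 by exact: (cvg_comp _ _ cp1 (@continuous_cos _ _)).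
have cs : sin q.1 @[q --> p] --> sin p.1 by exact: (cvg_comp _ _ cp1 (@continuous_sin _ _)).
have cb : (fun=> b) q @[q --> p] --> b by exact: cvg_cst.
apply: (@join_cont _
    (fun p : R * (R * R) => rot p.2.1 (Num.sqrt (L1 (b * cos p.1 ^+ 2)), 0))
    (fun p : R * (R * R) => rot p.2.2 (Num.sqrt (L2 (b * sin p.1 ^+ 2)), 0)) p);
  apply: polar_cont => //.
  have c : (b * cos q.1 ^+ 2) @[q --> p] --> b * cos p.1 ^+ 2 by exact: (cvgM cb (cvgM cc cc)).
  exact: (cvg_comp _ _ c (ip_cont ip1 (param_range a10 bb1 h1))).
have c : (b * sin q.1 ^+ 2) @[q --> p] --> b * sin p.1 ^+ 2 by exact: (cvgM cb (cvgM cs cs)).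
exact: (cvg_comp _ _ c (ip_cont ip2 (param_range a20 bb2 h2))).
Qed.

Let sqmod_join z1 z2 : sqmod ord0 (join z1 z2) = nrm2 z1 /\ sqmod j1 (join z1 z2) = nrm2 z2.
Proof.
by split; [rewrite -[in RHS](factor0 z1 z2)|rewrite -[in RHS](factor1 z1 z2)].
Qed.

Let nrm2_polar (t r : R) : 0 <= r -> nrm2 (rot t (Num.sqrt r, 0)) = r.
Proof. by move=> r0; rewrite nrm2_rot /nrm2 /= sqr_sqrtr// expr0n addr0. Qed.

Let level_paramP p : A4 (level_param p) /\ toric_energy g (level_param p) = b.
Proof.
have := param_range a10 bb1 (cos01 p.1); have := param_range a20 bb2 (sin01 p.1).
have p1 : 0 <= b * cos p.1 ^+ 2 by rewrite mulr_ge0 ?sqr_ge0// ltW.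
have p2 : 0 <= b * sin p.1 ^+ 2 by rewrite mulr_ge0 ?sqr_ge0// ltW.
move=> r2 r1.
have [/andP[_ l1] g1E] := ip_fun ip1 r1; have [/andP[_ l2] g2E] := ip_fun ip2 r2.
have q1 : 0 <= L1 (b * cos p.1 ^+ 2).
  by apply: (L_ge0 a0 ip L0 (j := ord0)); rewrite p1; case/andP: r1.
have q2 : 0 <= L2 (b * sin p.1 ^+ 2).
  by apply: (L_ge0 a0 ip L0 (j := j1)); rewrite p2; case/andP: r2.
have [e1 e2] := sqmod_join (rot p.2.1 (Num.sqrt (L1 (b * cos p.1 ^+ 2)), 0))
  (rot p.2.2 (Num.sqrt (L2 (b * sin p.1 ^+ 2)), 0)).
rewrite nrm2_polar// in e1; rewrite nrm2_polar// in e2.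
split; first by move=> j; case: (ord2P j) => ->; rewrite ?e1 ?e2.
by rewrite teE e1 e2 g1E g2E -mulrDr cos2Dsin2 mulr1.
Qed.

Let level_param_image : phi @` (level_param @` setT) = cyl_level.
Proof.
apply/seteqP; split=> [_ [_ [p _ <-] <-]|w [hw hb]].
  have [pA pE] := level_paramP p.
  by have [h1 h2] := phiP pA; split => //=; rewrite h2.
have hb' : cyl_energy w <= b by rewrite hb.
have [zA zw] := phi_surj hw hb'; have [_ he] := phiP zA.
exists (psi w) => //; move: (psi w) zA zw he => z zA zw; rewrite zw hb teE => he.
have r j := toric_range_lower b0 bb' a0 ip L0 j zA.
have ge j : 0 <= g j (sqmod j z).
  by have /andP[] : 0 <= g j (sqmod j z) < b' j
    by apply: (g_ge0 b0 bb' a0 ip L0); rewrite sqmod_ge0; case/andP: (r j).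
have [_ k1] := ip_inv ip1 (r ord0); have [_ k2] := ip_inv ip2 (r j1).
have f1 : 0 <= g1 (sqmod ord0 z) / b by rewrite divr_ge0 ?(ge ord0)// ltW.
have f2 : 0 <= g2 (sqmod j1 z) / b by rewrite divr_ge0 ?(ge j1)// ltW.
have [|t [ct st]] := unit_angle (a := Num.sqrt (g1 (sqmod ord0 z) / b)) (b := Num.sqrt (g2 (sqmod j1 z) / b)).
  by rewrite !sqr_sqrtr// -mulrDl -he divff// gt_eqF.
have [t1 h1] := polar (factor ord0 z); have [t2 h2] := polar (factor j1 z).
exists (t, (t1, t2)) => //.
rewrite /level_param /= ct st !sqr_sqrtr// !(mulrC b) !divfK ?gt_eqF// k1 k2.
by rewrite -[RHS]joinK h1 h2.
Qed.

Lemma cyl_level_connected : connected cyl_level.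
Proof.
rewrite -level_param_image; apply: connected_continuous_connected.
  apply: connected_continuous_connected; first exact: star_connected.
  by apply: continuous_within => p _; exact: level_param_cont.
apply: continuous_within => z [p _ <-].
by apply: smooth_cont phi_smooth _; have [] := level_paramP p.
Qed.

End Coordinates.
Theorem cyl_sublevel_toric : exists Omega : set 'rV[R]_2,
  [/\ strictly_monotone Omega,
      symplectomorphic (toric Omega) std_form cyl_sublevel canonical_form,
      compact cyl_sublevel, connected cyl_sublevel & connected cyl_level].
Proof.
have /andP[_ l1] := lo10; have /andP[h1 hh1] := hi1'0; have /andP[h2 hh2] := hi2'0.
have [Phi1 [Psi1 [L1 [g1 [a1 [b1 [a10 bb1 [L10 ip1] df1 E1]]]]]]] :=
  well_action_angle l1 h1 hh1 sQ1 sd1 Q10 d10 P1 b0 bP1.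
have [Phi2 [Psi2 [L2 [g2 [a2 [b2 [a20 bb2 [L20 ip2] df2 E2]]]]]]] :=
  well_action_angle lo20 h2 hh2 sQ2 sd2 Q20 d20 P2 b0 bP2.
exists (toric_sublevel (pick L1 L2) b); split.
- apply: (@toric_sublevel_strictly_monotone R 2 _ (pick g1 g2) (pick a1 a2) (pick b1 b2)) => // j;
  by case: (ord2P j) => ->.
- exact: (cyl_symplectomorphic a10 bb1 L10 ip1 a20 bb2 L20 ip2 df1 df2 E1 E2).
- exact: (cyl_sublevel_compact a10 bb1 L10 ip1 a20 bb2 L20 ip2 df1 df2 E1 E2).
- exact: (cyl_sublevel_connected a10 bb1 L10 ip1 a20 bb2 L20 ip2 df1 df2 E1 E2).
- exact: (cyl_level_connected a10 bb1 L10 ip1 a20 bb2 L20 ip2 df1 df2 E1 E2).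
Qed.

End TwoWells.

(** * Components of the energy level inside a window *)
Section Components.

(** A component is not split by the set [C], which is open and closed in [A]. *)
Lemma component_clopen {T : topologicalType} (A C W : set T) (x : T) : C x -> connected C ->
  closed C -> open W -> A `&` W = C -> connected_component A x = C.
Proof.
move=> Cx cC clC oW E; apply/seteqP; split; last first.
  by apply: connected_component_max => //; rewrite -E; exact: subIsetl.
have sub := @connected_component_sub _ A x.
have Ax : A x by move: Cx; rewrite -E => -[].
have /(_ (connected_component A x `&` C)) h := @component_connected _ A x.
rewrite -h; first exact: subIsetr.
- by exists x; split => //; exact: connected_component_refl.
- exists W => //; apply/seteqP; split=> y [h1 h2]; split => //.
    by move: h2; rewrite -E => -[].
  by rewrite -E; split => //; exact: sub.
- by exists C.
Qed.

End Components.

Section Margin.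
Context {R : realType}.
Variables (Q : R -> R) (hi b : R).
Hypotheses (sQ : smooth setT Q) (hi0 : 0 < hi).
Hypothesis P1 : forall t : R, 0 <= t < hi -> 0 < 'D_1 (well_potential Q) t.
Local Notation P := (well_potential Q).

Let dP (t : R) : is_derive t 1 P ('D_1 P t).
Proof. exact: smooth_is_derive (smooth_well_potential sQ) (I : setT t). Qed.

Lemma well_potential_derive0 : 'D_1 P 0 = 4 * Q 0.
Proof.
have h1 : is_derive (0 : R) 1 (fun t : R => 4 * t) 4.
  by apply: is_derive_eq; rewrite /GRing.scale /=; ring.
have h := is_deriveM h1 (smooth_is_derive sQ (I : setT 0)).
by rewrite (derive_val (is_derive := h)) /GRing.scale /=; ring.
Qed.

Lemma well_potential_incr (lo s t : R) : (forall t : R, lo < t < hi -> 0 < 'D_1 P t) ->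
  lo < s -> s < t -> t <= hi -> P s < P t.
Proof.
move=> P' ls st th; apply: (mvt_incr st) => [x _|x /andP[sx xt]]; first exact: dP.
by apply: P'; rewrite (lt_trans ls sx) (lt_le_trans xt th).
Qed.

(** By continuity the well extends a little beyond its bottom, to negative [t], so that
    the coordinates are defined on a neighbourhood of it, and the potential already
    exceeds [b] a little before the rim. *)
Lemma well_margin : 0 < b -> b < P hi -> exists lo hi' : R,
  [/\ -1 <= lo < 0, 0 < hi' < hi, forall t : R, lo < t < hi -> 0 < Q t,
      forall t : R, lo < t < hi -> 0 < 'D_1 P t & b < P hi'].
Proof.
move=> b0 bP.
have cP' := smooth_cont (smooth_derive (1 : R) (smooth_well_potential sQ)) (I : setT (0 : R)).
have P'0 : 0 < 'D_1 P 0 by apply: P1; rewrite lexx.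
have /nbhs_ballP[d /= d0 dB] : \forall t \near (0 : R), 0 < 'D_1 P t by exact: (cvgr_gt _ cP').
have [lo [l1 l0 ld]] : exists lo : R, [/\ -1 <= lo, lo < 0 & - d <= lo].
  have [dl|dg] := leP d 1; first by exists (- d); split; lra.
  by exists (-1); split; lra.
have P' t : lo < t < hi -> 0 < 'D_1 P t.
  move=> /andP[lt th]; have [t0|t0] := leP 0 t; first by apply: P1; rewrite t0.
  by apply: dB; rewrite /ball /= sub0r normrN ltr0_norm//; lra.
have hp := hi0.
have cP := smooth_cont (smooth_well_potential sQ) (I : setT hi).
have /nbhs_ballP[e /= e0 eB] : \forall t \near hi, b < P t by exact: (cvgr_gt _ cP).
have [hi' [h1 h2 h3]] : exists hi' : R, [/\ 0 < hi', hi' < hi & hi - hi' < e].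
  have [dl|dg] := leP e hi; first by exists (hi - e / 2); split; lra.
  by exists (hi / 2); split; lra.
exists lo, hi'; split => //; try by apply/andP.
- move=> t lth; have [t0 th] := andP lth.
  have P0 : P 0 = 0 by rewrite /well_potential mulr0 mul0r.
  have [t1|t1|->] := ltgtP t 0.
  + have := well_potential_incr P' t0 t1 (ltW hi0); rewrite P0 /well_potential => h.
    by move: h; rewrite -mulrA pmulr_rlt0// nmulr_rlt0.
  + have := well_potential_incr P' l0 t1 (ltW th); rewrite P0 /well_potential => h.
    by move: h; rewrite pmulr_rgt0// mulr_gt0.
  + by move: P'0; rewrite well_potential_derive0 pmulr_rgt0.
- by apply: eB; rewrite /ball /= gtr0_norm ?subr_gt0.
Qed.

End Margin.

Section WellComponent.
Context {R : realType}.
Implicit Types w : @ambient R.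
Variables (s b : R) (Q1 Q2 : R -> R) (hi1 hi2 : R).
Hypothesis s1 : s ^+ 2 = 1.
Hypotheses (b0 : 0 < b) (hi10 : 0 < hi1) (hi20 : 0 < hi2) (hi21 : hi2 <= 1).
Hypotheses (sQ1 : smooth setT Q1) (sQ2 : smooth setT Q2).
Hypothesis P1 : forall t : R, 0 <= t < hi1 -> 0 < 'D_1 (well_potential Q1) t.
Hypothesis P2 : forall t : R, 0 <= t < hi2 -> 0 < 'D_1 (well_potential Q2) t.
Hypotheses (bP1 : b < well_potential Q1 hi1) (bP2 : b < well_potential Q2 hi2).

Let E := cyl_energy s Q1 Q2.

Lemma height_ge0 w : phase_space w -> 0 <= height1 w /\ 0 <= height2 s w.
Proof.
move=> /phase_spaceP ph; split; first by rewrite /height1 -(cyl_chart_sqr1 s) sqr_ge0.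
rewrite /height2; have s2 := s1; apply: divr_ge0 => //.
have u2 : (s * w.1.2.1) ^+ 2 = w.1.2.1 ^+ 2 by rewrite exprMn s1 mul1r.
by move: (s * w.1.2.1) u2 => u u2; have := sqr_ge0 w.1.2.2; nra.
Qed.

Let kT (r : R) : smooth (setT : set (@ambient R)) (cst r).
Proof. by apply: smooth_cst; exact: openT. Qed.

Let sh1 : smooth setT (@height1 R).
Proof.
apply: smooth_mul; last exact: kT; apply: smooth_minus; last exact: kT.
apply: smooth_mul; last exact: kT; apply: smooth_add.
  exact: smooth_comp1 (mu_smooth (R := R)) smooth_expR.
by apply: smooth_comp1 smooth_expR => //; apply: smooth_opp; exact: mu_smooth.
Qed.

Let sh2 : smooth setT (@height2 R s).
Proof.
by apply: smooth_mul (kT _); apply: smooth_minus (kT _) _; apply: smooth_mul (kT _) (cosnu_smooth (R := R)).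
Qed.

Let sE : smooth setT E.
Proof.
have spm := @pmu_smooth R; have spn := @pnu_smooth R.
apply: smooth_add; apply: smooth_add; try exact: smooth_exp.
  by apply: smooth_comp1 sh1 (smooth_well_potential sQ1).
by apply: smooth_comp1 sh2 (smooth_well_potential sQ2).
Qed.

Let W : set (@ambient R) := [set w | height1 w < hi1 /\ height2 s w < hi2].

Let oW : open W.
Proof.
have -> : W = @height1 R @^-1` [set x | x < hi1] `&` @height2 R s @^-1` [set x | x < hi2] by [].
by apply: openI; apply: open_preim => //; exact: open_lt.
Qed.

(** The potentials increase up to the rims, where they exceed [b]; hence points of
    energy at most [b] in the window stay away from its edges, and the parts of the
    level set and of the sublevel set in the window are closed. *)
Theorem well_component : exists Omega : set 'rV[R]_2, strictly_monotone Omega /\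
  forall (S : set (@ambient R)) w, S w -> W w ->
    is_component S (@phase_space R `&` [set w | E w = b]) ->
  exists B, [/\ is_component B (@phase_space R `&` [set w | E w <= b]), compact B,
    boundary_in_phase_space B = S & symplectomorphic (toric Omega) std_form B canonical_form].
Proof.
have [lo1 [hi1' [l1 h1 Q10 P1' b1]]] := well_margin sQ1 hi10 P1 b0 bP1.
have [lo2 [hi2' [l2 h2 Q20 P2' b2]]] := well_margin sQ2 hi20 P2 b0 bP2.
have l20 : lo2 < 0 by case/andP: l2.
have [D [mD sy cpt cB cS]] :=
  cyl_sublevel_toric s1 b0 l1 l20 h1 h2 hi21 sQ1 sQ2 Q10 Q20 P1' P2' b1 b2.
exists D; split => // S w Sw Ww Scomp.
set B := cyl_sublevel _ _ _ _ _ _ in sy cpt cB.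
set Sb := cyl_level _ _ _ _ _ _ in cS.
have inwin v : phase_space v -> W v -> E v <= b -> cyl_window s hi1' hi2' v.
  move=> ph [v1 v2] vb; have [p1 p2] := height_ge0 ph.
  have /andP[l1' l1''] := l1; have /andP[h1' h1''] := h1; have /andP[h2' h2''] := h2.
  have Pge (Q : R -> R) lo hi t : lo < 0 -> (forall t : R, lo < t < hi -> 0 < Q t) -> 0 <= t -> t < hi ->
      0 <= well_potential Q t.
    move=> lo0 Qp t0 th; rewrite /well_potential mulr_ge0//; first exact: mulr_ge0.
    by apply/ltW/Qp; rewrite (lt_le_trans lo0 t0).
  have q1 := Pge Q1 lo1 hi1 _ l1'' Q10 p1 v1.
  have q2 := Pge Q2 lo2 hi2 _ l20 Q20 p2 v2.
  have pm := sqr_ge0 v.2.1; have pn := sqr_ge0 v.2.2.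
  rewrite /E /cyl_energy in vb.
  split => //; rewrite ltNge; apply/negP => h.
    have : well_potential Q1 hi1' <= well_potential Q1 (height1 v); last by lra.
    move: h; rewrite le_eqVlt => /orP[/eqP <- //|h].
    by apply/ltW/(well_potential_incr sQ1 P1' _ h (ltW v1)); rewrite (lt_trans l1'').
  have : well_potential Q2 hi2' <= well_potential Q2 (height2 s v); last by lra.
  move: h; rewrite le_eqVlt => /orP[/eqP <- //|h].
  by apply/ltW/(well_potential_incr sQ2 P2' _ h (ltW v2)); rewrite (lt_trans l20).
have BE : (@phase_space R `&` [set w | E w <= b]) `&` W = B.
  apply/seteqP; split=> v; first by move=> [[h3 h4] h5]; split => //; exact: inwin.
  move=> [[h3 h4 h5] h6]; split => //; split.
    by apply: lt_trans h4 _; case/andP: h1.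
  by apply: lt_trans h5 _; case/andP: h2.
have SE : (@phase_space R `&` [set w | E w = b]) `&` W = Sb.
  apply/seteqP; split=> v.
    by move=> [[h3 h4] h5]; split => //; apply: inwin => //; rewrite h4.
  move=> [[h3 h4 h5] h6]; split => //; split.
    by apply: lt_trans h4 _; case/andP: h1.
  by apply: lt_trans h5 _; case/andP: h2.
have clB : closed B by apply: compact_closed => //; exact: norm_hausdorff.
have SbB : Sb = B `&` E @^-1` [set b].
  apply/seteqP; split=> v; first by move=> [h3 h4]; split => //; split => //=; rewrite h4.
  by move=> [[h3 _] h4].
have cE : continuous E by move=> v; exact: smooth_cont sE (I : setT v).
have clS : closed Sb.
  rewrite SbB; apply: closedI => //; apply: closed_comp; last exact: closed_eq.
  by move=> v _; exact: cE.
have Sbw : S = Sb.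
  have [y Ay SA] := Scomp.
  have -> : S = connected_component (@phase_space R `&` [set w | E w = b]) w.
    by rewrite [LHS]SA; apply: same_connected_component; rewrite -SA.
  have Sbw : Sb w by rewrite -SE; split => //; move: Sw; rewrite SA => /connected_component_sub.
  exact: component_clopen Sbw cS clS oW SE.
have Sbw' : Sb w by rewrite -Sbw.
have Bw : B w by move: Sbw'; rewrite SbB => -[].
exists B; split => //.
- exists w; first by move: Bw; rewrite -BE => -[].
  exact/esym/(component_clopen Bw cB clB oW BE).
rewrite Sbw SbB /boundary_in_phase_space -(closure_id B).1//.
apply/seteqP; split=> v [Bv hv]; split => //=.
  have [[ph _ _] vb] := Bv; apply/eqP; rewrite eq_le vb leNgt; apply/negP => lt.
  have n1 : \forall u \near v, E u < b by exact: (cvgr_lt _ (cE v)).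
  have n2 : \forall u \near v, W u.
    by apply: open_near => //; move: Bv; rewrite -BE => -[].
  have [u [[phu nB] [u1 u2]]] := hv _ (filterI n1 n2).
  by apply: nB; rewrite -BE; split => //; split => //; exact: ltW.
move=> N nN.
(* Points of higher energy are reached by increasing the modulus of [pmu]. *)
pose f (t : R) : @ambient R := (v.1, (v.2.1 + t, v.2.2)).
have cf : f t @[t --> (0 : R)] --> v.
  have c1 : {for (0 : R), continuous (fun=> v.1)} by exact: cvg_cst.
  have c3 : {for (0 : R), continuous (fun t : R => v.2.1 + t)}.
    by apply: cvgD; [exact: cvg_cst|exact: cvg_id].
  have c4 : {for (0 : R), continuous (fun _ : R => v.2.2)} by exact: cvg_cst.
  have e : f 0 = v by rewrite /f addr0 -!surjective_pairing.
  by rewrite -[X in _ --> X]e; exact: (cont_pair c1 (cont_pair c3 c4)).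
have /nbhs_ballP[d /= d0 dB] : \forall t \near (0 : R), N (f t) by exact: cf.
pose t : R := if 0 <= v.2.1 then d / 2 else - (d / 2).
exists (f t); split; last first.
  apply: dB; rewrite /ball /= sub0r normrN /t.
  by case: ifP => _; rewrite ?normrN gtr0_norm; lra.
have [[ph _ _] _] := Bv.
split; first by apply/phase_spaceP; exact: (phase_spaceP v).1 ph.
move=> [_ /=]; rewrite leNgt => /negP; apply.
rewrite -[X in X < _]hv /E /cyl_energy /height1 /height2 /=.
rewrite ltrD2r ltrD2l /t; case: ifP => h; first by nra.
by move/negbT: h; rewrite -ltNge => h; nra.
Qed.

End WellComponent.

(** * The quartic potential *)
Section Quartic.
Context {R : realType}.
Variables (eps al : R).
Hypothesis eps0 : 0 < eps.
Implicit Types M x y t : R.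

(** The potentials of both factors of the regularized Hamiltonian are quartics of this
    form, in cosh mu and up to sign in cos nu.  The derivative is [slope], and
    [chord] is the difference quotient between 1 and [x]. *)
Definition quartic M x : R := - (eps / 32) * x ^+ 4 + al / 2 * x ^+ 2 - M / 2 * x.
Definition slope M x : R := - (eps / 8) * x ^+ 3 + al * x - M / 2.
Definition chord M x : R := - (eps / 32) * (x ^+ 3 + x ^+ 2 + x + 1) + al / 2 * (x + 1) - M / 2.

Lemma chordE M x : (x - 1) * chord M x = quartic M x - quartic M 1.
Proof. by rewrite /chord /quartic; field. Qed.

Lemma slopeN M x : slope (- M) (- x) = - slope M x.
Proof. by rewrite /slope; ring. Qed.

Lemma is_derive_quartic M x : is_derive x 1 (quartic M) (slope M x).
Proof. by apply: is_derive_eq; rewrite /slope /GRing.scale /=; field. Qed.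

Lemma is_derive_slope M x : is_derive x 1 (slope M) (- (3 * eps / 8) * x ^+ 2 + al).
Proof. by apply: is_derive_eq; rewrite /GRing.scale /=; field. Qed.

Lemma chord_smooth M : smooth setT (chord M).
Proof.
have k (r : R) : smooth setT (cst r : R -> R) by exact: (smooth_cst r openT).
have sx : smooth setT (id : R -> R) by exact: smooth_id openT.
apply: smooth_minus (k _); apply: smooth_add; apply: (smooth_mul (k _)); last exact: smooth_add (k 1).
by apply: smooth_add (k 1); apply: smooth_add => //; apply: smooth_add; exact: smooth_exp.
Qed.

Lemma chord_affine_smooth M (sg : R) : smooth setT (fun t => chord M (1 + 2 * sg * t)).
Proof.
have k (r : R) : smooth setT (cst r : R -> R) by exact: (smooth_cst r openT).
apply: smooth_comp1 (chord_smooth M) => //.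
by apply: smooth_add (k 1) _; apply: smooth_mul (k _) _; exact: smooth_id openT.
Qed.

(** With x = 1 + 2 sg t, the well potential is 2 / sg times the increment of the
    quartic from 1 to x, and [sg] cancels when this is differentiated in t. *)
Lemma chord_well_derive M (sg t : R) :
  'D_1 (well_potential (fun t => chord M (1 + 2 * sg * t))) t = 4 * slope M (1 + 2 * sg * t).
Proof.
have h : is_derive t 1 (well_potential (fun t => chord M (1 + 2 * sg * t))) (4 * slope M (1 + 2 * sg * t)).
  by rewrite /well_potential /chord; apply: is_derive_eq; rewrite /slope /GRing.scale /=; field.
exact: (derive_val (is_derive := h)).
Qed.

Lemma slope_diff M x y :
  slope M y - slope M x = (y - x) * (al - eps / 8 * (x ^+ 2 + x * y + y ^+ 2)).
Proof. by rewrite /slope; ring. Qed.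

Lemma quartic_diff M x y : slope M x = 0 ->
  quartic M y - quartic M x = (y - x) ^+ 2 * (al / 2 - eps / 32 * (y ^+ 2 + 2 * x * y + 3 * x ^+ 2)).
Proof.
move=> e; have -> : M = 2 * (- (eps / 8) * x ^+ 3 + al * x).
  by move: e; rewrite /slope => e; lra.
by rewrite /quartic; field.
Qed.

Lemma slope_cont M x y : {within `[x, y], continuous (slope M)}.
Proof.
apply: (@derivable_itv_cont _ _ (fun x => - (3 * eps / 8) * x ^+ 2 + al)) => z _.
exact: is_derive_slope.
Qed.

Lemma outer_max M : 0 <= M -> 0 < slope M 1 -> exists2 xm, 1 < xm & slope M xm = 0.
Proof.
move=> M0 s0; have e0 := eps0.
have al0 : 0 < al by move: s0; rewrite /slope; lra.
(* Beyond [B] the cubic term dominates the linear one, as B^2 >= B. *)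
pose B := 1 + 8 * al / eps.
have q0 : 0 < 8 * al / eps by rewrite divr_gt0// mulr_gt0.
have B1 : 1 < B by rewrite /B; lra.
have qe : eps * (8 * al / eps) = 8 * al by field; rewrite gt_eqF.
have sB : slope M B <= 0.
  have -> : slope M B = B * (al - eps / 8 * B ^+ 2) - M / 2 by rewrite /slope; ring.
  have h1 : al <= eps / 8 * B ^+ 2.
    have h2 : 8 * al / eps <= B ^+ 2 by rewrite /B; nra.
    by nra.
  by have : B * (al - eps / 8 * B ^+ 2) <= 0; [nra|lra].
have [||xm] := @IVT _ (slope M) 1 B 0 (ltW B1).
- exact: slope_cont.
- by rewrite ge_min le_max sB (ltW s0) orbT.
rewrite in_itv /= => /andP[x1 _] e; exists xm => //.
by rewrite lt_neqAle x1 andbT; apply/eqP => E; move: s0; rewrite E e ltxx.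
Qed.

Section Outer.
Variables (M xm : R).
Hypotheses (s0 : 0 < slope M 1) (xm1 : 1 < xm) (sxm : slope M xm = 0).

(** This is the increasing function slope x / (xm - x) at x = 1; its sign decides the
    sign of the slope on both sides of [xm]. *)
Let bracket : 0 < eps / 8 * (1 + xm + xm ^+ 2) - al.
Proof.
have h := slope_diff M 1 xm; rewrite sxm in h; have h1 := s0; have h2 := xm1.
rewrite -(pmulr_rgt0 _ (x := xm - 1)); first by nra.
by rewrite subr_gt0.
Qed.

Lemma outer_slope_gt0 x : 1 <= x < xm -> 0 < slope M x.
Proof.
move=> /andP[x1 xx]; have h := slope_diff M x xm; rewrite sxm sub0r in h.
have -> : slope M x = (xm - x) * (eps / 8 * (x ^+ 2 + x * xm + xm ^+ 2) - al).
  by rewrite -[LHS]opprK h; ring.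
have h1 := bracket; have e0 := eps0; have h2 := xm1; apply: mulr_gt0; first by lra.
have : 1 + xm + xm ^+ 2 <= x ^+ 2 + x * xm + xm ^+ 2 by nra.
by nra.
Qed.

Lemma outer_slope_lt0 x : xm < x -> slope M x < 0.
Proof.
move=> xx; have h := slope_diff M xm x; rewrite sxm subr0 in h; rewrite h.
have h1 := bracket; have e0 := eps0; have h2 := xm1; rewrite pmulr_rlt0; last by lra.
have : 1 + xm + xm ^+ 2 <= xm ^+ 2 + xm * x + x ^+ 2 by nra.
by nra.
Qed.

Lemma outer_decr x y : xm <= x -> x <= y -> quartic M y <= quartic M x.
Proof.
move=> xx; rewrite le_eqVlt => /orP[/eqP -> //|xy]; rewrite -lerN2; apply: ltW.
apply: (@mvt_incr _ (fun x => - quartic M x) (fun x => - slope M x) x y xy) => z hz.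
  exact: is_deriveN (is_derive_quartic M z).
by rewrite oppr_gt0; apply: outer_slope_lt0; apply: le_lt_trans xx _; case/andP: hz.
Qed.

Lemma outer_incr x : 1 <= x -> x < xm -> quartic M 1 <= quartic M x.
Proof.
rewrite le_eqVlt => /orP[/eqP -> //|x1 xx]; apply: ltW.
apply: (@mvt_incr _ _ (slope M) 1 x x1) => z /andP[hz hz']; first exact: is_derive_quartic.
by apply: outer_slope_gt0; rewrite (ltW hz) (lt_trans hz').
Qed.

Lemma outer_maximal x : 1 <= x -> quartic M x <= quartic M xm.
Proof.
move=> x1; rewrite -subr_le0 quartic_diff//; have h1 := bracket; have e0 := eps0; have h2 := xm1.
apply: mulr_ge0_le0; first exact: sqr_ge0.
have h3 : 2 * (1 + xm + xm ^+ 2) <= x ^+ 2 + 2 * xm * x + 3 * xm ^+ 2 by nra.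
by nra.
Qed.

End Outer.

Lemma inner_min M : 0 < slope M 1 -> slope M (-1) < 0 -> exists2 y, -1 < y < 1 & slope M y = 0.
Proof.
move=> s1 s0; have [|||y] := @IVT _ (slope M) (-1) 1 0.
- by lra.
- exact: slope_cont.
- by rewrite ge_min le_max (ltW s0) (ltW s1) orbT.
rewrite in_itv /= => /andP[y0 y1] e; exists y => //; rewrite !lt_neqAle y0 y1 !andbT.
by apply/andP; split; apply/eqP => E; [move: s0; rewrite E e ltxx|move: s1; rewrite -E e ltxx].
Qed.

Section Inner.
Variables (M y : R).
Hypotheses (al_gt : 3 * eps / 8 < al) (yI : -1 < y < 1) (sy : slope M y = 0).

Lemma inner_slope_gt0 x : y < x <= 1 -> 0 < slope M x.
Proof.
move=> /andP[yx x1]; have /andP[y0 y1] := yI; have h := slope_diff M y x.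
rewrite sy subr0 in h; rewrite h; have e0 := eps0; have ha := al_gt.
apply: mulr_gt0; first by lra.
have : y ^+ 2 + y * x + x ^+ 2 <= 3 by nra.
by nra.
Qed.

Lemma inner_minimal x : -1 <= x <= 1 -> quartic M y <= quartic M x.
Proof.
move=> /andP[x0 x1]; have /andP[y0 y1] := yI; rewrite -subr_ge0 quartic_diff//.
have e0 := eps0; have ha := al_gt; apply: mulr_ge0; first exact: sqr_ge0.
have : x ^+ 2 + 2 * y * x + 3 * y ^+ 2 <= 6 by nra.
by nra.
Qed.

End Inner.

End Quartic.

(** * The regularized Lagrange problem *)
Section Regularized.
Context {R : realType}.
Variables (m1 m2 eps c : R).
Implicit Types w : @ambient R.

Let al := eps / 16 - c / 2.
Let M1 := m1 + m2.
Let M2 := m1 - m2.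
Let q1 (t : R) := chord eps al M1 (1 + 2 * 1 * t).
Let q2 (s t : R) := chord eps al (s * M2) (1 + 2 * (-1) * t).

Lemma K1_quartic mu pmu : K1 m1 m2 eps c mu pmu = pmu ^+ 2 / 2 + quartic eps al M1 (cosh mu) + c / 4.
Proof. by rewrite /K1 /quartic /al /M1; field. Qed.

Lemma K2_quartic nu pnu : K2 m1 m2 eps c nu pnu = pnu ^+ 2 / 2 - quartic eps al M2 (cos nu) - c / 4.
Proof. by rewrite /K2 /quartic /al /M2; field. Qed.

Lemma quartic1 M : quartic eps al M 1 = - c / 4 - M / 2.
Proof. by rewrite /quartic /al; field. Qed.

Lemma well_chord M (sg t : R) : sg ^+ 2 = 1 ->
  well_potential (fun t => chord eps al M (1 + 2 * sg * t)) t =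
  2 * sg * (quartic eps al M (1 + 2 * sg * t) - quartic eps al M 1).
Proof.
move=> s1; rewrite -chordE /well_potential.
set C := chord _ _ _ _.
have -> : 2 * sg * ((1 + 2 * sg * t - 1) * C) = 4 * sg ^+ 2 * t * C by ring.
by rewrite s1 mulr1.
Qed.

Let sgn_quartic s x : s ^+ 2 = 1 -> quartic eps al (s * M2) (s * x) = quartic eps al M2 x.
Proof.
move=> s1; have s4 : s ^+ 4 = 1 by rewrite -[4%N]/(2 * 2)%N exprM s1 expr1n.
rewrite /quartic !exprMn s4 s1 !mul1r; congr (_ - _).
have -> : s * M2 / 2 * (s * x) = s ^+ 2 * (M2 / 2 * x) by ring.
by rewrite s1 mul1r.
Qed.

(** The sum of the energies of the wells at their bottoms is -(M1 - s M2) / 2. *)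
Lemma K_cyl_energy s mu nu pmu pnu : s ^+ 2 = 1 ->
  cyl_energy s q1 (q2 s) (cot mu nu pmu pnu) = 2 * K m1 m2 eps c mu nu pmu pnu + (M1 - s * M2).
Proof.
move=> s1; rewrite /K K1_quartic K2_quartic /cyl_energy.
rewrite /q1 well_chord ?expr1n// /q2 well_chord; last by rewrite sqrrN expr1n.
have -> : 1 + 2 * 1 * height1 (cot mu nu pmu pnu) = cosh mu by rewrite /height1 /=; field.
have -> : 1 + 2 * (-1) * height2 s (cot mu nu pmu pnu) = s * cos nu.
  by rewrite /height2 /=; field.
by rewrite sgn_quartic// !quartic1 /=; field.
Qed.

Lemma hypersurface_cyl s : s ^+ 2 = 1 -> regularized_hypersurface m1 m2 eps c =
  @phase_space R `&` [set w | cyl_energy s q1 (q2 s) w = M1 - s * M2].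
Proof.
move=> s1; apply/seteqP; split=> [_ [mu [nu [pmu [pnu [-> k]]]]]|_ [[mu [nu [pmu [pnu ->]]]] /=]].
  by split; [exists mu, nu, pmu, pnu|rewrite /= K_cyl_energy// k mulr0 add0r].
rewrite K_cyl_energy// => h; exists mu, nu, pmu, pnu; split => //.
by lra.
Qed.

Lemma sublevel_cyl s : s ^+ 2 = 1 -> regularized_sublevel m1 m2 eps c =
  @phase_space R `&` [set w | cyl_energy s q1 (q2 s) w <= M1 - s * M2].
Proof.
move=> s1; apply/seteqP; split=> [_ [mu [nu [pmu [pnu [-> k]]]]]|_ [[mu [nu [pmu [pnu ->]]]] /=]].
  by split; [exists mu, nu, pmu, pnu|rewrite /= K_cyl_energy//; lra].
rewrite K_cyl_energy// => h; exists mu, nu, pmu, pnu; split => //.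
by lra.
Qed.

Lemma cosh_abs (x : R) : cosh `|x| = cosh x.
Proof. by case: (ger0P x) => // _; rewrite /cosh opprK addrC. Qed.

Lemma cosh_incr (x y : R) : 0 <= x -> x <= y -> cosh x <= cosh y.
Proof.
move=> x0 xy; rewrite /cosh ler_pM2r ?invr_gt0// -subr_ge0.
have ex : expR x * expR (- x) = 1 by rewrite -expRD subrr expR0.
have ey : expR y * expR (- y) = 1 by rewrite -expRD subrr expR0.
have h1 : expR x <= expR y by rewrite ler_expR.
have h2 : expR (- y) <= 1 by rewrite -expR0 ler_expR; lra.
have h3 : expR (- x) <= 1 by rewrite -expR0 ler_expR; lra.
have p1 := expR_ge0 (- x); have p2 := expR_ge0 (- y).
have -> : expR y + expR (- y) - (expR x + expR (- x)) =
   (expR y - expR x) * (1 - expR (- x) * expR (- y)).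
  transitivity (expR y - expR x + (expR x * expR (- x)) * expR (- y) - (expR y * expR (- y)) * expR (- x)).
    by rewrite ex ey; ring.
  by ring.
apply: mulr_ge0; first by lra.
by nra.
Qed.

Lemma cosh_ge1 (x : R) : 1 <= cosh x.
Proof. by rewrite cosh_half lerDl mulr_ge0// sqr_ge0. Qed.

Lemma cosh_continuous : continuous (@cosh R).
Proof.
move=> x; have k (r : R) : smooth setT (cst r : R -> R) by exact: (smooth_cst r openT).
have s : smooth setT (@cosh R).
  apply: smooth_mul (k _); apply: smooth_add; first exact: smooth_expR.
  by apply: smooth_comp1 smooth_expR => //; apply: smooth_opp; exact: smooth_id openT.
exact: smooth_cont s (I : setT x).
Qed.

(** From a point beyond the outer maximum one can escape to infinity inside the
    level set, by converting the decrease of the potential into momentum. *)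
Lemma escape xm mu nu pmu pnu S : (forall x y, xm <= x -> x <= y ->
    quartic eps al M1 y <= quartic eps al M1 x) -> xm <= cosh mu ->
  K m1 m2 eps c mu nu pmu pnu = 0 -> S (cot mu nu pmu pnu) ->
  is_component S (regularized_hypersurface m1 m2 eps c) -> ~ bounded_set S.
Proof.
move=> decr xmu K0 Sw [y Ay SA] [N [_ SN]].
pose sg : R := if 0 <= mu then 1 else -1.
pose sp : R := if 0 <= pmu then 1 else -1.
pose mut (t : R) := mu + sg * t ^+ 2.
pose V (x : R) := quartic eps al M1 (cosh x).
pose pt (t : R) := sp * Num.sqrt (pmu ^+ 2 + 2 * (V mu - V (mut t))).
pose f (t : R) : @ambient R := cot (mut t) nu (pt t) pnu.
have abs_mut t : `|mut t| = `|mu| + t ^+ 2.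
  have t2 := sqr_ge0 t.
  rewrite /mut /sg; case: (ger0P mu) => h; first by rewrite mul1r ger0_norm// addr_ge0.
  by rewrite mulN1r ler0_norm; lra.
have Vle t : V (mut t) <= V mu.
  apply: decr => //; rewrite -(cosh_abs mu) -(cosh_abs (mut t)) abs_mut.
  by apply: cosh_incr => //; rewrite lerDl sqr_ge0.
have pt2 t : pt t ^+ 2 = pmu ^+ 2 + 2 * (V mu - V (mut t)).
  rewrite /pt exprMn sqr_sqrtr; last first.
    by rewrite addr_ge0 ?sqr_ge0// mulr_ge0// subr_ge0.
  by rewrite /sp; case: ifP => _; rewrite ?sqrrN expr1n mul1r.
have Kf t : K m1 m2 eps c (mut t) nu (pt t) pnu = 0.
  by rewrite -K0 /K !K1_quartic pt2 /V; congr (_ + _); field.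
have f0 : f 0 = cot mu nu pmu pnu.
  have m0 : mut 0 = mu by rewrite /mut expr0n mulr0 addr0.
  rewrite /f /pt m0 subrr mulr0 addr0 sqrtr_sqr /sp; congr cot.
  by case: (ger0P pmu) => h; rewrite ?mul1r ?mulN1r ?opprK.
have cf : continuous f.
  have cid (x : R) : {for x, continuous (fun t : R => t)} by exact: cvg_id.
  have ck (r x : R) : {for x, continuous (fun _ : R => r)} by exact: cvg_cst.
  have cmu x : {for x, continuous mut}.
    by apply: (cvgD (ck mu x)); apply: (cvgM (ck sg x)); exact: (cvgM (cid x) (cid x)).
  have cV x : {for x, continuous (fun t => V (mut t))}.
    have cq (y' : R) : {for y', continuous (quartic eps al M1)}.
      apply: differentiable_continuous; apply/derivable1_diffP.
      by have := is_derive_quartic eps al M1 y' => -[].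
    exact: (cvg_comp _ _ (cvg_comp _ _ (cmu x) (@cosh_continuous _)) (cq _)).
  have cpt x : {for x, continuous pt}.
    apply: (cvgM (ck sp x)).
    have h : {for x, continuous (fun t => pmu ^+ 2 + 2 * (V mu - V (mut t)))}.
      by apply: (cvgD (ck _ x)); apply: (cvgM (ck 2 x)); exact: (cvgB (ck _ x) (cV x)).
    exact: (cvg_comp _ _ h (@sqrt_continuous _ _)).
  move=> x.
  have c1 : {for x, continuous (fun _ : R => (cos nu, sin nu))} by exact: cvg_cst.
  exact: (cont_pair (cont_pair (cmu x) c1) (cont_pair (cpt x) (ck pnu x))).
have sub : f @` setT `<=` S.
  have -> : S = connected_component (regularized_hypersurface m1 m2 eps c) (cot mu nu pmu pnu).
    by rewrite [LHS]SA; apply: same_connected_component; rewrite -SA.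
  apply: connected_component_max.
  - by exists 0.
  - by move=> _ [t _ <-]; exists (mut t), nu, (pt t), pnu.
  - apply: connected_continuous_connected; first exact: star_connected.
    by apply: continuous_within => x _; exact: cf.
pose t : R := `|N| + 2.
have t2 : 2 <= t by rewrite lerDr.
have h1 : N < t by rewrite (le_lt_trans (ler_norm N))// ltrDl.
have /= h2 := SN _ h1 (f t) (sub _ (imageP f I)).
have h3 : `|mut t| <= `|f t|.
  by rewrite /Num.norm /= !le_max lexx.
have : t < `|mut t| by rewrite abs_mut; have := normr_ge0 mu; nra.
by rewrite ltNge (le_trans h3 h2).
Qed.

Hypotheses (m2_gt0 : 0 < m2) (m2_le : m2 <= m1) (eps_gt0 : 0 < eps) (m2_ge : 3 * eps / 8 <= m2).
Variables (i1 i3 : R).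
Hypotheses (i1I : - 2^-1 < i1 < 2^-1) (i3I : i3 < - 2^-1).
Hypothesis c1 : m1 / (i1 + 2^-1) + m2 / (2^-1 - i1) + eps / 2 * i1 ^+ 2 < - c.
Hypothesis c3 : m1 / (- (i3 + 2^-1)) + m2 / (2^-1 - i3) + eps / 2 * i3 ^+ 2 < - c.

(** For x in ]0, 1[ one has 1 / x >= 1 and 1 / x + 1 / (1 - x) >= 4. *)
Let c_large : m1 + 3 * m2 < - c.
Proof.
have /andP[l r] := i1I; have hm := m2_le; have h2 := m2_gt0; have he := eps_gt0; have hc := c1.
pose x := i1 + 2^-1; have x0 : 0 < x by rewrite /x; lra.
have x1 : 0 < 1 - x by rewrite /x; lra.
have e : 2^-1 - i1 = 1 - x by rewrite /x; field.
rewrite e -/x in hc.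
have h3 : (m1 - m2) <= (m1 - m2) / x by rewrite ler_pdivlMr//; nra.
have h4 : 4 * m2 <= m2 / x + m2 / (1 - x).
  have -> : m2 / x + m2 / (1 - x) = m2 / (x * (1 - x)) by field; rewrite !gt_eqF.
  by rewrite ler_pdivlMr ?mulr_gt0//; have := sqr_ge0 (2 * x - 1); nra.
have h5 : m1 / x = (m1 - m2) / x + m2 / x by field; rewrite gt_eqF.
by have := sqr_ge0 i1; nra.
Qed.

Let al_gt : 3 * eps / 8 < al.
Proof. by have := c_large; have := m2_ge; have := m2_le; have := eps_gt0; rewrite /al; lra. Qed.

Let slope1 M : M <= M1 -> 0 < slope eps al M 1.
Proof.
have := c_large; have := m2_ge; have := m2_le; have := eps_gt0.
by rewrite /slope /al /M1; lra.
Qed.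

(** At zero momentum over the axis beyond e, the regularized Hamiltonian is
    (x^2 - 1) / 4 times the difference between H and c, where x = cosh mu.  It is
    positive at the third critical point, and the second summand is - M2 / 2 there. *)
Let barrier3 : exists2 x, 1 <= x & - c / 4 + M2 / 2 < quartic eps al M1 x.
Proof.
have h3 := i3I; have hc := c3; pose x := - 2 * i3.
have x1 : 1 < x by rewrite /x; lra.
have e : i3 = - (x / 2) by rewrite /x; field.
exists x; first exact: ltW.
have -> : quartic eps al M1 x = (x ^+ 2 - 1) / 4 * (- c - (m1 / (- (i3 + 2^-1)) + m2 / (2^-1 - i3) +
   eps / 2 * i3 ^+ 2)) - c / 4 + M2 / 2.
  by rewrite e /quartic /al /M1 /M2; field; apply/andP; split; apply/eqP => h0; lra.
have : 0 < (x ^+ 2 - 1) / 4 * (- c - (m1 / (- (i3 + 2^-1)) + m2 / (2^-1 - i3) + eps / 2 * i3 ^+ 2)).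
  by apply: mulr_gt0; [nra|rewrite subr_gt0].
lra.
Qed.

(** Between the two centres the factor is (1 - x^2) / 4, where x = cos nu, and the
    first summand is - M1 / 2. *)
Let barrier1 : exists2 x, -1 <= x <= 1 & quartic eps al M2 x < - c / 4 - M1 / 2.
Proof.
have /andP[l r] := i1I; have hc := c1; pose x := 2 * i1.
have [x0 x1] : -1 < x /\ x < 1 by rewrite /x; lra.
have e : i1 = x / 2 by rewrite /x; field.
exists x; first by rewrite !ltW.
have -> : quartic eps al M2 x = - ((1 - x ^+ 2) / 4 * (- c - (m1 / (i1 + 2^-1) + m2 / (2^-1 - i1) +
   eps / 2 * i1 ^+ 2))) - c / 4 - M1 / 2.
  by rewrite e /quartic /al /M1 /M2; field; apply/andP; split; apply/eqP => h0; lra.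
have : 0 < (1 - x ^+ 2) / 4 * (- c - (m1 / (i1 + 2^-1) + m2 / (2^-1 - i1) + eps / 2 * i1 ^+ 2)).
  by apply: mulr_gt0; [nra|rewrite subr_gt0].
lra.
Qed.

Theorem bounded_component_toric S :
  is_component S (regularized_hypersurface m1 m2 eps c) -> bounded_set S ->
  exists Omega : set 'rV[R]_2, strictly_monotone Omega /\ arises_as_boundary m1 m2 eps c S (toric Omega).
Proof.
move=> Scomp Sbnd; have h2 := m2_gt0; have h12 := m2_le.
have M10 : 0 <= M1 by rewrite /M1; lra.
have sl1 := slope1 (lexx M1).
have [xm xm1 sxm] := outer_max eps_gt0 M10 sl1.
have [y yI sy] : exists2 y, -1 < y < 1 & slope eps al M2 y = 0.
  apply: inner_min; first by apply: slope1; rewrite /M1 /M2; lra.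
  by rewrite -[M2]opprK slopeN oppr_lt0; apply: slope1; rewrite /M1 /M2; lra.
have [x3 x31 b3] := barrier3; have [x1 x1I b1] := barrier1.
have Qm := lt_le_trans b3 (outer_maximal eps_gt0 sl1 xm1 sxm x31).
have Qy := le_lt_trans (inner_minimal eps_gt0 al_gt yI sy x1I) b1.
have [w Sw Ew] : exists2 w, S w & regularized_hypersurface m1 m2 eps c w.
  by have [w Aw ->] := Scomp; exists w => //; exact: connected_component_refl.
have [mu [nu [pmu [pnu [wE K0]]]]] := Ew.
have cmu : cosh mu < xm.
  rewrite ltNge; apply/negP => h; rewrite wE in Sw.
  exact: (escape (outer_decr eps_gt0 sl1 xm1 sxm) h K0 Sw Scomp Sbnd).
have cnu : cos nu != y.
  apply/eqP => e; move: K0; rewrite /K K1_quartic K2_quartic e => K0.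
  have := outer_incr eps_gt0 sl1 xm1 sxm (cosh_ge1 mu) cmu; rewrite quartic1.
  by have := sqr_ge0 pmu; have := sqr_ge0 pnu; lra.
(* The component lies around m for [s = 1], around e for [s = -1]. *)
have [s [s1 sM sy1 scnu]] : exists s,
  [/\ s ^+ 2 = 1, - M2 <= s * M2 < M1, -1 < s * y < 1 & s * y < s * cos nu].
  have /andP[y0 y1] := yI; move: cnu; rewrite neq_lt => /orP[h|h].
    exists (-1); rewrite sqrrN expr1n !mulN1r; split => //.
    - by rewrite lexx /M1 /M2; lra.
    - by apply/andP; split; lra.
    - by rewrite ltrN2.
  by exists 1; rewrite expr1n !mul1r; split => //; apply/andP; split; rewrite /M1 /M2; lra.
have sys : slope eps al (s * M2) (s * y) = 0.
  have /orP[/eqP ->|/eqP ->] : (s == 1) || (s == -1) by rewrite -eqf_sqr s1 expr1n.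
    by rewrite !mul1r.
  by rewrite !mulN1r slopeN sy oppr0.
have /andP[sM1 sM2] := sM.
pose hi1 := (xm - 1) / 2; pose hi2 := (1 - s * y) / 2.
have /andP[sy0 sy2] := sy1.
have b0 : 0 < M1 - s * M2 by lra.
have [|||||||||D [mD HD]] := @well_component R s (M1 - s * M2) q1 (q2 s) hi1 hi2 s1 b0.
- by rewrite /hi1; lra.
- by rewrite /hi2; lra.
- by rewrite /hi2; lra.
- exact: chord_affine_smooth.
- exact: chord_affine_smooth.
- move=> t /andP[t0 th]; rewrite chord_well_derive mulr_gt0//.
  apply: (outer_slope_gt0 eps_gt0 sl1 xm1 sxm); rewrite /hi1 in th; lra.
- move=> t /andP[t0 th]; rewrite chord_well_derive mulr_gt0//.
  apply: (inner_slope_gt0 eps_gt0 al_gt sy1 sys); rewrite /hi2 in th; lra.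
- rewrite /q1 well_chord ?expr1n//.
  have -> : 1 + 2 * 1 * hi1 = xm by rewrite /hi1; field.
  by rewrite quartic1; lra.
- rewrite /q2 well_chord ?sqrrN ?expr1n//.
  have -> : 1 + 2 * (-1) * hi2 = s * y by rewrite /hi2; field.
  by rewrite quartic1 sgn_quartic//; lra.
exists D; split => //; have [||B [B1 B2 B3 B4]] := HD S w Sw.
- rewrite wE; split; first by rewrite /height1 /hi1 /=; lra.
  by rewrite /height2 /hi2 /=; lra.
- by rewrite -hypersurface_cyl.
by exists B; split => //; rewrite (sublevel_cyl s1).
Qed.

End Regularized.

Lemma critical_value_axis (R : realType) (m1 m2 eps i : R) :
  critical_value m1 m2 eps i = - (m1 / `|i + 2^-1| + m2 / `|i - 2^-1| + eps / 2 * i ^+ 2).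
Proof.
by rewrite /critical_value /H /U /= expr0n /= !addr0 mulr0 add0r !sqrtr_sqr.
Qed.

Unset Implicit Arguments.

Theorem theoremA (R : realType) (m1 m2 eps iota1 iota2 iota3 c : R)
  (m2_gt0 : 0 < m2) (m2_le_m1 : m2 <= m1) (m1_le : m1 <= 9 * m2)
  (eps_gt0 : 0 < eps / 2) (m1_ge : eps / 2 <= m1) (m2_ge : 3 * eps / 8 <= m2)
  (L123 : lagrange_points m1 m2 eps iota1 iota2 iota3)
  (c_lt : c < Num.min (Num.min (critical_value m1 m2 eps iota1)
                               (critical_value m1 m2 eps iota2))
                      (critical_value m1 m2 eps iota3))
  (S : set ambient)
  (S_comp : is_component S (regularized_hypersurface m1 m2 eps c))
  (S_bnd : bounded_set S) :
  exists Omega : set 'rV[R]_2,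
    strictly_monotone Omega /\
    arises_as_boundary m1 m2 eps c S (toric Omega).
Proof.
have [i1I _ i3I _] := L123; have /andP[i1l i1r] := i1I.
move: c_lt; rewrite !lt_min !critical_value_axis => /andP[/andP[c1 _] c3].
apply: (@bounded_component_toric R m1 m2 eps c m2_gt0 m2_le_m1 _ m2_ge iota1 iota3 i1I i3I) => //.
- by move: eps_gt0; lra.
- move: c1; rewrite ltrNr gtr0_norm; last by lra.
  by rewrite ltr0_norm ?opprB//; lra.
- move: c3; rewrite ltrNr ltr0_norm; last by lra.
  by rewrite ltr0_norm ?opprB//; lra.
Qed.
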